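(* Let $c\in\mathbb{R}$, $\alpha,\varepsilon>0$, $x_\ell<x_r$, and let $u_0$ be compactly supported in $[x_\ell,x_r]$. Assume that $$\frac{c}{2}+\varepsilon\left(\Re(\lambda_1^2(i\xi))-\frac{|\lambda_1(i\xi)|^2}{2}\right)-\alpha\,\Re(i\xi\lambda_1(i\xi))\ \ge\ 0\qquad\text{for all }\xi\in\mathbb{R}.$$ Then the problem $$\partial_t(u-\alpha\partial_{xx}u)+c\,\partial_xu+\varepsilon\,\partial_{xxx}u=0,\quad (t,x)\in(0,\infty)\times(x_\ell,x_r),\qquad u(0,x)=u_0(x),\quad x\in(x_\ell,x_r),$$ with, for all $t>0$, the boundary conditions $$\partial_xu(t,x_r)=\mathcal{L}^{-1}(\lambda_1(s))\ast u(t,x_r),\qquad \partial_{xx}u(t,x_r)=\mathcal{L}^{-1}(\lambda_1^2(s))\ast u(t,x_r),$$ $$\partial_{xx}u(t,x_\ell)+\mathcal{L}^{-1}\!\left(\lambda_1(s)-\frac{\alpha s}{\varepsilon}\right)\ast\partial_xu(t,x_\ell)+\mathcal{L}^{-1}\!\left(\lambda_1(s)^2-\frac{\alpha s}{\varepsilon}\lambda_1(s)\right)\ast u(t,x_\ell)+\frac{c}{\varepsilon}u(t,x_\ell)=0,$$ is $H^1$-stable. More precisely, for any $t>0$, the generalized kinetic energy satisfies $$\int_{x_\ell}^{x_r}\Big(u^2(t,x)+\alpha(\partial_xu)^2(t,x)\Big)\,dx\ \le\ \int_{x_\ell}^{x_r}\Big(u_0^2(x)+\alpha(\partial_xu_0)^2(x)\Big)\,dx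 .$$
   Context: For $\Re(s)>0$, $\lambda_1(s)$ denotes the unique root with negative real part of the cubic equation $s+c\lambda-\alpha s\lambda^2+\varepsilon\lambda^3=0$ in $\lambda$ (the other two roots have positive real part). For $\xi\in\mathbb{R}$, $\lambda_1(i\xi):=\lim_{\eta\to0^+}\lambda_1(\eta+i\xi)$. $\mathcal{L}$ denotes the Laplace transform in time with dual variable $s$, $\Re(s)>0$, and $\ast$ is convolution in time: for a symbol $m(s)$ and a function $g$ of $t\ge 0$ (extended by $0$ for $t<0$), $\mathcal{L}^{-1}(m(s))\ast g$ is the causal function or distribution of $t$ whose Laplace transform is $m(s)\,\mathcal{L}g(s)$. *)

(* Defs.v *)
From HB Require Import structures.
From mathcomp Require Import all_boot all_order all_algebra.
From mathcomp Require Import complex.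
From mathcomp Require Import all_classical all_reals all_analysis.

Set Implicit Arguments.
Unset Strict Implicit.
Unset Printing Implicit Defensive.

Import Order.TTheory GRing.Theory Num.Theory.
Import numFieldNormedType.Exports.

Local Open Scope classical_set_scope.
Local Open Scope ring_scope.
Local Open Scope complex_scope.

(* MathComp's generic Re and Im are valued in R[i]; these are valued in R. *)
Local Notation Re := complex.Re.
Local Notation Im := complex.Im.

Section Symbol.
Context {R : realType}.
Implicit Types (c alpha eps xi : R) (s l : R[i]).

Definition char_cubic c alpha eps s l : R[i] :=
  s + c%:C * l - alpha%:C * s * l ^+ 2 + eps%:C * l ^+ 3.

(* Meaningful for 0 < Re s, where such a root exists and is unique. *)
Definition lambda1 c alpha eps s : R[i] :=
  xget 0 [set l | char_cubic c alpha eps s l = 0 /\ Re l < 0].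

(* The boundary value at s = i xi. The limit is taken in the field R[i] with
   the topology of its norm (which MathComp-Analysis attaches to R[i]^o). *)
Definition lambda1_bnd c alpha eps xi : R[i] :=
  lim ((lambda1 c alpha eps (eta +i* xi) : R[i]^o) @[eta --> (0 : R)^'+]).

End Symbol.

Section Laplace.
Context {R : realType}.
Implicit Types (f g phi : R -> R) (m : R[i] -> R[i]) (T : (R -> R) -> R).
Let mu := @lebesgue_measure R.

(* Functions of time are extended by 0 to t < 0, whatever their values there. *)
Definition laplace f (s : R[i]) : R[i] :=
  (\int[mu]_(t in `[0, +oo[) (f t * (expR (- (Re s * t)) * cos (Im s * t))))
  -i* (\int[mu]_(t in `[0, +oo[) (f t * (expR (- (Re s * t)) * sin (Im s * t)))).

Definition laplace_transformable f : Prop :=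
  forall sigma : R, 0 < sigma ->
    mu.-integrable `[0, +oo[ (fun t => (f t * expR (- (sigma * t)))%:E).

Definition test_function (U : set R) phi : Prop :=
  (forall n t, derivable (derive1n n phi) t 1) /\
  exists2 K : set R, compact K /\ K `<=` U & forall t, ~ K t -> phi t = 0.

(* T, as a distribution on R, is the n-th distributional derivative of f
   (extended by 0 to t < 0), hence is causal with Laplace transform
   s ^ n * laplace f s. Every causal distribution whose Laplace transform is
   defined on Re s > 0 and has at most polynomial growth on each half-plane
   Re s >= sigma > 0, with a degree independent of sigma, has this form. *)
Definition is_causal_derivative n f T : Prop :=
  laplace_transformable f /\
  forall phi, test_function setT phi ->
    T phi = (-1) ^+ n * \int[mu]_(t in `[0, +oo[) (f t * derive1n n phi t).

(* T = L^-1(m) * g *)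
Definition is_invL_conv m g T : Prop :=
  laplace_transformable g /\
  exists n f, is_causal_derivative n f T /\
    forall s : R[i], 0 < Re s -> s ^+ n * laplace f s = m s * laplace g s.

Definition pairing f phi : R := \int[mu]_(t in `]0, +oo[) (f t * phi t).

End Laplace.

Section Problem.
Context {R : realType}.
Implicit Types (c alpha eps xl xr : R) (u v : R -> R -> R).

Definition dx (k : nat) u : R -> R -> R := fun t x => derive1n k (u t) x.
Definition dt v : R -> R -> R := fun t x => derive1 (fun t' => v t' x) t.

Definition extends_continuously (A B : set (R * R)) v : Prop :=
  exists2 F : R * R -> R, {within B, continuous F} &
    forall t x, A (t, x) -> F (t, x) = v t x.

(* Space derivatives are computed in the open interval; their values at its
   end points are one-sided limits. *)
Definition trace_l xl v (t : R) : R := lim (v t x @[x --> xl^'+]).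
Definition trace_r xr v (t : R) : R := lim (v t x @[x --> xr^'-]).

Definition regular xl xr u : Prop :=
  [/\ {within `[0, +oo[ `*` `[xl, xr], continuous (fun p : R * R => u p.1 p.2)},
      (forall t x, 0 <= t -> xl < x < xr -> derivable (u t) x 1) /\
      extends_continuously (`[0, +oo[ `*` `]xl, xr[) (`[0, +oo[ `*` `[xl, xr])
        (dx 1 u),
      forall k t x, (k <= 2)%N -> 0 < t -> xl < x < xr ->
        derivable (dx k u t) x 1 /\ derivable (fun t' => dx k u t' x) t 1,
      forall k, (k <= 3)%N ->
        extends_continuously (`]0, +oo[ `*` `]xl, xr[)
          (`]0, +oo[ `*` `[xl, xr]) (dx k u) &
      forall k, (k <= 2)%N ->
        extends_continuously (`]0, +oo[ `*` `]xl, xr[)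
          (`]0, +oo[ `*` `[xl, xr]) (dt (dx k u))].

Definition solves_pde c alpha eps xl xr u : Prop :=
  forall t x, 0 < t -> xl < x < xr ->
    dt (fun t' x' => u t' x' - alpha * dx 2 u t' x') t x
      + c * dx 1 u t x + eps * dx 3 u t x = 0.

(* L^-1(m) * g is in general a distribution, so that the boundary conditions
   for t > 0 are equalities of distributions on ]0, +oo[. *)
Definition bc_right1 c alpha eps xr u : Prop :=
  exists2 T, is_invL_conv (lambda1 c alpha eps) (u ^~ xr) T &
    forall phi, test_function `]0, +oo[ phi ->
      pairing (trace_r xr (dx 1 u)) phi = T phi.

Definition bc_right2 c alpha eps xr u : Prop :=
  exists2 T, is_invL_conv (fun s => lambda1 c alpha eps s ^+ 2) (u ^~ xr) T &
    forall phi, test_function `]0, +oo[ phi ->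
      pairing (trace_r xr (dx 2 u)) phi = T phi.

Definition bc_left c alpha eps xl u : Prop :=
  let lam := lambda1 c alpha eps in
  exists T1 T2,
    [/\ is_invL_conv (fun s => lam s - alpha%:C * s / eps%:C)
          (trace_l xl (dx 1 u)) T1,
        is_invL_conv (fun s => lam s ^+ 2 - alpha%:C * s / eps%:C * lam s)
          (u ^~ xl) T2 &
        forall phi, test_function `]0, +oo[ phi ->
          pairing (trace_l xl (dx 2 u)) phi + T1 phi + T2 phi
            + c / eps * pairing (u ^~ xl) phi = 0].

End Problem.

(* Main.v *)
Require Import Defs.
From HB Require Import structures.
From mathcomp Require Import all_boot all_order all_algebra.
From mathcomp Require Import complex.
From mathcomp Require Import all_classical all_reals all_analysis.
From mathcomp Require Import measurable_realfun.
From mathcomp Require Import ring lra.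
Import Order.TTheory GRing.Theory Num.Theory.
Import numFieldNormedType.Exports.
Local Open Scope classical_set_scope.
Local Open Scope ring_scope.
Local Open Scope complex_scope.

(* Let a = 1 / sqrt alpha. The Cayley transform th = (lam1 + a) / (lam1 - a) of the
   root satisfies s th (1 - th) = - (p (1 - th^2) (1 - th) + r (1 + th)^3) with
   p = c a / 4 and r = eps a^3 / 4, so that it is analytic in 1/s at infinity and
   vanishes there. Hence lam1 acts in time as a power series in the integration
   operator, and only real large s are needed to identify the boundary conditions,
   by uniqueness of the Laplace transform. For a function g of time and
   y_n = L^-1(th^n) * g, the equation for th gives d/dt (sum_(n >= 1) y_n^2 / 2) as a
   telescoping sum, equal to minus a quadratic expression in g and L^-1(lam1) * g
   which, with g = u(., x_r), is exactly the regular part of the boundary flux at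
   x_r; the remaining part of the flux is - (1 / 2a) d/dt g^2, and both leave the
   interval as nonnegative exterior energy. (In Fourier terms, the symbol of the flux is
   Re s (1 + alpha |lam1|^2) / (-2 Re lam1) >= 0 for Re s > 0, whatever the
   coefficients.) At x_l the flux is linear in L^-1(lam1) * u_x and quadratic in u_x;
   moving the operator to u by duality and completing the square leads to the same
   quadratic form for the time-reversed trace of u. *)

(** For large [s] the terms [s - alpha s l ^ 2] of the cubic dominate, so the root tends to [- a]:
    the Cayley transform is the one that sends this limit to 0. Behind the telescoping sum is a
    Laguerre expansion. The trace g is continued to the exterior half-line as exp (lam1 x) acting on
    g; since exp (- a x) L_n (2 a x) integrates against exp (lam1 x) to th^n / (a - lam1), the y_n
    are, up to sign, the coefficients of (d/dx - a) of this continuation. By Parseval the exterior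
    energy is g^2 / a + (2 / a) times the sum of y_n^2 over n >= 1, which accounts for both parts of
    the flux. The continuation is never constructed: only the recurrence between its coefficients is
    used. It is run on the symbols th^n / (1 - th), of which the th^n are consecutive differences,
    because lam1 = - a (1 + th) / (1 - th) is a combination of two of them. The boundary conditions
    are nonlocal identities of distributions; they are first turned into pointwise identities
    between continuous functions, so that the energy balance involves classical traces only. *)

Set Implicit Arguments.
Unset Strict Implicit.
Unset Printing Implicit Defensive.

(** * Primitives *)

Section DerivationRules.
Context {R : realType}.
Implicit Types (f g : R -> R) (t a b k : R).

(** The rules are stated on explicit lambda terms, so that a derivative can be assembled as a proof
    term and its value then adjusted with [is_derive_eq]. *)
Lemma dlamD {f g t a b} : is_derive t 1 f a -> is_derive t 1 g b ->
  is_derive t 1 (fun x => f x + g x) (a + b).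
Proof. exact: is_deriveD. Qed.

Lemma dlamN {f t a} : is_derive t 1 f a -> is_derive t 1 (fun x => - f x) (- a).
Proof. exact: is_deriveN. Qed.

Lemma dlamB {f g t a b} : is_derive t 1 f a -> is_derive t 1 g b ->
  is_derive t 1 (fun x => f x - g x) (a - b).
Proof. exact: is_deriveB. Qed.

Lemma dlamM {f g t a b} : is_derive t 1 f a -> is_derive t 1 g b ->
  is_derive t 1 (fun x => f x * g x) (a * g t + f t * b).
Proof.
move=> fa gb; have h := is_deriveM fa gb; apply: is_derive_eq h _.
by rewrite addrC; congr (_ + _); exact: mulrC.
Qed.

Lemma dlamZ k {f t a} : is_derive t 1 f a ->
  is_derive t 1 (fun x => k * f x) (k * a).
Proof. exact: is_deriveZ. Qed.

Lemma dlamcomp {f g t a b} : is_derive (g t) 1 f a -> is_derive t 1 g b ->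
  is_derive t 1 (fun x => f (g x)) (a * b).
Proof. exact: is_derive1_comp. Qed.

Lemma dlamexp k t : is_derive t 1 (fun x => expR (k * x)) (k * expR (k * t)).
Proof.
have h := dlamcomp (is_derive_expR (k * t)) (dlamZ k (is_derive_id t 1)).
by apply: is_derive_eq h _; rewrite mulr1 mulrC.
Qed.

Lemma is_derive_cont {f t a} : is_derive t 1 f a -> {for t, continuous f}.
Proof. by move=> [df _]; apply/differentiable_continuous/derivable1_diffP. Qed.

Lemma derive1_is_derive f t a : derivable f t 1 -> derive1 f t = a ->
  is_derive t 1 f a.
Proof. by move=> df <-; rewrite derive1E; exact: DeriveDef. Qed.

Lemma is_derive_derive1 f t a : is_derive t 1 f a -> derive1 f t = a.
Proof. by move=> [df <-]; rewrite derive1E. Qed.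

Lemma cst_of_derive0 f (x y : R) : (forall t, is_derive t 1 f 0) -> f x = f y.
Proof. exact: is_derive_0_is_cst. Qed.

(** Mean value theorem for [g - f]. Only interior derivatives are required, so that mere continuity
    is enough at the end points. *)
Lemma derive_le f g (df dg : R -> R) (a b : R) : a <= b ->
  (forall t, a < t < b -> is_derive t 1 f (df t)) ->
  (forall t, a < t < b -> is_derive t 1 g (dg t)) ->
  {within `[a, b], continuous f} -> {within `[a, b], continuous g} ->
  (forall t, a < t < b -> df t <= dg t) -> f a <= g a -> f b <= g b.
Proof.
rewrite le_eqVlt => /predU1P[->//|ab] hf hg cf cg fg fga.
have dfx t : t \in `]a, b[ -> is_derive t 1 (g \- f) ((dg \- df) t).
  by rewrite in_itv/= => ht; exact: dlamB (hg _ ht) (hf _ ht).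
have [|c cab /eqP] := MVT ab dfx.
  by move=> x; apply: continuousB; [exact: cg|exact: cf].
rewrite /= => /eqP h.
have : 0 <= (dg c - df c) * (b - a).
  by rewrite mulr_ge0 ?subr_ge0 ?(ltW ab)// fg//; move: cab; rewrite in_itv.
by rewrite -h => h'; lra.
Qed.

End DerivationRules.

Section Primitive.
Context {R : realType}.
Implicit Types (f g F : R -> R) (t x : R).
Let mu := @lebesgue_measure R.

(** The sign convention for negative [t] makes this a primitive on the whole line, differentiable at
    0, so that no one-sided derivative occurs at the initial time. *)
Definition prim f t : R :=
  if 0 <= t then \int[mu]_(x in `[0, t]) f x else - \int[mu]_(x in `[t, 0]) f x.

Lemma prim0 f : prim f 0 = 0.
Proof. by rewrite /prim lexx set_itv1 Rintegral_set1. Qed.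

Lemma continuous_integrable_itv f (a b : R) : continuous f ->
  mu.-integrable `[a, b] (EFin \o f).
Proof.
move=> cf; apply: continuous_compact_integrable; first exact: segment_compact.
exact: continuous_subspaceT.
Qed.

Lemma is_derive_prim f : continuous f -> forall t, is_derive t 1 (prim f) (f t).
Proof.
(* The base point [b] lies below 0 and below all points near [t]: both branches of [prim] become
   [F x - F 0], and [t] is interior for the fundamental theorem. *)
move=> cf t; pose b := - (`|t| + 1); pose F x := \int[mu]_(s in `[b, x]) f s.
have hb x : `|x| < `|t| + 1 -> b < x.
  by rewrite /b ltr_norml => /andP[].
have b0 : b < 0 by apply: hb; rewrite normr0 ltr_pwDr.
have E x : b < x -> prim f x = F x - F 0.
  move=> bx; rewrite /prim; case: ifPn => [x0|/negbTE]; rewrite /F.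
    rewrite Rintegral_itvB ?bnd_simp ?(ltW b0)//; last exact: continuous_integrable_itv.
    rewrite Rintegral_itv_obnd_cbnd//.
    by have := continuous_integrable_itv 0 x cf; apply: integrableS => //; exact: subset_itv_oc_cc.
  move=> /negbT; rewrite -ltNge => x0.
  rewrite -[RHS]opprB; congr (- _).
  rewrite Rintegral_itvB ?bnd_simp ?(ltW bx) ?(ltW x0)//; last exact: continuous_integrable_itv.
  rewrite Rintegral_itv_obnd_cbnd//.
  by have := continuous_integrable_itv x 0 cf; apply: integrableS => //; exact: subset_itv_oc_cc.
have dF : is_derive t 1 F (f t).
  have [] := @continuous_FTC1_closed R f b t (t + 1) _ _ _ (cf t).
  - by rewrite ltrDl.
  - exact: continuous_integrable_itv.
  - by apply: hb; rewrite ltrDl.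
  - by move=> ? ?; exact: derive1_is_derive.
have : is_derive t 1 (fun x => F x - F 0) (f t).
  by apply: is_derive_eq (dlamB dF (is_derive_cst _ _ _)) _; rewrite subr0.
apply: near_eq_is_derive.
have : \forall x \near t, b < x.
  by apply: lt_nbhsr; apply: hb; rewrite ltrDl.
by apply: filterS => x /E ->.
Qed.

Lemma continuous_prim f : continuous f -> continuous (prim f).
Proof. by move=> cf t; exact: is_derive_cont (is_derive_prim cf t). Qed.

Lemma prim_unique f F : continuous f -> (forall t, is_derive t 1 F (f t)) ->
  forall t, F t - F 0 = prim f t.
Proof.
move=> cf dF t; apply/eqP; rewrite -subr_eq0; apply/eqP.
have := @cst_of_derive0 R (fun x => F x - F 0 - prim f x) t 0.
rewrite subrr prim0 subr0; apply => x; apply: is_derive_eq.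
  by apply: dlamB (is_derive_prim cf x); apply: dlamB (is_derive_cst _ _ _).
by rewrite subr0 subrr.
Qed.

Lemma primE f t : 0 <= t -> prim f t = \int[mu]_(x in `[0, t]) f x.
Proof. by rewrite /prim => ->. Qed.

Lemma prim_lin f g (a b : R) : continuous f -> continuous g -> forall t,
  prim (fun x => a * f x + b * g x) t = a * prim f t + b * prim g t.
Proof.
move=> cf cg t.
suff : (fun x => a * prim f x + b * prim g x) t - (a * prim f 0 + b * prim g 0) =
  prim (fun x => a * f x + b * g x) t by rewrite !prim0 !mulr0 addr0 subr0 => ->.
apply: (@prim_unique _ (fun x => a * prim f x + b * prim g x)).
- by move=> x; apply: cvgD; apply: cvgM (cvg_cst _) _; [exact: cf|exact: cg].
- by move=> x; apply: dlamD; apply: dlamZ; exact: is_derive_prim.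
Qed.

Lemma prim_le f g t : continuous f -> continuous g -> 0 <= t ->
  (forall x, 0 <= x <= t -> f x <= g x) -> prim f t <= prim g t.
Proof.
move=> cf cg t0 fg.
apply: (@derive_le _ _ _ f g 0 t) => //.
- by move=> x _; exact: is_derive_prim.
- by move=> x _; exact: is_derive_prim.
- exact/continuous_subspaceT/continuous_prim.
- exact/continuous_subspaceT/continuous_prim.
- by move=> x /andP[x0 xt]; rewrite fg// !ltW.
- by rewrite !prim0.
Qed.

Lemma prim_opp f : continuous f -> forall t, prim f (- t) = - prim (fun x => f (- x)) t.
Proof.
move=> cf t.
have cfN : continuous (fun x => f (- x)).
  by move=> x; apply: continuous_comp; [exact: opp_continuous|exact: cf].
suff : (fun x => - prim f (- x)) t - - prim f (- 0) = prim (fun x => f (- x)) t.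
  by rewrite oppr0 prim0 oppr0 subr0 => <-; rewrite opprK.
apply: (@prim_unique _ (fun x => - prim f (- x))) => //.
move=> x; have h := dlamN (dlamcomp (is_derive_prim cf (- x)) (dlamN (is_derive_id x 1))).
by apply: is_derive_eq h _; rewrite mulrN1 opprK.
Qed.

Lemma prim_bound_ge0 f (C T sigma : R) : 0 < sigma -> continuous f ->
  (forall t, 0 <= t <= T -> `|f t| <= C * expR (sigma * t)) ->
  forall t, 0 <= t <= T -> `|prim f t| <= C / sigma * expR (sigma * t).
Proof.
move=> s0 cf fC t /andP[t0 tT].
have C0 : 0 <= C.
  have := fC 0; rewrite mulr0 expR0 mulr1 lexx (le_trans t0 tT) => /(_ isT).
  exact: le_trans.
pose h x := C / sigma * expR (sigma * x).
have dh x : is_derive x 1 h (C * expR (sigma * x)).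
  have e := dlamZ (C / sigma) (dlamexp sigma x); apply: is_derive_eq e _.
  by rewrite mulrA divfK// gt_eqF.
have ch : continuous h by move=> x; exact: is_derive_cont (dh x).
have bnd x : 0 < x < t -> `|f x| <= C * expR (sigma * x).
  by move=> /andP[x0 xt]; apply: fC; rewrite (ltW x0)/= (le_trans (ltW xt)).
have h00 : 0 <= h 0 by rewrite /h mulr0 expR0 mulr1 divr_ge0// ltW.
rewrite ler_norml; apply/andP; split.
  apply: (@derive_le _ (fun x => - h x) (prim f) (fun x => - (C * expR (sigma * x))) f 0 t) => //.
  - by move=> x _; exact: is_derive_prim.
  - by apply: continuous_subspaceT => x; apply: continuousN; exact: ch.
  - exact/continuous_subspaceT/continuous_prim.
  - by move=> x /bnd; rewrite ler_norml => /andP[].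
  - by rewrite prim0 oppr_le0.
apply: (@derive_le _ (prim f) h f (fun x => (C * expR (sigma * x))) 0 t) => //.
- by move=> x _; exact: is_derive_prim.
- exact/continuous_subspaceT/continuous_prim.
- exact/continuous_subspaceT.
- by move=> x /bnd; rewrite ler_norml => /andP[].
- by rewrite prim0.
Qed.

(* The weight [expR (sigma * `|t|)] turns [prim] into a map of norm at most [sigma^-1]. *)
Lemma prim_bound f (C T sigma : R) : 0 < sigma -> continuous f ->
  (forall t, `|t| <= T -> `|f t| <= C * expR (sigma * `|t|)) ->
  forall t, `|t| <= T -> `|prim f t| <= C / sigma * expR (sigma * `|t|).
Proof.
move=> s0 cf fC t tT; case: (leP 0 t) => t0.
  move: tT; rewrite ger0_norm// => tT; apply: (@prim_bound_ge0 f C T) => //.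
    by move=> x /andP[x0 xT]; have := fC x; rewrite (ger0_norm x0); apply.
  by rewrite t0.
have Et : `|t| = - t by rewrite ltr0_norm.
rewrite -[t in prim f t]opprK (prim_opp cf) normrN Et.
apply: (@prim_bound_ge0 (fun x => f (- x)) C T) => //.
- by move=> x; apply: continuous_comp; [exact: opp_continuous|exact: cf].
- by move=> x /andP[x0 xT]; have := fC (- x); rewrite normrN (ger0_norm x0); apply.
- by rewrite -Et normr_ge0.
Qed.

End Primitive.

(** * Power series in the primitive operator *)

Section GeometricDomination.
Context {R : realType}.

(** Keeping the subtracted term in the bound makes the induction on [m] exact. *)
Lemma half_series_partial (a : nat -> R) (D : R) :
  (forall k, `|a k| <= D * 2^-1 ^+ k) -> forall N m,
  `|series a (N + m)%N - series a N| <= D * 2 * (2^-1 ^+ N - 2^-1 ^+ (N + m)).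
Proof.
move=> ha N; elim=> [|m IH]; first by rewrite addn0 !subrr normr0 mulr0.
rewrite addnS seriesS -addrA (le_trans (ler_normD _ _))//.
rewrite (le_trans (lerD (ha _) IH))// exprS.
by rewrite le_eqVlt; apply/orP; left; apply/eqP; field.
Qed.

Lemma half_series_cvg (a : nat -> R) (D : R) :
  (forall k, `|a k| <= D * 2^-1 ^+ k) -> cvgn (series a).
Proof.
move=> ha; apply: normed_cvg.
apply: (@series_le_cvg _ _ (geometric D 2^-1)) => [k|k|k|].
- exact: normr_ge0.
- exact: le_trans (ha k).
- exact: ha.
- apply: is_cvg_geometric_series; rewrite ger0_norm ?invr_ge0//.
  by rewrite invf_lt1 ?ltr1n.
Qed.

Lemma half_series_tail (a : nat -> R) (D : R) :
  (forall k, `|a k| <= D * 2^-1 ^+ k) -> forall N,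
  `|limn (series a) - series a N| <= D * 2 * 2^-1 ^+ N.
Proof.
move=> ha N.
have D0 : 0 <= D by have := ha 0; rewrite expr0 mulr1; exact: le_trans.
have cvs := half_series_cvg ha.
have : `|series a n - series a N| @[n --> \oo] --> `|limn (series a) - series a N|.
  by apply: cvg_norm; apply: cvgB cvs (cvg_cst _).
move=> /cvg_lim <- //; apply: limr_le.
  by apply: is_cvg_norm; apply: is_cvgB cvs (is_cvg_cst _).
near=> n.
have Nn : (N <= n)%N by near: n; exact: nbhs_infty_ge.
rewrite -(subnKC Nn) (le_trans (half_series_partial ha N _))//.
by rewrite ler_wpM2l ?mulr_ge0// lerBlDr lerDl exprn_ge0.
Unshelve. all: by end_near. Qed.

Lemma half_expr_cvg0 (D : R) : D * 2^-1 ^+ n @[n --> \oo] --> 0.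
Proof.
have -> : 0 = D * 0 :> R by rewrite mulr0.
apply: cvgM (cvg_cst _) _; apply: cvg_expr.
by rewrite ger0_norm ?invr_ge0// invf_lt1 ?ltr1n.
Qed.

(** Identities about infinite series are proved below by comparing truncations at every order [N]
    and concluding with this bound. *)
Lemma le_half_expr0 (x D : R) : (forall N : nat, x <= D * 2^-1 ^+ N) -> x <= 0.
Proof.
move=> h; have <- : limn (fun n => D * 2^-1 ^+ n) = 0.
  by apply/cvg_lim => //; exact: half_expr_cvg0.
apply: limr_ge; last exact: nearW.
by apply/cvg_ex; exists 0; exact: half_expr_cvg0.
Qed.

End GeometricDomination.

Section PowerSeriesInPrimitive.
Context {R : realType}.
Implicit Types (f g : R -> R) (A : nat -> R) (t T M B C : R).

(* [prim] is division by the Laplace variable [s], so that [op A] has symbol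
   [\sum_k A k / s ^ k]. *)
Definition op A f t : R := limn (series (fun k => A k * iter k prim f t)).

Definition geo M B A : Prop := forall k, `|A k| <= M * B ^+ k.

Lemma continuous_iter_prim f k : continuous f -> continuous (iter k prim f).
Proof. by move=> cf; elim: k => [//|k IH]; exact: continuous_prim. Qed.

Lemma iter_prim_bound f C T sigma : 0 < sigma -> continuous f ->
  (forall t, `|t| <= T -> `|f t| <= C * expR (sigma * `|t|)) -> forall k t,
  `|t| <= T -> `|iter k prim f t| <= C / sigma ^+ k * expR (sigma * `|t|).
Proof.
move=> s0 cf fC; elim=> [|k IH] t tT; first by rewrite expr0 divr1 fC.
rewrite exprSr invfM mulrA; apply: prim_bound tT => //.
exact: continuous_iter_prim.
Qed.

Lemma locally_bounded f T : continuous f ->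
  exists C, forall t, `|t| <= T -> `|f t| <= C.
Proof.
move=> cf; case: (lerP 0 T) => T0; last first.
  by exists 0 => t tT; have := le_lt_trans tT T0; rewrite normr_lt0.
have TT : - T <= T by rewrite (le_trans _ T0)// oppr_le0.
have cnf : {within `[- T, T], continuous (fun x => `|f x|)}.
  apply: continuous_subspaceT => x; apply: continuous_comp; first exact: cf.
  exact: norm_continuous.
have [c _ fc] := EVT_max TT cnf.
by exists `|f c| => t; rewrite ler_norml => tT; apply: fc; rewrite in_itv.
Qed.

Lemma locally_exp_bounded f T B : 0 < B -> continuous f ->
  exists C, forall t, `|t| <= T -> `|f t| <= C * expR (B * `|t|).
Proof.
move=> B0 cf; have [C fC] := locally_bounded T cf; exists C => t tT.
have C0 : 0 <= C by exact: le_trans (fC t tT).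
rewrite (le_trans (fC t tT))// ler_peMr// -[leLHS]expR0 ler_expR.
by rewrite mulr_ge0// ltW.
Qed.

Section Convergence.
Variables (A : nat -> R) (f : R -> R) (M B C T : R).
Hypotheses (B0 : 0 < B) (hA : geo M B A) (cf : continuous f).
Hypothesis fC : forall t, `|t| <= T -> `|f t| <= C * expR (2 * B * `|t|).

(** With the weight exponent [2 * B], the factor [B ^+ k] of [geo] meets [(2 * B) ^- k] from the
    iterated primitive: the ratio is one half whatever the growth of the coefficients. *)
Let term_bound t : `|t| <= T -> forall k,
  `|A k * iter k prim f t| <= M * C * expR (2 * B * `|t|) * 2^-1 ^+ k.
Proof.
move=> tT k; have B2 : 0 < 2 * B by rewrite mulr_gt0.
rewrite normrM (le_trans (ler_pM _ _ (hA k) (iter_prim_bound B2 cf fC k tT)))//.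
rewrite le_eqVlt; apply/orP; left; apply/eqP.
have Bk : B ^+ k != 0 by rewrite expf_neq0// gt_eqF.
have tk : (2 : R) ^+ k != 0 by rewrite expf_neq0.
by rewrite exprMn exprVn; field; rewrite Bk tk.
Qed.

Lemma op_cvg_loc t : `|t| <= T -> cvgn (series (fun k => A k * iter k prim f t)).
Proof. by move=> /term_bound; exact: half_series_cvg. Qed.

Lemma op_tail t : `|t| <= T -> forall N,
  `|op A f t - series (fun k => A k * iter k prim f t) N| <=
  M * C * expR (2 * B * `|t|) * 2 * 2^-1 ^+ N.
Proof. by move=> /term_bound; exact: half_series_tail. Qed.

Lemma op_bound t : `|t| <= T -> `|op A f t| <= M * C * expR (2 * B * `|t|) * 2.
Proof.
by move=> /op_tail /(_ 0%N); rewrite expr0 mulr1 /series/= big_geq// subr0.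
Qed.

End Convergence.

Section Uniform.
Variables (A : nat -> R) (f : R -> R) (M B : R).
Hypotheses (B0 : 0 < B) (hA : geo M B A) (cf : continuous f).

Lemma op_cvg t : cvgn (series (fun k => A k * iter k prim f t)).
Proof.
have B2 : 0 < 2 * B by rewrite mulr_gt0.
have [C fC] := locally_exp_bounded `|t| B2 cf.
exact: (op_cvg_loc B0 hA cf fC).
Qed.

Lemma op_tail_unif T : exists D, forall t, `|t| <= T -> forall N,
  `|op A f t - series (fun k => A k * iter k prim f t) N| <= D * 2^-1 ^+ N.
Proof.
have B2 : 0 < 2 * B by rewrite mulr_gt0.
have [C fC] := locally_exp_bounded T B2 cf.
exists (`|M * C| * expR (2 * B * T) * 2) => t tT N.
apply: le_trans (op_tail B0 hA cf fC tT N) _.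
rewrite ler_wpM2r ?exprn_ge0 ?invr_ge0// ler_wpM2r//.
rewrite ler_pM ?expR_ge0 ?ler_norm ?ler_expR ?ler_wpM2l ?(ltW B2)//.
have := fC 0; rewrite normr0 mulr0 expR0 mulr1 => /(_ (le_trans (normr_ge0 _) tT)).
move=> /(le_trans (normr_ge0 _)) C0; rewrite mulr_ge0//.
by have := hA 0; rewrite expr0 mulr1; exact: le_trans.
Qed.

Lemma continuous_series_iter N :
  continuous (fun t => series (fun k => A k * iter k prim f t) N).
Proof.
move=> t; elim: N => [|N IH].
  rewrite /series/= /continuous_at; under eq_fun do rewrite big_geq//.
  by rewrite big_geq//; exact: cvg_cst.
rewrite /continuous_at; under eq_fun do rewrite seriesSr; rewrite seriesSr.
apply: cvgD IH _; apply: cvgM (cvg_cst _) _; exact: continuous_iter_prim.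
Qed.

Lemma continuous_op : continuous (op A f).
Proof.
move=> t; apply/cvgrPdist_le => e e0.
have [D hD] := op_tail_unif (`|t| + 1).
have e3 : 0 < e / 3 by rewrite divr_gt0.
have [N hN] : exists N, D * 2^-1 ^+ N <= e / 3.
  have /cvgrPdist_le/(_ _ e3)[N _ /(_ N (leqnn _))] := half_expr_cvg0 D.
  by rewrite sub0r normrN => h; exists N; exact: le_trans (ler_norm _) h.
have /cvgrPdist_le/(_ _ e3) := @continuous_series_iter N t.
have nt : \forall x \near t, `|x| <= `|t| + 1.
  have : continuous (fun x : R => `|x|) by exact: norm_continuous.
  by move=> /(_ t) /cvgr_le; apply; rewrite ltrDl.
apply: filterS2 nt => x xt h.
rewrite [X in `|X|](_ : _ = (op A f t - series (fun k => A k * iter k prim f t) N) +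
  (series (fun k => A k * iter k prim f t) N - series (fun k => A k * iter k prim f x) N)
  - (op A f x - series (fun k => A k * iter k prim f x) N)); last by ring.
rewrite (_ : e = e / 3 + e / 3 + e / 3); last by field.
apply: le_trans (ler_normB _ _) _; apply: lerD; last exact: le_trans (hD _ xt _) hN.
apply: le_trans (ler_normD _ _) _; apply: lerD => //.
by apply: le_trans (hD _ _ _) hN; rewrite lerDl.
Qed.

End Uniform.

Lemma geoS A M B : geo M B A -> geo (M * B) B (fun k => A k.+1).
Proof. by move=> hA k; rewrite -mulrA -exprS; exact: hA. Qed.

Lemma op_eq A A' f t : A =1 A' -> op A f t = op A' f t.
Proof. by move=> /funext ->. Qed.

Lemma op_lin A A' f (a b : R) M M' B : 0 < B -> geo M B A -> geo M' B A' ->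
  continuous f -> forall t,
  op (fun k => a * A k + b * A' k) f t = a * op A f t + b * op A' f t.
Proof.
move=> B0 hA hA' cf t; rewrite {1}/op; apply/cvg_lim => //.
rewrite (_ : series _ = (fun n => a * series (fun k => A k * iter k prim f t) n
   + b * series (fun k => A' k * iter k prim f t) n)).
  by apply: cvgD; apply: cvgM (cvg_cst _) _; [exact: (op_cvg B0 hA)|exact: (op_cvg B0 hA')].
apply/funext => n; rewrite /series/= !mulr_sumr -big_split/=.
by apply: eq_bigr => k _; ring.
Qed.

Lemma prim_series A f N : continuous f -> forall t,
  prim (fun t => series (fun k => A k * iter k prim f t) N) t =
  series (fun k => A k * iter k.+1 prim f t) N.
Proof.
move=> cf; elim: N => [|N IH] t.
  rewrite (_ : (fun t => _) = (fun t => 0 * f t + 0 * f t)); last first.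
    by apply/funext => x; rewrite /series/= big_geq// !mul0r addr0.
  by rewrite prim_lin// /series/= big_geq// !mul0r addr0.
rewrite [RHS]seriesSr -IH.
rewrite (_ : (fun t => _) = (fun t => 1 * (series (fun k => A k * iter k prim f t) N)
   + A N * iter N prim f t)).
  rewrite prim_lin ?mul1r//; first exact: continuous_series_iter.
  exact: continuous_iter_prim.
by apply/funext => x; rewrite mul1r seriesSr.
Qed.

Lemma prim_sub f g t : continuous f -> continuous g ->
  prim (fun x => f x - g x) t = prim f t - prim g t.
Proof.
move=> cf cg; rewrite (_ : (fun x => _) = (fun x => 1 * f x + (-1) * g x)).
  by rewrite prim_lin// mul1r mulN1r.
by apply/funext => x; rewrite mul1r mulN1r.
Qed.

(** One primitive is factored out in front of the series. This gives access to the time derivative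
    of [op], and to its value [A 0 * f 0] at time 0. *)
Lemma op_shift A f M B : 0 < B -> geo M B A -> continuous f -> forall t,
  op A f t = A 0 * f t + prim (op (fun k => A k.+1) f) t.
Proof.
move=> B0 hA cf t; apply/eqP; rewrite -subr_eq0 -normr_le0; apply/eqP.
have hA1 := geoS hA.
have [D hD] := op_tail_unif B0 hA cf `|t|.
have [D' hD'] := op_tail_unif B0 hA1 cf `|t|.
pose P N x := series (fun k => A k.+1 * iter k prim f x) N.
(* [D] bounds the tail of [op A], and [D'] that of the shifted series; the exponential is the loss
   of [prim_bound] with weight 1. *)
apply/eqP; apply: (@le_half_expr0 _ _ (D + D' * expR `|t|)) => N.
have EN : series (fun k => A k * iter k prim f t) N.+1 = A 0 * f t + prim (P N) t.
  by rewrite /P prim_series// /series/= big_nat_recl.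
rewrite (_ : _ - _ = (op A f t - series (fun k => A k * iter k prim f t) N.+1)
   - prim (fun x => op (fun k => A k.+1) f x - P N x) t); last first.
  rewrite prim_sub; [|exact: (continuous_op B0 hA1 cf)|exact: (continuous_series_iter (A := fun k => A k.+1) cf)].
  by rewrite EN; ring.
apply: le_trans (ler_normB _ _) _; rewrite mulrDl lerD//.
  apply: le_trans (hD t (lexx _) N.+1) _.
  have D0 : 0 <= D by have := hD t (lexx _) 0%N; rewrite expr0 mulr1; exact: le_trans.
  by rewrite ler_wpM2l// exprS ler_piMl ?exprn_ge0 ?invr_ge0// invf_le1 ?ler1n.
have := @prim_bound R (fun x => op (fun k => A k.+1) f x - P N x) (D' * 2^-1 ^+ N) `|t| 1 ltr01 _ _ t (lexx _).
rewrite divr1 mul1r -mulrA (mulrC _ (expR _)) mulrA; apply.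
  move=> x; apply: cvgB; [exact: (continuous_op B0 hA1)|exact: continuous_series_iter].
move=> x xt; rewrite mul1r (le_trans (hD' x xt N))// ler_peMr//.
  by have := hD' t (lexx _) N; exact: le_trans.
by rewrite -[leLHS]expR0 ler_expR.
Qed.

Lemma is_derive_op A f M B : 0 < B -> geo M B A -> A 0 = 0 -> continuous f ->
  forall t, is_derive t 1 (op A f) (op (fun k => A k.+1) f t).
Proof.
move=> B0 hA A0 cf t.
have -> : op A f = prim (op (fun k => A k.+1) f).
  by apply/funext => x; rewrite (op_shift B0 hA cf) A0 mul0r add0r.
by apply: is_derive_prim; exact: continuous_op (geoS hA) cf.
Qed.

End PowerSeriesInPrimitive.

(** * Adjoint of the primitive operator and time reversal *)

Section Duality.
Context {R : realType}.
Implicit Types (f h : R -> R) (A : nat -> R) (t T M B : R).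

Definition rev T f t : R := f (T - t).

Lemma revK T f : rev T (rev T f) = f.
Proof. by apply/funext => t; rewrite /rev subKr. Qed.

Lemma continuous_rev T f : continuous f -> continuous (rev T f).
Proof.
move=> cf t; rewrite /rev; apply: continuous_comp; last exact: cf.
by apply: continuousB; [exact: cvg_cst|exact: cvg_id].
Qed.

Lemma prim_small f (e T : R) : continuous f ->
  (forall t, `|t| <= T -> `|f t| <= e) ->
  forall t, `|t| <= T -> `|prim f t| <= e * expR `|t|.
Proof.
move=> cf fe t tT; have := @prim_bound R f e T 1 ltr01 cf _ t tT.
rewrite divr1 mul1r; apply => x xT; rewrite mul1r (le_trans (fe x xT))//.
rewrite ler_peMr//; first exact: le_trans (fe x xT).
by rewrite -[leLHS]expR0 ler_expR.
Qed.

Lemma continuous_mul f h : continuous f -> continuous h ->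
  continuous (fun t => f t * h t).
Proof. by move=> cf ch t; apply: cvgM; [exact: cf|exact: ch]. Qed.

(** [rev T (prim (rev T f)) t] is the integral of [f] over [[t, T]], so this is an integration by
    parts. The boundary term [F] vanishes at 0 through [prim h] and at [T] through the other
    factor. *)
Lemma prim_dual1 f h T : continuous f -> continuous h ->
  prim (fun t => f t * prim h t) T = prim (fun t => rev T (prim (rev T f)) t * h t) T.
Proof.
move=> cf ch.
have crf := @continuous_rev T f cf.
have cpf := continuous_rev (T := T) (continuous_prim crf).
apply/eqP; rewrite -subr_eq0 -prim_sub; first last.
  exact: continuous_mul.
  by apply: continuous_mul => //; exact: continuous_prim.
pose F t := - rev T (prim (rev T f)) t * prim h t.
have FT : F T - F 0 = 0.
  by rewrite /F /rev subrr !prim0 oppr0 mulr0 mul0r subrr.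
apply/eqP; rewrite -[RHS]FT; symmetry; apply: prim_unique.
- move=> t; apply: cvgB; [apply: continuous_mul => //; exact: continuous_prim|].
  exact: continuous_mul.
move=> t; have h1 := dlamB (is_derive_cst T t 1) (is_derive_id t 1).
have h2 := dlamN (dlamcomp (g := fun x => T - x) (is_derive_prim crf (T - t)) h1).
apply: is_derive_eq (dlamM h2 (is_derive_prim ch t)) _.
by rewrite /rev subKr; ring.
Qed.

Lemma prim_dual_iter k f h T : continuous f -> continuous h ->
  prim (fun t => f t * iter k prim h t) T =
  prim (fun t => rev T (iter k prim (rev T f)) t * h t) T.
Proof.
elim: k f => [|k IH] f cf ch; first by rewrite /= revK.
have crf := @continuous_rev T f cf.
rewrite /= prim_dual1//; last exact: continuous_iter_prim.
rewrite IH//; last exact/continuous_rev/continuous_prim.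
by rewrite revK -iterSr.
Qed.

Lemma prim_dual_series N A f h T : continuous f -> continuous h ->
  prim (fun t => f t * series (fun k => A k * iter k prim h t) N) T =
  prim (fun t => rev T (fun t => series (fun k => A k * iter k prim (rev T f) t) N) t * h t) T.
Proof.
move=> cf ch; have crf := @continuous_rev T f cf.
elim: N => [|N IH].
  congr (prim _ _); apply/funext => t.
  by rewrite /rev/= /series/= !big_geq// mulr0 mul0r.
rewrite (_ : (fun t => _) = (fun t =>
   1 * (f t * series (fun k => A k * iter k prim h t) N) + A N * (f t * iter N prim h t))).
  rewrite prim_lin; [|apply: continuous_mul cf _; exact: continuous_series_iter
    |apply: continuous_mul cf _; exact: continuous_iter_prim].
  rewrite IH prim_dual_iter// -prim_lin.
  - congr (prim _ _); apply/funext => t; rewrite /rev seriesSr.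
    by ring.
  - by apply: continuous_mul => //; apply: continuous_rev; exact: continuous_series_iter.
  - by apply: continuous_mul => //; apply: continuous_rev; exact: continuous_iter_prim.
by apply/funext => t; rewrite seriesSr; ring.
Qed.

Lemma prim_dual_op A f h T M B : 0 < B -> geo M B A -> 0 <= T ->
  continuous f -> continuous h ->
  prim (fun t => f t * op A h t) T = prim (fun t => rev T (op A (rev T f)) t * h t) T.
Proof.
move=> B0 hA T0 cf ch; have crf := @continuous_rev T f cf.
have [D hD] := op_tail_unif B0 hA ch T.
(* The radius is doubled because the reversed series is evaluated at [T - t]. *)
have [D' hD'] := op_tail_unif B0 hA crf (T + T).
have [F hF] := locally_bounded T cf; have [H hH] := locally_bounded T ch.
have nT : `|T| <= T by rewrite ger0_norm.
have n0 : `|0 : R| <= T by rewrite normr0.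
have D0 : 0 <= D by have := hD 0 n0 0; rewrite expr0 mulr1; exact: le_trans.
have D'0 : 0 <= D'.
  have := hD' 0 _ 0; rewrite expr0 mulr1 normr0 => /(_ (addr_ge0 T0 T0)).
  exact: le_trans.
apply/eqP; rewrite -subr_eq0 -normr_le0.
apply: (@le_half_expr0 _ _ ((F * D + D' * H) * expR `|T|)) => N.
pose P x := series (fun k => A k * iter k prim h x) N.
pose Q x := series (fun k => A k * iter k prim (rev T f) x) N.
have cP : continuous P by exact: continuous_series_iter.
have cQ : continuous Q by exact: continuous_series_iter.
have cop := continuous_op B0 hA ch.
have copr := continuous_op B0 hA crf.
have E : prim (fun t => f t * P t) T = prim (fun t => rev T Q t * h t) T.
  exact: prim_dual_series.
rewrite (_ : _ - _ = prim (fun t => f t * op A h t - f t * P t) T -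
    prim (fun t => rev T (op A (rev T f)) t * h t - rev T Q t * h t) T); last first.
  rewrite !prim_sub; try by [exact: continuous_mul|apply: continuous_mul => //; exact: continuous_rev].
  by rewrite E; ring.
rewrite (le_trans (ler_normB _ _))// -mulrA mulrDl; apply: lerD.
  rewrite (_ : F * D * _ = F * (D * 2^-1 ^+ N) * expR `|T|); last by ring.
  apply: (@prim_small _ _ T) => //.
    by move=> t; apply: cvgB; exact: continuous_mul.
  move=> t tT; rewrite -mulrBr normrM ler_pM//; first exact: hF.
  exact: hD.
rewrite (_ : D' * H * _ = (D' * 2^-1 ^+ N * H) * expR `|T|); last by ring.
apply: (@prim_small _ _ T) => //.
  by move=> t; apply: cvgB; apply: continuous_mul => //; exact: continuous_rev.
move=> t tT; rewrite -mulrBl normrM ler_pM//; last exact: hH.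
by apply: hD'; rewrite (le_trans (ler_normB _ _))// lerD.
Qed.

End Duality.

(** * The kernel of the root at infinity *)

Section Lattice.
Context {R : realType}.
Variables (p r : R).
Implicit Types (z : nat -> R) (g : R -> R).

(* [s * th ^+ n.+1 = lat (fun n => th ^+ n / (1 - th)) n] when [th] satisfies
   [s th (1 - th) = - (p (1 - th ^ 2) (1 - th) + r (1 + th) ^ 3)]. *)
Definition lat z n : R :=
  - p * (z n - z n.+1 - z n.+2 + z n.+3)
  - r * (z n + 3 * z n.+1 + 3 * z n.+2 + z n.+3).

(* The coefficient of [s ^- k] in [th ^+ n / (1 - th)], for the root [th] that
   tends to [0] as [s] tends to infinity. *)
Fixpoint coef (k n : nat) : R :=
  if k is k'.+1 then \sum_(n.-1 <= m < k) lat (coef k') m else (n == 0)%:R.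

(** The root [th] is of order [1 / s] at infinity, so the expansion of [th ^ n / (1 - th)] starts at
    order [n]. *)
Lemma coef_supp k n : (k < n)%N -> coef k n = 0.
Proof.
case: k => [|k] kn /=; first by case: n kn.
by rewrite big_geq// -ltnS prednK// (leq_ltn_trans _ kn).
Qed.

(** The equation of [th] at order [k.+1], since [th ^ n.+1] is the difference of two consecutive
    symbols. [coef] solves it by summation over [n]; the sum is finite because [lat (coef k)]
    vanishes beyond [k]. *)
Lemma coefS k n : coef k.+1 n.+1 - coef k.+1 n.+2 = lat (coef k) n.
Proof.
case: (ltnP n k.+1) => nk /=; first by rewrite [X in X - _]big_ltn// addrK.
rewrite !big_geq ?subr0//; last exact: leqW.
rewrite /lat !coef_supp//; first by rewrite !mulr0 !addr0 !subr0 !mulr0 subr0.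
- by rewrite !ltnS ltnW// ltnW// ltnW.
- by rewrite !ltnS ltnW// ltnW.
- by rewrite !ltnS ltnW.
Qed.

(** The symbols for [n = 0] and [n = 1] differ by 1, which has no term of positive order; the
    truncated predecessor [n.-1] in [coef] encodes this. *)
Lemma coef01 k : coef k 0 - coef k 1 = (k == 0)%:R.
Proof. by case: k => [|k] /=; rewrite ?subr0// subrr. Qed.

(** [lat_bound] gives [2 |p| + 4 |r|]; the geometric sum over [m] doubles it, and passing from
    [n.-1] to [n] doubles it again. The [+ 1] keeps the constant positive for all [p] and [r]. *)
Definition growth : R := 8 * `|p| + 16 * `|r| + 1.

Lemma growth_gt0 : 0 < growth.
Proof. by rewrite /growth ltr_wpDl// addr_ge0// mulr_ge0. Qed.

Lemma lat_bound z C n : (forall m, `|z m| <= C * 2^-1 ^+ m) ->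
  `|lat z n| <= (2 * `|p| + 4 * `|r|) * C * 2^-1 ^+ n.
Proof.
move=> hz.
have C0 : 0 <= C by have := hz 0; rewrite expr0 mulr1; exact: le_trans.
have [h0 h1 h2 h3] := And4 (hz n) (hz n.+1) (hz n.+2) (hz n.+3).
have q0 : 0 <= C * 2^-1 ^+ n by rewrite mulr_ge0// exprn_ge0// invr_ge0.
rewrite -[leRHS]mulrA /lat; move: h0 h1 h2 h3 q0; rewrite !exprS.
set q := 2^-1 ^+ n; rewrite 4!(ler_norml (z _)).
move=> /andP[? ?] /andP[? ?] /andP[? ?] /andP[? ?] q0.
set X := (X in - p * X); set Y := (X in _ - r * X).
have hX : `|X| <= 2 * (C * q) by rewrite /X ler_norml; apply/andP; split; lra.
have hY : `|Y| <= 4 * (C * q) by rewrite /Y ler_norml; apply/andP; split; lra.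
rewrite (_ : (2 * _ + _) * _ = `|p| * (2 * (C * q)) + `|r| * (4 * (C * q))); last by ring.
by rewrite (le_trans (ler_normB _ _))// lerD// normrM ?normrN ler_wpM2l.
Qed.

Lemma sum_half_le (a : nat -> R) D m n : (forall k, `|a k| <= D * 2^-1 ^+ k) ->
  `|\sum_(m <= k < n) a k| <= D * 2 * 2^-1 ^+ m.
Proof.
move=> ha; have D0 : 0 <= D by have := ha 0; rewrite expr0 mulr1; exact: le_trans.
case: (leqP m n) => mn; last by rewrite big_geq ?normr0 ?(ltnW mn)// !mulr_ge0// exprn_ge0// invr_ge0.
have := half_series_partial ha m (n - m); rewrite subnKC// /series/=.
rewrite [in X in X - _](big_cat_nat _ mn)//= addrAC subrr add0r => /le_trans; apply.
by rewrite ler_wpM2l ?mulr_ge0// lerBlDr lerDl exprn_ge0// invr_ge0.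
Qed.

Lemma half_pred n : (2^-1 : R) ^+ n.-1 <= 2 * 2^-1 ^+ n.
Proof.
case: n => [|n] /=; first by rewrite expr0 mulr1 ler1n.
by rewrite exprS mulrA divff// mul1r.
Qed.

Lemma sum_lat_le z C n N : (forall m, `|z m| <= C * 2^-1 ^+ m) ->
  `|\sum_(n.-1 <= m < N) lat z m| <= growth * C * 2^-1 ^+ n.
Proof.
move=> hz; have C0 : 0 <= C by have := hz 0; rewrite expr0 mulr1; exact: le_trans.
apply: le_trans (sum_half_le _ _ (fun m => lat_bound m hz)) _.
apply: le_trans (ler_wpM2l _ (half_pred n)) _; first by rewrite !mulr_ge0// addr_ge0// mulr_ge0.
rewrite mulrA ler_wpM2r ?exprn_ge0 ?invr_ge0// /growth.
by have := normr_ge0 p; have := normr_ge0 r; nra.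
Qed.

Lemma coef_bound k n : `|coef k n| <= growth ^+ k * 2^-1 ^+ n.
Proof.
elim: k n => [|k IH] n; last first.
  by rewrite exprS; exact: sum_lat_le.
rewrite expr0 mul1r; case: n => [|n] /=; first by rewrite normr1 expr0.
by rewrite normr0 exprn_ge0// invr_ge0.
Qed.

Lemma geo_coef n : geo (2^-1 ^+ n) growth (fun k => coef k n).
Proof. by move=> k; rewrite mulrC coef_bound. Qed.

Lemma lat_sum (w : nat -> R) (z : nat -> nat -> R) J n :
  lat (fun n => \sum_(0 <= k < J) z k n * w k) n = \sum_(0 <= k < J) w k * lat (z k) n.
Proof.
elim: J => [|J IH]; first by rewrite /lat !big_geq//; ring.
rewrite [RHS]big_nat_recr//= -IH /lat !(big_nat_recr J)//=; ring.
Qed.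

Section Generating.
Variables (th s : R).
Hypotheses (th_small : `|th| <= 4^-1) (s_large : 2 * growth <= s).
Hypothesis th_root :
  s * th * (1 - th) = - (p * (1 - th ^+ 2) * (1 - th) + r * (1 + th) ^+ 3).

Let zeta n := th ^+ n / (1 - th).
Let err J n := zeta n - \sum_(0 <= k < J) coef k n * s ^- k.

Let s_gt0 : 0 < s.
Proof. by apply: lt_le_trans s_large; rewrite mulr_gt0// growth_gt0. Qed.

Let th1 : 1 - th != 0.
Proof.
rewrite subr_eq0; apply/eqP => h; move: th_small; rewrite -h normr1.
by rewrite leNgt invf_lt1// ltr1n.
Qed.

Let zeta_bound n : `|zeta n| <= 2 * 2^-1 ^+ n.
Proof.
have h : th <= 4^-1 by exact: le_trans (ler_norm _) th_small.
have h1 : 2^-1 <= 1 - th by lra.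
have h0 : 0 < 1 - th by apply: lt_le_trans h1; rewrite invr_gt0.
rewrite /zeta normrM normfV (gtr0_norm h0) mulrC ler_pM ?invr_ge0 ?(ltW h0)//.
  by rewrite -[leRHS]invrK lef_pV2// posrE// invr_gt0.
rewrite normrX lerXn2r ?nnegrE ?invr_ge0//; apply: le_trans th_small _.
by rewrite lef_pV2 ?posrE// ler_nat.
Qed.

Let zeta_lat n : zeta n.+1 - zeta n.+2 = s^-1 * lat zeta n.
Proof.
have s0 : s != 0 by rewrite gt_eqF.
have e : s * th * (1 - th) ^+ 2 =
  - (p * (1 - th ^+ 2) * (1 - th) + r * (1 + th) ^+ 3) * (1 - th).
  by rewrite -th_root; ring.
apply: (mulfI s0); rewrite mulrA divff// mul1r.
apply: (mulfI th1); rewrite /lat /zeta !exprS.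
set q := th ^+ n.
transitivity (q * (s * th * (1 - th))); first by field; rewrite th1.
by rewrite th_root; field; rewrite th1.
Qed.

Let err_step J n : err J.+1 n.+1 - err J.+1 n.+2 = s^-1 * lat (err J) n.
Proof.
rewrite /err [LHS](_ : _ = (zeta n.+1 - zeta n.+2) -
  (\sum_(0 <= k < J.+1) coef k n.+1 * s ^- k - \sum_(0 <= k < J.+1) coef k n.+2 * s ^- k)); last by ring.
rewrite zeta_lat -sumrB big_nat_recl//= !mul0r subr0 add0r.
rewrite (eq_bigr (fun k => s^-1 * (s ^- k * lat (coef k) n))); last first.
  by move=> k _; rewrite -mulrBl coefS exprS invfM; ring.
rewrite -mulr_sumr -lat_sum -mulrBr; congr (_ * _); rewrite /lat; ring.
Qed.


(** By [err_step] the error obeys the same recurrence as the coefficients, so each further order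
    gains the factor [growth / s]. The recurrence only controls differences in [n]; it is summed up
    to infinity, where the error vanishes. *)
Let err_bound J n : `|err J n| <= 2 * (growth / s) ^+ J * 2^-1 ^+ n.
Proof.
elim: J n => [|J IH] n.
  by rewrite /err big_geq// subr0 expr0 mulr1 zeta_bound.
have E m : err J.+1 n.-1.+1 = s^-1 * \sum_(n.-1 <= k < n.-1 + m) lat (err J) k + err J.+1 (n.-1 + m).+1.
  elim: m => [|m IHm]; first by rewrite addn0 big_geq// mulr0 add0r.
  rewrite IHm addnS big_nat_recr ?leq_addr//= mulrDr -err_step; ring.
have -> : err J.+1 n = err J.+1 n.-1.+1.
  case: n {E} => [//|n //]; apply/eqP; rewrite -subr_eq0; apply/eqP.
  rewrite /err [LHS](_ : _ = (zeta 0 - zeta 1) -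
    (\sum_(0 <= k < J.+1) coef k 0 * s ^- k - \sum_(0 <= k < J.+1) coef k 1 * s ^- k)); last by ring.
  rewrite -sumrB big_nat_recl//= big1_seq => [|k _]; last by rewrite subrr.
  by rewrite /zeta !mulr1n !mul0r subr0 addr0 mul1r expr0 invr1 expr1; field.
(* [D] is not uniform in [J]: it only serves to let the last term of [E] tend to 0 as [m] grows. *)
pose D := 2 + \sum_(0 <= k < J.+1) growth ^+ k * s ^- k.
have hD m : `|err J.+1 m| <= D * 2^-1 ^+ m.
  rewrite /D mulrDl /err (le_trans (ler_normB _ _))// lerD//.
  rewrite mulr_suml (le_trans (ler_norm_sum _ _ _))//; apply: ler_sum => k _.
  rewrite normrM (ger0_norm (_ : 0 <= s ^- k)) ?invr_ge0 ?exprn_ge0 ?(ltW s_gt0)//.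
  by rewrite mulrAC ler_wpM2r ?coef_bound// invr_ge0 exprn_ge0// ltW.
rewrite -subr_le0; apply: (@le_half_expr0 _ _ D) => m.
rewrite (E m) lerBlDl (le_trans (ler_normD _ _))// lerD//.
  rewrite normrM (gtr0_norm (_ : 0 < s^-1)) ?invr_gt0//.
  rewrite (le_trans (ler_wpM2l _ (sum_lat_le _ _ IH)))// ?invr_ge0 ?(ltW s_gt0)//.
  by rewrite exprS le_eqVlt; apply/orP; left; apply/eqP; ring.
have D0 : 0 <= D by have := hD 0; rewrite expr0 mulr1; exact: le_trans.
rewrite (le_trans (hD _))// ler_wpM2l//.
rewrite ler_wiXn2l ?invr_ge0 ?invf_le1 ?ler1n//.
by rewrite (leq_trans (leq_addl n.-1 m)).
Qed.

Lemma coef_generating n :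
  series (fun k => coef k n * s ^- k) N @[N --> \oo] --> th ^+ n / (1 - th).
Proof.
apply/cvgrPdist_le => e e0.
have := half_expr_cvg0 (2 : R) => /cvgrPdist_le/(_ _ e0); apply: filterS => J.
rewrite sub0r normrN => h; apply: le_trans (err_bound J n) _.
apply: le_trans (le_trans (ler_norm _) h).
rewrite -mulrA ler_wpM2l//.
have gs0 : 0 <= growth / s by rewrite divr_ge0 ?(ltW growth_gt0) ?ltW.
rewrite -[leRHS]mulr1 ler_pM ?exprn_ge0 ?invr_ge0//.
  rewrite lerXn2r ?nnegrE ?invr_ge0// ler_pdivrMr// ler_pdivlMl//.
by rewrite exprn_ile1 ?invr_ge0// invf_le1 ?ler1n.
Qed.

End Generating.
End Lattice.

(** * The modes of a trace and their telescoping energy *)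

Section Dissipation.
Context {R : realType}.
Variables (p r : R).
Implicit Types (g : R -> R) (t T : R).

(** The operator with symbol [th ^ n / (1 - th)]; the y_n of the overview are the differences of
    consecutive modes. *)
Definition mode n g t : R := op (fun k => coef p r k n) g t.

Let B := growth p r.
Let B0 : 0 < B. Proof. exact: growth_gt0. Qed.

Lemma continuous_mode n g : continuous g -> continuous (mode n g).
Proof. by move=> cg; exact: (continuous_op B0 (geo_coef p r n) cg). Qed.

Lemma op_zero g t : op (fun=> 0) g t = 0.
Proof.
rewrite /op; apply/cvg_lim => //; rewrite (_ : series _ = fun=> 0).
  exact: cvg_cst.
by apply/funext => n; rewrite /series/= big1// => i _; rewrite mul0r.
Qed.

Lemma op_sub A A' g M M' D : 0 < D -> geo M D A -> geo M' D A' ->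
  continuous g -> forall t, op (fun k => A k - A' k) g t = op A g t - op A' g t.
Proof.
move=> D0 hA hA' cg t; rewrite -[X in X - _]mul1r -[X in _ - X]mul1r -mulNr.
by rewrite -(op_lin _ _ D0 hA hA' cg); apply: op_eq => k; rewrite mul1r mulN1r.
Qed.

Lemma mode01 g : continuous g -> forall t, mode 0 g t - mode 1 g t = g t.
Proof.
move=> cg t; rewrite /mode -(op_sub B0 (geo_coef p r 0) (geo_coef p r 1) cg).
have h : geo 1 B (fun k => (k == 0)%:R).
  move=> [|k] /=; rewrite mul1r ?normr1 ?expr0// normr0 exprn_ge0// ltW//.
rewrite (op_eq _ _ (coef01 p r)) (op_shift B0 h cg)/= mul1r.
rewrite (_ : op _ g = fun=> 0); last by apply/funext => x; rewrite op_zero.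
rewrite (_ : (fun=> 0) = (fun t => 0 * g t + 0 * g t)); last first.
  by apply/funext => x; rewrite mul0r addr0.
by rewrite prim_lin// !mul0r !addr0.
Qed.

Lemma geo_lin A A' (a b M M' D : R) : 0 < D -> geo M D A -> geo M' D A' ->
  geo (`|a| * M + `|b| * M') D (fun k => a * A k + b * A' k).
Proof.
move=> D0 hA hA' k; rewrite (le_trans (ler_normD _ _))// mulrDl !normrM.
by rewrite -!mulrA; apply: lerD; apply: ler_wpM2l => //.
Qed.

Lemma op_lat n g : continuous g -> forall t,
  op (fun k => lat p r (coef p r k) n) g t = lat p r (fun m => mode m g t) n.
Proof.
move=> cg t.
have G m := geo_coef p r m.
have g1 := geo_lin (- p - r) (p - 3 * r) B0 (G n) (G n.+1).
have g2 := geo_lin (p - 3 * r) (- p - r) B0 (G n.+2) (G n.+3).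
rewrite (_ : (fun k => _) = (fun k =>
  1 * ((- p - r) * coef p r k n + (p - 3 * r) * coef p r k n.+1)
  + 1 * ((p - 3 * r) * coef p r k n.+2 + (- p - r) * coef p r k n.+3))); last first.
  by apply/funext => k; rewrite /lat; ring.
rewrite (op_lin _ _ B0 g1 g2 cg) (op_lin _ _ B0 (G n) (G n.+1) cg).
by rewrite (op_lin _ _ B0 (G n.+2) (G n.+3) cg) /lat /mode; ring.
Qed.

(** The symbol [th ^ n.+1] has no constant term in [1 / s], so the difference is differentiable
    although [g] is only continuous, and its derivative has symbol [s * th ^ n.+1]. *)
Lemma is_derive_modeB n g : continuous g -> forall t,
  is_derive t 1 (fun t => mode n.+1 g t - mode n.+2 g t)
    (lat p r (fun m => mode m g t) n).
Proof.
move=> cg t; have G m := geo_coef p r m.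
rewrite (_ : (fun t => _) = op (fun k => 1 * coef p r k n.+1 + (-1) * coef p r k n.+2) g).
  rewrite -op_lat//.
  have := is_derive_op B0 (geo_lin 1 (-1) B0 (G n.+1) (G n.+2)) _ cg t.
  rewrite /= mulr0 mulr0 addr0 => /(_ erefl) h; apply: is_derive_eq h _.
  by apply: op_eq => k; rewrite mul1r mulN1r coefS.
by apply/funext => x; rewrite (op_lin _ _ B0 (G n.+1) (G n.+2) cg) mul1r mulN1r.
Qed.

(** The quadratic form for which the derivative of half the square of [z n.+1 - z n.+2] becomes a
    difference in [n], see [lat_flux]. *)
Definition flux (z : nat -> R) n : R :=
  p * (z n - z n.+1) * (z n.+1 - z n.+2)
  + r * (z n * z n.+1 + z n.+1 * z n.+2 + 3 * z n.+1 ^+ 2 - z n * z n.+2).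

Lemma lat_flux z n : (z n.+1 - z n.+2) * lat p r z n = flux z n.+1 - flux z n.
Proof. by rewrite /lat /flux; ring. Qed.

Lemma flux_bound z C : (forall m, `|z m| <= C * 2^-1 ^+ m) -> forall n,
  `|flux z n| <= (4 * `|p| + 6 * `|r|) * C ^+ 2 * 2^-1 ^+ n.
Proof.
move=> hz n; have C0 : 0 <= C by have := hz 0; rewrite expr0 mulr1; exact: le_trans.
pose q := C * 2^-1 ^+ n; have q0 : 0 <= q by rewrite mulr_ge0// exprn_ge0// invr_ge0.
have hq m : (n <= m)%N -> `|z m| <= q.
  move=> nm; apply: le_trans (hz m) _; rewrite ler_wpM2l//.
  by rewrite ler_wiXn2l ?invr_ge0 ?invf_le1 ?ler1n.
have [h0 h1 h2] := And3 (hq n (leqnn _)) (hq n.+1 (leqnSn _)) (hq n.+2 (leq_trans (leqnSn _) (leqnSn _))).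
have zz a b : `|a| <= q -> `|b| <= q -> `|a * b| <= q ^+ 2.
  by move=> ha hb; rewrite normrM expr2 ler_pM.
apply: (@le_trans _ _ ((4 * `|p| + 6 * `|r|) * q ^+ 2)).
  have b1 : `|(z n - z n.+1) * (z n.+1 - z n.+2)| <= 4 * q ^+ 2.
    rewrite normrM (_ : 4 * _ = (q + q) * (q + q)); last by ring.
    by rewrite ler_pM// (le_trans (ler_normB _ _))// lerD.
  have b2 : `|z n * z n.+1 + z n.+1 * z n.+2 + 3 * z n.+1 ^+ 2 - z n * z n.+2| <= 6 * q ^+ 2.
    rewrite (_ : 6 * _ = q ^+ 2 + q ^+ 2 + 3 * q ^+ 2 + q ^+ 2); last by ring.
    rewrite (le_trans (ler_normB _ _))// lerD ?zz// (le_trans (ler_normD _ _))// lerD//.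
      by rewrite (le_trans (ler_normD _ _))// lerD// zz.
    by rewrite normrM ger0_norm// ler_wpM2l// [X in `|X|]expr2 zz.
  rewrite (_ : (_ + _) * _ = `|p| * (4 * q ^+ 2) + `|r| * (6 * q ^+ 2)); last by ring.
  by rewrite /flux -mulrA (le_trans (ler_normD _ _))// lerD// normrM ler_wpM2l.
rewrite -mulrA ler_wpM2l ?addr_ge0 ?mulr_ge0// /q exprMn ler_wpM2l ?sqr_ge0//.
by rewrite expr2 ler_piMl ?exprn_ge0 ?exprn_ile1 ?invr_ge0 ?invf_le1 ?ler1n.
Qed.

(** The decay in [n] comes from the constant in [geo_coef]; through [flux_bound] it removes the far
    end of the telescoping sum. *)
Lemma mode_bound T g : continuous g ->
  exists C, forall t, `|t| <= T -> forall n, `|mode n g t| <= C * 2^-1 ^+ n.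
Proof.
move=> cg; have B2 : 0 < 2 * B by rewrite mulr_gt0.
have [C gC] := locally_exp_bounded T B2 cg.
exists (C * expR (2 * B * T) * 2) => t tT n.
have C0 : 0 <= C.
  have := gC 0; rewrite normr0 mulr0 expR0 mulr1 => /(_ (le_trans (normr_ge0 _) tT)).
  exact: le_trans.
have := op_bound B0 (geo_coef p r n) cg gC tT => /le_trans; apply.
rewrite (_ : 2^-1 ^+ n * _ * _ * _ = C * 2 * 2^-1 ^+ n * expR (2 * B * `|t|)); last by ring.
rewrite [leRHS](_ : _ = C * 2 * 2^-1 ^+ n * expR (2 * B * T)); last by ring.
by rewrite ler_wpM2l ?mulr_ge0 ?exprn_ge0 ?invr_ge0// ler_expR ler_wpM2l// ltW.
Qed.

Lemma continuous_flux_mode n g : continuous g ->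
  continuous (fun t => flux (fun m => mode m g t) n).
Proof.
move=> cg; have cm m := @continuous_mode m g cg.
have cM (f h : R -> R) : continuous f -> continuous h -> continuous (fun t : R => f t * h t : R).
  exact: continuous_mul.
have cD (f h : R -> R) : continuous f -> continuous h -> continuous (fun t : R => f t + h t : R).
  by move=> cf ch t; apply: cvgD; [exact: cf|exact: ch].
have cN (f : R -> R) : continuous f -> continuous (fun t : R => - f t : R).
  by move=> cf t; apply: cvgN; exact: cf.
have cC (a : R) : continuous (fun t : R => a) by move=> t; exact: cvg_cst.
rewrite /flux; apply: (cD).
  by do 2 (apply: (cM); last by apply: (cD) => //; apply: (cN)); exact: cC.
apply: (cM); first exact: cC.
apply: (cD); last by apply: (cN); apply: (cM).
apply: (cD); first by apply: (cD); apply: (cM).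
by apply: (cM); [exact: cC|apply: (cM)].
Qed.

(* Along the modes, [flux] telescopes: minus its integral is half the sum of the
   squares of the differences of consecutive modes at the final time. *)
Lemma dissipation g T : continuous g -> 0 <= T ->
  prim (fun t => flux (fun m => mode m g t) 0) T <= 0.
Proof.
move=> cg T0; have TT : `|T| <= T by rewrite ger0_norm.
pose F n t := flux (fun m => mode m g t) n.
pose y n t := mode n.+1 g t - mode n.+2 g t.
have cF n : continuous (F n) by exact: continuous_flux_mode.
have E N : prim (F 0) T = prim (F N) T - 2^-1 * \sum_(n < N) y n T ^+ 2
    + 2^-1 * \sum_(n < N) y n 0 ^+ 2.
  elim: N => [|N ->]; first by rewrite !big_ord0 !mulr0 subr0 addr0.
  rewrite !big_ord_recr/=.
  have dy t : is_derive t 1 (fun t => 2^-1 * (y N t * y N t)) (F N.+1 t - F N t).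
    have d := is_derive_modeB N cg t.
    apply: is_derive_eq (dlamZ 2^-1 (dlamM d d)) _.
    by rewrite /F -lat_flux /y; field.
  have := prim_unique _ dy T; rewrite prim_sub// => e.
  have cFF : continuous (fun t => F N.+1 t - F N t).
    by move=> t; apply: cvgB; exact: cF.
  by have {}e := e cFF; rewrite !expr2; lra.
(* At time 0 only the coefficient of order 0 survives, and it vanishes for all modes but the
   first. *)
have y0 n : y n 0 = 0.
  rewrite /y /mode; do 2 rewrite (op_shift B0 (geo_coef p r _) cg) prim0 addr0.
  by rewrite /= mul0r subr0.
have [C hC] := mode_bound T cg.
apply: (@le_half_expr0 _ _ ((4 * `|p| + 6 * `|r|) * C ^+ 2 * expR `|T|)) => N.
have y00 : \sum_(n < N) y n 0 ^+ 2 = 0 by rewrite big1// => n _; rewrite y0 expr0n.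
rewrite (E N) y00 mulr0 addr0.
apply: (@le_trans _ _ (prim (F N) T)).
  by rewrite lerBlDr lerDl mulr_ge0 ?invr_ge0// sumr_ge0// => n _; exact: sqr_ge0.
rewrite mulrAC; apply: le_trans (ler_norm _) _.
by apply: (@prim_small _ _ _ T) => // t tT; apply: flux_bound; exact: hC.
Qed.

End Dissipation.

(** * Bernstein polynomials *)

Section Bernstein.
Context {R : realType}.
Implicit Types (f : nat -> R) (x : R).

(* The Bernstein polynomial of [f], as the expectation of [f] at a binomial
   variable, computed by conditioning on the first trial. *)
Fixpoint bernstein n f : {poly R} :=
  if n is n'.+1 then
    (1 - 'X) * bernstein n' f + 'X * bernstein n' (fun k => f k.+1)
  else (f 0)%:P.

Lemma bernstein_rec n f x : (bernstein n.+1 f).[x] =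
  (1 - x) * (bernstein n f).[x] + x * (bernstein n (fun k => f k.+1)).[x].
Proof. by rewrite /= !hornerE. Qed.

Lemma bernstein_le n f g x : 0 <= x <= 1 -> (forall k, f k <= g k) ->
  (bernstein n f).[x] <= (bernstein n g).[x].
Proof.
move=> /andP[x0 x1]; elim: n f g => [|n IH] f g fg; first by rewrite /= !hornerE.
by rewrite !bernstein_rec lerD// ler_wpM2l ?subr_ge0// IH.
Qed.

(** The mean square deviation of a binomial variable from [c]: squared bias plus variance. *)
Lemma bernstein_var n (u v c x : R) :
  (bernstein n (fun k => u + v * (k%:R - c) ^+ 2)).[x] =
  u + v * ((n%:R * x - c) ^+ 2 + n%:R * x * (1 - x)).
Proof.
elim: n c => [|n IH] c; first by rewrite /= !hornerE; ring.
rewrite bernstein_rec IH (_ : (fun k => _) = fun k => u + v * (k%:R - (c - 1)) ^+ 2).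
  by rewrite IH -!natr1; ring.
by apply/funext => k; rewrite -natr1; ring.
Qed.

(** Bernstein's proof, with a quadratic majorant in place of splitting the sum: positivity of the
    operator and its second moment suffice. *)
Lemma lipschitz_poly_approx (f : R -> R) (L e : R) :
  (forall x y, `|f x - f y| <= L * `|x - y|) -> 0 < e ->
  exists P : {poly R}, forall x, 0 <= x <= 1 -> `|f x - P.[x]| <= e.
Proof.
move=> fL e0; have L0 : 0 <= L.
  by have := fL 1 0; rewrite subr0 normr1 mulr1; exact: le_trans.
(* [d] makes the linear part [L * d] at most [e / 2], and [N] below does the same for the variance
   part; [L + 1] avoids dividing by 0. *)
pose d := e / (2 * (L + 1)).
have d0 : 0 < d by rewrite divr_gt0// mulr_gt0// ltr_wpDl.
have [N hN] : exists N : nat, 2 * L / (d * e) < N%:R.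
  by exists (Num.truncn (2 * L / (d * e))).+1; exact: truncnS_gt.
have NS : (0 : R) < N%:R.
  by apply: le_lt_trans hN; apply: divr_ge0; apply: mulr_ge0 => //; exact: ltW.
exists (bernstein N (fun k => f (k%:R / N%:R))) => x x01.
have /andP[x0 x1] := x01.
pose v := L / (d * N%:R ^+ 2).
have v0 : 0 <= v by rewrite divr_ge0// mulr_ge0 ?exprn_ge0// ltW.
(* Based on [q <= d + q ^ 2 / d] for the distance [q] between [x] and the node. *)
have key k : `|f x - f (k%:R / N%:R)| <= L * d + v * (k%:R - N%:R * x) ^+ 2.
  rewrite (le_trans (fL _ _))// /v.
  have -> : L / (d * N%:R ^+ 2) * (k%:R - N%:R * x) ^+ 2 =
      L * ((x - k%:R / N%:R) ^+ 2 / d) by field; rewrite !gt_eqF.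
  rewrite -mulrDr ler_wpM2l// -real_normK ?num_real//.
  set q := `|_|; have q0 : 0 <= q by exact: normr_ge0.
  have [qd|dq] := leP q d; first by rewrite ler_wpDr// divr_ge0 ?exprn_ge0// ltW.
  rewrite ler_wpDl ?(ltW d0)// expr2 -mulrA ler_peMr//.
  by rewrite ler_pdivlMr// mul1r ltW.
have val : L * d + v * ((N%:R * x - N%:R * x) ^+ 2 + N%:R * x * (1 - x)) <= e.
  have h1 : L * d <= e / 2.
    rewrite /d mulrA ler_pdivrMr ?mulr_gt0 ?ltr_wpDl//.
    by rewrite (_ : _ / 2 * _ = L * e + e); [lra|field].
  have h2 : v * ((N%:R * x - N%:R * x) ^+ 2 + N%:R * x * (1 - x)) <= e / 2.
    have -> : v * ((N%:R * x - N%:R * x) ^+ 2 + N%:R * x * (1 - x)) =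
      (L / (d * N%:R)) * (x * (1 - x)).
      by rewrite /v; field; rewrite !gt_eqF.
    apply: (@le_trans _ _ (L / (d * N%:R))).
      rewrite ler_piMr//; first by apply: divr_ge0 => //; apply: mulr_ge0; exact: ltW.
      by rewrite mulr_ile1 ?subr_ge0// gerBl.
    rewrite (ler_pdivrMr _ _ (mulr_gt0 d0 NS)).
    move: hN; rewrite (ltr_pdivrMr _ _ (mulr_gt0 d0 e0)) => /ltW h.
    by rewrite (_ : e / 2 * _ = 2^-1 * (N%:R * (d * e))); [lra|field].
  by lra.
rewrite ler_norml; apply/andP; split.
  rewrite lerNl opprB lerBlDr addrC.
  apply: le_trans (bernstein_le _ (g := fun k => f x + L * d + v * (k%:R - N%:R * x) ^+ 2) x01 _) _.
    by move=> k; have := key k; rewrite ler_norml => /andP[? ?]; lra.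
  by rewrite bernstein_var; lra.
rewrite lerBlDr -lerBlDl.
apply: le_trans (bernstein_le _ (f := fun k => f x - L * d + (- v) * (k%:R - N%:R * x) ^+ 2) x01 _).
  by rewrite bernstein_var; lra.
by move=> k; have := key k; rewrite ler_norml => /andP[? ?]; lra.
Qed.

End Bernstein.

(** * Test functions *)

Section Bump.
Context {R : realType}.
Variables (a b : R).
Hypothesis ab : a < b.
Implicit Types (N : {poly R}) (m : nat) (z : R).

Lemma is_derive0_quad (f : R -> R) (C x : R) :
  (forall z, `|f z| <= C * (z - x) ^+ 2) -> is_derive x 1 f 0.
Proof.
move=> fC; have fx : f x = 0.
  by apply/eqP; rewrite -normr_le0 (le_trans (fC x))// subrr expr0n mulr0.
apply/is_derive1_caratheodory; exists (fun z => f z / (z - x)); split.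
- move=> z; rewrite fx subr0; have [->|zx] := eqVneq z x; first by rewrite fx mul0r mul0r.
  by rewrite divfK// subr_eq0.
- apply/cvgrPdist_le => e e0; rewrite /= fx mul0r.
  have C0 : 0 <= `|C| by exact: normr_ge0.
  have : (fun z : R => z) z @[z --> x] --> x by exact: cvg_id.
  have d0 : 0 < e / (`|C| + 1) by rewrite divr_gt0// ltr_wpDl.
  move=> /cvgrPdist_le/(_ _ d0); apply: filterS => z; rewrite distrC => hz.
  rewrite sub0r normrN normrM normfV.
  have [->|zx] := eqVneq z x; first by rewrite fx normr0 mul0r ltW.
  have z0 : 0 < `|z - x| by rewrite normr_gt0 subr_eq0.
  rewrite ler_pdivrMr// (le_trans (fC z))// -[(z - x) ^+ 2]real_normK ?num_real// expr2 mulrA.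
  rewrite ler_wpM2r//; apply: (@le_trans _ _ (`|C| * `|z - x|)).
    by rewrite ler_wpM2r// ler_norm.
  move: hz; rewrite ler_pdivlMr ?ltr_wpDl// => h; apply: le_trans h.
  by rewrite mulrDr mulrC lerDl mulr1.
- by rewrite fx mul0r.
Qed.

Lemma expRN_le (k : nat) (D : R) : 0 < D ->
  expR (- D^-1) <= (k.+1)`!%:R * D ^+ k.+1.
Proof.
move=> D0; have V0 : 0 <= D^-1 by rewrite invr_ge0 ltW.
have f0 : (0 : R) < (k.+1)`!%:R by rewrite ltr0n fact_gt0.
rewrite expRN -[leRHS]invrK lef_pV2 ?posrE ?expR_gt0 ?invr_gt0 ?mulr_gt0 ?exprn_gt0//.
rewrite invfM mulrC -exprVn.
by apply: le_trans (expR_ge1Dxn k V0); rewrite lerDr.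
Qed.

Let D z : R := (z - a) * (b - z).
Let DP : {poly R} := ('X - a%:P) * (b%:P - 'X).

Let DPE z : DP.[z] = D z.
Proof. by rewrite /DP !hornerE. Qed.

(* The factors [N] and [(D z) ^- m] make this family stable under differentiation. *)
Definition bump N m z : R :=
  if a < z < b then N.[z] * (D z) ^- m * expR (- (D z)^-1) else 0.

(** Numerator of the derivative over the denominator [D ^ m.+2]; the last term comes from the
    exponential. *)
Let bump' N m : {poly R} :=
  N^`() * DP ^+ 2 - m%:R *: (N * DP^`() * DP) + N * DP^`().

Let D_gt0 z : a < z < b -> 0 < D z.
Proof. by move=> /andP[az zb]; rewrite mulr_gt0// subr_gt0. Qed.

Lemma is_derive_poly N z : is_derive z 1 (horner N) (N^`()).[z].
Proof. by apply: derive1_is_derive; [exact: derivable_horner|by rewrite -derivE]. Qed.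

(** The exponential beats every power of [D]. Two powers to spare give a zero derivative at the
    ends, hence smoothness by induction in the stable family. *)
Let bump_near0 N m : exists C, forall z, `|bump N m z| <= C * (D z) ^+ 2.
Proof.
have [C NC] := @locally_bounded R (horner N) (`|a| + `|b|) (fun z => is_derive_cont (is_derive_poly N z)).
exists (C * (m.+2)`!%:R) => z; rewrite /bump; case: ifPn => zab; last first.
  rewrite normr0 mulr_ge0 ?sqr_ge0// mulr_ge0 ?exprn_ge0//.
  by have := NC 0; rewrite normr0 addr_ge0// => /(_ isT); exact: le_trans.
have D0 := D_gt0 zab.
rewrite -mulrA normrM -mulrA ler_pM//.
  apply: NC; move: zab => /andP[az zb].
  have := ler_norm b; have := ler_norm (- a); rewrite normrN.
  have := normr_ge0 a; have := normr_ge0 b; rewrite ler_norml; lra.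
rewrite ger0_norm ?mulr_ge0 ?invr_ge0 ?expR_ge0 ?exprn_ge0 ?(ltW D0)//.
rewrite mulrC ler_pdivrMr ?exprn_gt0// (le_trans (expRN_le m.+1 D0))//.
by rewrite -mulrA -exprD addnC addn2.
Qed.

Lemma is_derive_bump N m z : is_derive z 1 (bump N m) (bump (bump' N m) m.+2 z).
Proof.
case: (boolP (a < z < b)) => [zab|zab].
  have /andP[az zb] := zab; have D0 := D_gt0 zab; have Dn0 : D z != 0 by rewrite gt_eqF.
  apply: (@near_eq_is_derive _ _ _ (fun z => N.[z] * (D z) ^- m * expR (- (D z)^-1))).
    have : \forall x \near z, x \in `]a, b[ by exact: near_in_itvoo.
    by apply: filterS => x; rewrite in_itv/= /bump => ->.
  have dD : is_derive z 1 D (DP^`()).[z].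
    by rewrite (_ : D = horner DP); [exact: is_derive_poly|apply/funext => x; rewrite DPE].
  have dV : is_derive z 1 (fun x => (D x)^-1) (- (D z) ^- 2 * (DP^`()).[z]).
    exact: is_deriveV.
  have dVm : is_derive z 1 (fun x => (D x)^-1 ^+ m) (- m%:R * (D z) ^- m.+1 * (DP^`()).[z]).
    elim: m => [|m IH].
      by rewrite oppr0 !mul0r; apply: (is_derive_cst (1 : R)).
    rewrite (_ : (fun x => _) = fun x => (D x)^-1 * (D x)^-1 ^+ m); last first.
      by apply/funext => x; rewrite exprS.
    apply: is_derive_eq (dlamM dV IH) _; rewrite -natr1 !exprS exprVn; field.
    by rewrite Dn0 expf_neq0.
  have h := dlamM (dlamM (is_derive_poly N z) dVm)
    (dlamcomp (g := fun x => - (D x)^-1) (is_derive_expR _) (dlamN dV)).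
  rewrite (_ : (fun z => _) = (fun x => N.[x] * (D x)^-1 ^+ m * expR (- (D x)^-1))); last first.
    by apply/funext => x; rewrite exprVn.
  apply: is_derive_eq h _; rewrite /bump zab /bump' expr2; have := DPE z.
  move: (DP) => Q e; rewrite !(hornerD, hornerN, hornerM, hornerZ) !e exprVn !exprS; field.
  by rewrite Dn0 expf_neq0.
have -> : bump (bump' N m) m.+2 z = 0 by rewrite /bump (negbTE zab).
have [C hC] := bump_near0 N m.
(* If [x] is inside the interval and [z] is not, then [D x] is at most [b - a] times the distance
   from [x] to [z]; the end points and the exterior are thus treated together. *)
apply: (@is_derive0_quad _ (C * (b - a) ^+ 2)) => x.
have C0 : 0 <= C.
  have := hC ((a + b) / 2); rewrite -ler_pdivrMr; last first.
    by apply: exprn_gt0; apply: D_gt0; rewrite ltr_pdivlMr// ltr_pdivrMr// !mulr_natr !mulr2n ltrD2l ltrD2r ab.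
  by apply: le_trans; rewrite divr_ge0// sqr_ge0.
have [xab|xab] := boolP (a < x < b); last first.
  by rewrite /bump (negbTE xab) normr0 mulr_ge0 ?sqr_ge0// mulr_ge0 ?sqr_ge0.
rewrite (le_trans (hC x))// -mulrA ler_wpM2l// -exprMn.
have D0 := D_gt0 xab; move: zab; rewrite negb_and -!leNgt => /orP[za|bz].
  rewrite lerXn2r ?nnegrE ?(ltW D0)//; rewrite /D; move: xab => /andP[ax xb].
    by rewrite mulr_ge0// subr_ge0; lra.
  by rewrite mulrC ler_pM ?subr_ge0 ?(ltW ax) ?(ltW xb)//; lra.
rewrite -[leRHS]sqrrN lerXn2r ?nnegrE ?(ltW D0)//; rewrite /D; move: xab => /andP[ax xb].
  by rewrite -mulrN opprB mulr_ge0// subr_ge0; lra.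
by rewrite -mulrN opprB ler_pM ?subr_ge0 ?(ltW ax) ?(ltW xb)//; lra.
Qed.

Lemma bump_smooth n N m : exists N' m', derive1n n (bump N m) = bump N' m'.
Proof.
elim: n N m => [|n IH] N m; first by exists N, m.
rewrite derive1Sn (_ : derive1 _ = bump (bump' N m) m.+2); first exact: IH.
by apply/funext => z; apply: is_derive_derive1; exact: is_derive_bump.
Qed.

Lemma bump_test (U : set R) : `[a, b]%classic `<=` U -> test_function U (bump 1 0).
Proof.
move=> abU; split.
  move=> n t; have [N [m ->]] := bump_smooth n 1 0.
  by have [] := is_derive_bump N m t.
exists `[a, b]%classic; first by split => //; exact: segment_compact.
move=> t tab; rewrite /bump; case: ifPn => // /andP[a_t t_b].
by exfalso; apply: tab; rewrite /= in_itv/= (ltW a_t) (ltW t_b).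
Qed.

Lemma bump_gt0 z : a < z < b -> 0 < bump 1 0 z.
Proof. by move=> zab; rewrite /bump zab hornerE mul1r invr1 mul1r expR_gt0. Qed.

Lemma bump_ge0 z : 0 <= bump 1 0 z.
Proof.
by rewrite /bump; case: ifPn => // _; rewrite hornerE mul1r invr1 mul1r expR_ge0.
Qed.

Lemma continuous_bump : continuous (bump 1 0).
Proof. by move=> z; exact: is_derive_cont (is_derive_bump 1 0 z). Qed.

End Bump.

Section TestFunctions.
Context {R : realType}.
Implicit Types (f g h phi : R -> R) (t : R).
Let mu := @lebesgue_measure R.

Lemma is_derive_near0 f t : (\forall x \near t, f x = 0) -> is_derive t 1 f 0.
Proof.
move=> h; have d : is_derive t 1 (fun=> 0 : R) 0 := is_derive_cst (0 : R) t 1.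
by apply: near_eq_is_derive d; apply: filterS h => x ->.
Qed.

Definition supp (a b : R) phi : Prop := forall t, ~~ (a <= t <= b) -> phi t = 0.

Definition cont0 f : Prop := forall t, 0 < t -> {for t, continuous f}.

Lemma test_function_supp phi : test_function `]0, +oo[%classic phi ->
  exists a b, [/\ 0 < a, a <= b & supp a b phi].
Proof.
move=> [_ [K [cK K0] phiK]].
have [M [_ KM]] := compact_bounded cK.
have : closed K by apply: compact_closed => //; exact: Rhausdorff.
rewrite -openC openE => /(_ 0) [].
  by move=> /K0; rewrite /= in_itv/= ltxx.
move=> e /= e0 he; exists (Num.min e 1), (`|M| + 2); split.
- by rewrite lt_min e0 ltr01.
- by rewrite (@le_trans _ _ 1) ?ge_min ?lexx ?orbT// ler_wpDl// ler1n.
move=> t ht; apply: phiK => Kt; move/negP: ht; apply; apply/andP; split.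
  rewrite leNgt; apply/negP; rewrite lt_min => /andP[te _].
  have t0 : 0 < t by have := K0 _ Kt; rewrite /= in_itv/= andbT.
  by apply: (he t) Kt; rewrite /ball/= sub0r normrN gtr0_norm.
apply: le_trans (ler_norm _) _; apply: KM Kt.
by rewrite (le_lt_trans (ler_norm _))// ltrDl.
Qed.

Lemma derive_supp (a b : R) phi : supp a b phi -> supp a b (derive1 phi).
Proof.
move=> sphi t tab; apply: is_derive_derive1.
apply: is_derive_near0.
move: tab; rewrite negb_and -!ltNge => /orP[ta|bt].
  have : \forall x \near t, x < a by exact: lt_nbhsl.
  by apply: filterS => x xa; rewrite sphi// negb_and -ltNge xa.
have : \forall x \near t, b < x by exact: lt_nbhsr.
by apply: filterS => x xa; rewrite sphi// negb_and -!ltNge xa orbT.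
Qed.

Lemma derive1n_supp n (a b : R) phi : supp a b phi -> supp a b (derive1n n phi).
Proof. by elim: n => [//|n IH] /IH h; rewrite derive1nS; exact: derive_supp. Qed.

Lemma test_is_derive (U : set R) phi n t : test_function U phi ->
  is_derive t 1 (derive1n n phi) (derive1n n.+1 phi t).
Proof. by move=> [sphi _]; apply: derive1_is_derive => //; rewrite derive1nS. Qed.

Lemma test_continuous (U : set R) phi n : test_function U phi ->
  continuous (derive1n n phi).
Proof. by move=> tphi t; exact: is_derive_cont (test_is_derive n t tphi). Qed.

Arguments test_is_derive {U phi} n t _.
Arguments test_continuous {U phi} n _.

Lemma integral_supp f (a b : R) : 0 < a -> a <= b -> supp a b f ->
  \int[mu]_(t in `]0, +oo[) f t = prim f b /\
  \int[mu]_(t in `[0, +oo[) f t = prim f b.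
Proof.
move=> a0 ab sf; rewrite primE ?(le_trans (ltW a0))//.
have E (A : set R) : (forall t, a <= t -> A t) ->
    \int[mu]_(t in A) f t = \int[mu]_(t in `[0, b]) f t.
  move=> aA; rewrite [LHS]Rintegral_mkcond [RHS]Rintegral_mkcond.
  congr (Rintegral _ _ _); apply/funext => t; rewrite !patchE.
  have [tab|/sf ->] := boolP (a <= t <= b); last by rewrite !if_same.
  have /andP[at_ tb] := tab.
  by rewrite !mem_set//=; [rewrite in_itv/= tb (le_trans (ltW a0))|exact: aA].
split; apply: E => t at_; rewrite /= in_itv/= andbT.
  exact: lt_le_trans at_.
by rewrite (le_trans (ltW a0)).
Qed.

(** Freezing [f] to the left of [a] makes it continuous on the whole line without changing its
    product with a function supported in [[a, b]], so that the results on [prim] apply. *)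
Definition ext (a : R) f t : R := f (Num.max a t).

Lemma continuous_ext (a : R) f : 0 < a -> cont0 f -> continuous (ext a f).
Proof.
move=> a0 cf t; apply: continuous_comp; last first.
  by apply: cf; rewrite lt_max a0.
by apply: continuous_max; [exact: cvg_cst|exact: cvg_id].
Qed.

Lemma ext_supp (a b : R) f phi : supp a b phi -> (fun t => f t * phi t) = (fun t => ext a f t * phi t).
Proof.
move=> sphi; apply/funext => t; rewrite /ext.
have [//|ta] := leP a t.
by rewrite sphi ?mulr0// negb_and -ltNge ta.
Qed.

Lemma pairing_prim (a b : R) f phi : 0 < a -> a <= b -> supp a b phi ->
  pairing f phi = prim (fun t => ext a f t * phi t) b.
Proof.
move=> a0 ab sphi; rewrite -(ext_supp _ sphi).
have : supp a b (fun t => f t * phi t) by move=> t /sphi ->; rewrite mulr0.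
by move=> /(integral_supp a0 ab)[<- _].
Qed.

Lemma pairing_lin f g phi (k l : R) : test_function `]0, +oo[%classic phi ->
  cont0 f -> cont0 g ->
  pairing (fun t => k * f t + l * g t) phi = k * pairing f phi + l * pairing g phi.
Proof.
move=> tphi cf cg; have [a [b [a0 ab sphi]]] := test_function_supp tphi.
have cphi : continuous phi := test_continuous 0 tphi.
rewrite !(pairing_prim _ a0 ab sphi) -prim_lin.
- by congr (prim _ _); apply/funext => t; rewrite /ext; ring.
- by apply: continuous_mul => //; exact: continuous_ext.
- by apply: continuous_mul => //; exact: continuous_ext.
Qed.

Lemma pairing_derive f f' phi : test_function `]0, +oo[%classic phi ->
  (forall t, 0 < t -> is_derive t 1 f (f' t)) -> cont0 f' ->
  pairing f (derive1 phi) = - pairing f' phi.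
Proof.
move=> tphi df cf'; have [a [b [a0 ab sphi]]] := test_function_supp tphi.
(* [supp] says nothing about the value at [b]; at [b + 1] the boundary term is certainly 0. *)
have ab1 : a <= b + 1 by rewrite (le_trans ab)// lerDl.
have sphi1 : supp a (b + 1) phi.
  move=> t; rewrite negb_and -!ltNge => h; apply: sphi; rewrite negb_and -!ltNge.
  by case/orP: h => [->//|h]; rewrite (lt_trans _ h) ?orbT// ltrDl.
have sdphi1 := derive_supp sphi1.
have cf : cont0 f by move=> t t0; exact: is_derive_cont (df t t0).
have cphi : continuous phi := test_continuous 0 tphi.
have cdphi : continuous (derive1 phi) := test_continuous 1 tphi.
have cA : continuous (fun t => ext a f' t * phi t).
  by apply: continuous_mul => //; exact: continuous_ext.
have cB : continuous (fun t => ext a f t * derive1 phi t).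
  by apply: continuous_mul => //; exact: continuous_ext.
rewrite (pairing_prim _ a0 ab1 sdphi1) (pairing_prim _ a0 ab1 sphi1).
apply/eqP; rewrite -subr_eq0 opprK -[prim _ _ + _]mul1r mulrDr -prim_lin//.
pose F t := f t * phi t.
have F0 t : ~~ (a <= t <= b) -> F t = 0 by move=> h; rewrite /F sphi// mulr0.
rewrite -(_ : F (b + 1) - F 0 = 0); last first.
  by rewrite !F0 ?subr0// negb_and -?ltNge ?a0// ltrDl ltr01 orbT.
apply/eqP; symmetry; apply: prim_unique.
  by move=> t; apply: cvgD; apply: cvgM (cvg_cst _) _; [exact: cB|exact: cA].
move=> t; rewrite !mul1r; have [t0|t0] := ltP 0 t; last first.
  have ta : t < a by exact: le_lt_trans a0.
  have zero : ~~ (a <= t <= b + 1) by rewrite negb_and -ltNge ta.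
  rewrite sphi1// sdphi1// !mulr0 addr0.
  apply: is_derive_near0.
  have : \forall x \near t, x < a by exact: lt_nbhsl.
  by apply: filterS => x xa; rewrite F0// negb_and -ltNge xa.
have E g psi : supp a (b + 1) psi -> ext a g t * psi t = g t * psi t.
  by move=> s; have /(congr1 (fun k => k t)) := ext_supp g s.
rewrite !E//; apply: is_derive_eq (dlamM (df t t0) (test_is_derive 0 t tphi)) _.
by rewrite addrC.
Qed.

(** One inequality is enough, since [pairing_inj] applies it to both [f - g] and [g - f]. *)
Lemma pairing_eq0 h : cont0 h ->
  (forall phi, test_function `]0, +oo[%classic phi -> pairing h phi = 0) ->
  forall t, 0 < t -> h t <= 0.
Proof.
move=> ch h0 t t0; rewrite leNgt; apply/negP => ht.
have [e e0 he] : exists2 e, 0 < e & forall x, `|x - t| <= e -> h t / 2 < h x.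
  have : \forall x \near t, h t / 2 < h x.
    by apply: (cvgr_gt _ (ch t t0)); rewrite ltr_pdivrMr// ltr_pMr// ltr1n.
  move=> /nbhs_ballP[d /= d0 hd]; exists (d / 2); first by rewrite divr_gt0.
  move=> x xt; apply: hd; rewrite /ball/= distrC; apply: le_lt_trans xt _.
  by rewrite ltr_pdivrMr// ltr_pMr// ltr1n.
pose d := Num.min e (t / 2).
have d0 : 0 < d by rewrite lt_min e0 divr_gt0.
have dt : d <= t / 2 by rewrite ge_min lexx orbT.
have ab : t - d < t + d by rewrite ltrD2l (lt_trans _ d0)// oppr_lt0.
have a0 : 0 < t - d by lra.
have test : test_function `]0, +oo[%classic (bump (t - d) (t + d) 1 0).
  apply: bump_test => // x; rewrite /= !in_itv/= andbT => /andP[+ _].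
  exact: lt_le_trans.
have sb : supp (t - d) (t + d) (bump (t - d) (t + d) 1 0).
  move=> x; rewrite /bump; case: ifPn => // /andP[h1 h2].
  by rewrite (ltW h1) (ltW h2).
have := h0 _ test; rewrite (pairing_prim _ a0 (ltW ab) sb).
set F := (fun x => ext _ _ _ * _) => pF0.
have cF : continuous F.
  by apply: continuous_mul; [exact: continuous_ext|exact: continuous_bump].
have F0 x : 0 <= F x.
  have [xab|xab] := boolP (t - d <= x <= t + d); last by rewrite /F sb// mulr0.
  rewrite /F mulr_ge0 ?bump_ge0// /ext max_r; last by case/andP: xab.
  apply: le_trans (ltW (he _ _)); first by rewrite divr_ge0// ltW.
  by rewrite (@le_trans _ _ d) ?ge_min ?lexx// ler_norml; lra.
have Ft : 0 < F t.
  rewrite /F mulr_gt0 ?bump_gt0//; last by lra.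
  by rewrite /ext max_r//; lra.
(* A nondecreasing primitive that vanishes at 0 and at [t + d] is constant in between, which
   contradicts [F t > 0]. *)
have mono x y : x <= y -> prim F x <= prim F y.
  move=> xy; apply: (@derive_le _ (fun=> prim F x) (prim F) (fun=> 0) F x y) => //.
  - by move=> s _; exact: is_derive_prim.
  - by apply: continuous_subspaceT => s; exact: cvg_cst.
  - exact/continuous_subspaceT/continuous_prim.
have cstF x : 0 < x < t + d -> prim F x = 0.
  move=> /andP[x0 xd]; apply/eqP; rewrite eq_le -{1}pF0 mono ?(ltW xd)//=.
  by rewrite -(prim0 F) mono// ltW.
have d1 : is_derive t 1 (prim F) 0.
  apply: is_derive_near0.
  have : \forall x \near t, x \in `]0, (t + d)[.
    by apply: near_in_itvoo; rewrite in_itv/= t0 ltrDl.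
  by apply: filterS => x; rewrite in_itv/= => /cstF ->.
have := is_derive_derive1 (is_derive_prim cF t).
by rewrite (is_derive_derive1 d1) => e1; move: Ft; rewrite -e1 ltxx.
Qed.

Lemma pairing_inj f g : cont0 f -> cont0 g ->
  (forall phi, test_function `]0, +oo[%classic phi -> pairing f phi = pairing g phi) ->
  forall t, 0 < t -> f t = g t.
Proof.
move=> cf cg fg t t0; apply/eqP; rewrite eq_le.
have c1 (k l : R) : cont0 (fun t => k * f t + l * g t).
  by move=> x x0; apply: cvgD; apply: cvgM (cvg_cst _) _; [exact: cf|exact: cg].
have h1 := @pairing_eq0 _ (c1 1 (-1)); have h2 := @pairing_eq0 _ (c1 (-1) 1).
have /h1/(_ t t0) : forall phi, test_function `]0, +oo[%classic phi ->
    pairing (fun t => 1 * f t + (-1) * g t) phi = 0.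
  by move=> phi tphi; rewrite pairing_lin// fg//; ring.
have /h2/(_ t t0) : forall phi, test_function `]0, +oo[%classic phi ->
    pairing (fun t => (-1) * f t + 1 * g t) phi = 0.
  by move=> phi tphi; rewrite pairing_lin// fg//; ring.
by move=> ? ?; apply/andP; split; lra.
Qed.

End TestFunctions.

Arguments test_is_derive {R U phi} n t _.
Arguments test_continuous {R U phi} n _.

(** * Laplace transforms *)

Section HalfLineIntegral.
Context {R : realType}.
Implicit Types (f g h F : R -> R) (s k t C : R).
Let mu := @lebesgue_measure R.

Definition half : set R := `[0, +oo[%classic.

Lemma measurable_half : measurable (half : set (measurableTypeR R)).
Proof. exact: measurable_itv. Qed.
Local Hint Resolve measurable_half : core.

Lemma halfP t : half t <-> 0 <= t.
Proof. by rewrite /half/= in_itv/= andbT. Qed.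

Definition integ f : Prop := mu.-integrable half (EFin \o f).

Lemma integ_ext f g : (forall t, 0 <= t -> f t = g t) -> integ f -> integ g.
Proof.
move=> fg; apply: eq_integrable => // t; rewrite inE => /halfP t0.
by rewrite /= fg.
Qed.

Lemma integD f g : integ f -> integ g -> integ (fun t => f t + g t).
Proof. by move=> hf hg; have := integrableD measurable_half hf hg. Qed.

Lemma integZ k f : integ f -> integ (fun t => k * f t).
Proof. by move=> hf; have := integrableZl measurable_half k hf. Qed.

Lemma integ_norm f : integ f -> integ (fun t => `|f t|).
Proof. by move=> hf; have := integrable_norm hf. Qed.

Lemma measurable_cont f : continuous f -> measurable_fun half f.
Proof.
move=> cf; apply: measurable_funTS; exact: measurable_realfun.continuous_measurable_fun.
Qed.

Lemma integ_measurable f : integ f -> measurable_fun half f.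
Proof. by move=> /integrableP[/measurable_EFinP]. Qed.

Lemma integ_le f g : measurable_fun half f -> integ g ->
  (forall t, 0 <= t -> `|f t| <= g t) -> integ f.
Proof.
move=> mf hg fg; apply: le_integrable hg => //; first exact/measurable_EFinP.
by move=> t /halfP t0; rewrite /= lee_fin (le_trans (fg t t0))// ler_norm.
Qed.

Lemma integ_expN_val k : 0 < k -> integ (fun t => expR (- (k * t))) /\
  \int[mu]_(t in half) expR (- (k * t)) = k^-1.
Proof.
move=> k0.
pose f t := expR (- (k * t)); pose F t := - k^-1 * expR (- (k * t)).
have df t : is_derive t 1 f (- k * expR (- (k * t))).
  rewrite /f (_ : (fun t => _) = fun t => expR (- k * t)); last by apply/funext => x; rewrite mulNr.
  by rewrite -mulNr; exact: dlamexp.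
have dF t : is_derive t 1 F (f t).
  apply: is_derive_eq (dlamZ (- k^-1) (df t)) _.
  by rewrite mulrA mulrNN mulVf ?mul1r// gt_eqF.
have cf : continuous f by move=> t; exact: is_derive_cont (df t).
have lim : F x @[x --> +oo] --> 0.
  rewrite -(mulr0 (- k^-1)); apply: cvgM; first exact: cvg_cst.
  have h : (fun x => k * x) x @[x --> +oo] --> +oo by exact: gt0_cvgMry k0 _.
  exact: cvg_comp h (@cvgr_expR R).
have int : (\int[mu]_(t in half) (f t)%:E = 0%:E - (F 0)%:E)%E.
  apply: (@ge0_continuous_FTC2y R f F 0 0) => //.
  - by move=> x _; exact: expR_ge0.
  - exact: continuous_subspaceT.
  - by apply: cvg_at_right_filter; exact: (is_derive_cont (dF 0)).
  - by move=> x _; exact: is_derive_derive1 (dF x).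
have F0 : F 0 = - k^-1 by rewrite /F mulr0 oppr0 expR0 mulr1.
split; last by rewrite /Rintegral int F0 sub0e EFinN oppeK.
apply/integrableP; split; first by apply/measurable_EFinP; exact: (measurable_cont cf).
under eq_integral do rewrite /= ger0_norm ?expR_ge0//.
by rewrite int -EFinB ltry.
Qed.

Lemma integ_dominated F C k : continuous F -> 0 < k ->
  (forall t, 0 <= t -> `|F t| <= C * expR (- (k * t))) -> integ F.
Proof.
move=> cF k0 hF; apply: (@integ_le _ (fun t => C * expR (- (k * t)))) => //.
  exact: measurable_cont.
by apply: integZ; have [] := integ_expN_val k0.
Qed.

Lemma integ_dominated_val F C k : continuous F -> 0 < k ->
  (forall t, 0 <= t -> `|F t| <= C * expR (- (k * t))) ->
  `|\int[mu]_(t in half) F t| <= C / k.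
Proof.
move=> cF k0 hF; have [ie ve] := integ_expN_val k0.
have iF := integ_dominated cF k0 hF.
rewrite (le_trans (le_normr_Rintegral _ iF))// -ve.
rewrite -(RintegralZl _ _ ie)//.
apply: le_Rintegral => //; [exact: integ_norm|exact: integZ|].
by move=> t /halfP/hF.
Qed.

Lemma prim_cvg F : continuous F -> integ F ->
  prim F n%:R @[n --> \oo] --> \int[mu]_(t in half) F t.
Proof.
move=> cF iF; pose f_ n := F \_ (`[0, n%:R]%classic : set R).
have mf n : measurable_fun half (EFin \o f_ n).
  apply/measurable_EFinP/measurable_restrict => //.
  by apply: measurable_funTS; exact: measurable_realfun.continuous_measurable_fun.
have E n : prim F n%:R = \int[mu]_(t in half) f_ n t.
  rewrite primE// /f_ -Rintegral_mkcondr; congr (Rintegral _ _ _).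
  rewrite setIidr// => x; rewrite /= in_itv/= => /andP[x0 _]; exact/halfP.
have mF : measurable_fun half (EFin \o F) by apply/measurable_EFinP; exact: (measurable_cont cF).
have [|||_ _ h] := @dominated_convergence _ _ _ mu half measurable_half
  (fun n => EFin \o f_ n) (EFin \o F) (EFin \o (fun t => `|F t|)) mf mF.
- apply: aeW => t /halfP t0; apply: cvg_EFin; first exact: nearW.
  apply: (@cvg_near_cst _ _ _ _ \oo).
  exists (Num.truncn t).+1 => // n /= tn; rewrite /f_ patchE mem_set//= in_itv/= t0/=.
  by rewrite (le_trans (ltW (truncnS_gt t)))// ler_nat.
- exact: integ_norm.
- apply: aeW => t n _; rewrite /= lee_fin /f_ patchE; case: ifPn => //.
  by rewrite normr0.
rewrite (_ : (fun n => _) = fun n => \int[mu]_(t in half) f_ n t); last exact/funext.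
by apply: fine_cvg; rewrite fineK//; apply: integrable_fin_num.
Qed.

End HalfLineIntegral.

Section LaplaceOfSeries.
Context {R : realType}.
Implicit Types (f g h F : R -> R) (s t C : R) (A : nat -> R).
Let mu := @lebesgue_measure R.

Definition damp s F t : R := F t * expR (- (s * t)).

Definition lap s F : R := \int[mu]_(t in half) damp s F t.

Lemma is_derive_expN s t : is_derive t 1 (fun t => expR (- (s * t))) (- s * expR (- (s * t))).
Proof.
rewrite (_ : (fun t => _) = fun t => expR (- s * t)); last by apply/funext => x; rewrite mulNr.
by rewrite -mulNr; exact: dlamexp.
Qed.

Lemma continuous_expN s : continuous (fun t : R => expR (- (s * t))).
Proof. by move=> t; exact: is_derive_cont (is_derive_expN s t). Qed.

Lemma continuous_damp s F : continuous F -> continuous (damp s F).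
Proof. by move=> cF; apply: continuous_mul => //; exact: continuous_expN. Qed.

Lemma damp_bound F C sigma s t : `|F t| <= C * expR (sigma * t) ->
  `|damp s F t| <= C * expR (- ((s - sigma) * t)).
Proof.
move=> hF; rewrite /damp normrM (ger0_norm (expR_ge0 _)).
rewrite (_ : - ((s - sigma) * t) = sigma * t + - (s * t)); last by ring.
by rewrite expRD mulrA ler_wpM2r ?expR_ge0.
Qed.

Lemma damp_integ F C sigma s : continuous F -> sigma < s ->
  (forall t, 0 <= t -> `|F t| <= C * expR (sigma * t)) -> integ (damp s F).
Proof.
move=> cF ss hF; apply: (@integ_dominated _ _ C (s - sigma)).
- exact: continuous_damp.
- by rewrite subr_gt0.
- by move=> t /hF/damp_bound; exact.
Qed.

Lemma lap_bound F C sigma s : continuous F -> sigma < s ->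
  (forall t, 0 <= t -> `|F t| <= C * expR (sigma * t)) ->
  `|lap s F| <= C / (s - sigma).
Proof.
move=> cF ss hF; apply: integ_dominated_val.
- exact: continuous_damp.
- by rewrite subr_gt0.
- by move=> t /hF/damp_bound; exact.
Qed.

Lemma lapD s F h : integ (damp s F) -> integ (damp s h) ->
  lap s (fun t => F t + h t) = lap s F + lap s h.
Proof.
move=> iF ih; rewrite -(RintegralD measurable_half iF ih).
by apply: eq_Rintegral => t _; rewrite /damp mulrDl.
Qed.

Lemma lapZ s F (k : R) : integ (damp s F) -> lap s (fun t => k * F t) = k * lap s F.
Proof.
move=> iF; rewrite -(RintegralZl k measurable_half iF).
by apply: eq_Rintegral => t _; rewrite /damp mulrA.
Qed.

Lemma damp_integD s F h : integ (damp s F) -> integ (damp s h) ->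
  integ (damp s (fun t => F t + h t)).
Proof.
by move=> iF ih; have := integD iF ih; apply: integ_ext => t _; rewrite /damp mulrDl.
Qed.

Lemma damp_integZ s F (k : R) : integ (damp s F) -> integ (damp s (fun t => k * F t)).
Proof.
by move=> iF; have := integZ k iF; apply: integ_ext => t _; rewrite /damp mulrA.
Qed.

(** Being transformable is an integral condition that gives no pointwise bound on [g], but it gives
    one on its primitive. The series are therefore transformed on [prim g]. *)
Lemma prim_exp_bound g sigma : continuous g -> 0 < sigma -> integ (damp sigma g) ->
  exists C, forall t, 0 <= t -> `|prim g t| <= C * expR (sigma * t).
Proof.
move=> cg s0 ig; exists (\int[mu]_(t in half) `|damp sigma g t|) => t t0.
have cng : continuous (fun t => `|g t|).
  by move=> x; apply: continuous_comp; [exact: cg|exact: norm_continuous].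
have cnd : continuous (fun x => expR (sigma * t) * `|damp sigma g x|).
  move=> x; apply: cvgM; first exact: cvg_cst.
  by apply: continuous_comp; [exact: continuous_damp|exact: norm_continuous].
have sub : `[0, t] `<=` (half : set R).
  by move=> x; rewrite /= in_itv/= => /andP[x0 _]; exact/halfP.
have imm : mu.-integrable `[0, t] (EFin \o (fun t => `|damp sigma g t|)).
  by apply: (integrableS measurable_half) sub _; [exact: measurable_itv|exact: integ_norm].
rewrite primE// (le_trans (le_normr_Rintegral _ (continuous_integrable_itv 0 t cg)))//.
apply: (@le_trans _ _ (\int[mu]_(x in `[0, t]) (expR (sigma * t) * `|damp sigma g x|))).
  apply: le_Rintegral => //; try exact: continuous_integrable_itv.
  move=> x; rewrite /= in_itv/= => /andP[x0 xt].
  rewrite /damp normrM (ger0_norm (expR_ge0 _)) mulrCA -expRD ler_peMr//.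
  by rewrite -[leLHS]expR0 ler_expR -mulrN -mulrDr mulr_ge0 ?(ltW s0)// subr_ge0.
rewrite RintegralZl// mulrC ler_wpM2r ?expR_ge0//.
rewrite -[leLHS]/(fine _) -[leRHS]/(fine _) fine_le//.
- exact: integrable_fin_num imm.
- by apply: integrable_fin_num; [exact: measurable_half|exact: integ_norm].
- apply: ge0_subset_integral => //; first exact: measurable_half.
  by apply/measurable_EFinP; exact: integ_measurable (integ_norm ig).
Qed.

Lemma cvg_expN_nat (k C : R) : 0 < k -> C * expR (- (k * n%:R)) @[n --> \oo] --> 0.
Proof.
move=> k0; rewrite -(mulr0 C); apply: cvgM; first exact: cvg_cst.
have h : k * n%:R @[n --> \oo] --> +oo.
  apply/cvgryPge => A; have /cvgryPge/(_ (A / k)) := @cvgr_idn R.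
  by apply: filterS => n; rewrite ler_pdivrMr// mulrC.
exact: cvg_comp h (@cvgr_expR R).
Qed.

Lemma lap_prim g C sigma s : continuous g -> sigma < s -> 0 < s ->
  integ (damp s g) ->
  (forall t, 0 <= t -> `|prim g t| <= C * expR (sigma * t)) ->
  lap s (prim g) = s^-1 * lap s g.
Proof.
move=> cg ss s0 ig hC.
have cpg := continuous_prim cg.
have c1 := continuous_damp (s := s) cpg; have c2 := continuous_damp (s := s) cg.
have h1 := prim_cvg c1 (damp_integ cpg ss hC).
have h2 := prim_cvg c2 ig.
have s0' : s != 0 by rewrite gt_eqF.
have E T : prim (damp s (prim g)) T = s^-1 * prim (damp s g) T - s^-1 * damp s (prim g) T.
  have d (x : R) : is_derive x 1 (fun x => s^-1 * prim (damp s g) x - s^-1 * damp s (prim g) x)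
      (damp s (prim g) x).
    have e1 := dlamM (is_derive_prim cg x) (is_derive_expN s x).
    apply: is_derive_eq (dlamB (dlamZ s^-1 (is_derive_prim c2 x)) (dlamZ s^-1 e1)) _.
    by rewrite /damp; field.
  have := @prim_unique _ _ _ c1 d T; rewrite prim0 /damp prim0 mul0r !mulr0 subr0 subr0.
  by move=> <-.
have h3 : damp s (prim g) n%:R @[n --> \oo] --> 0.
  apply: (@squeeze_cvgr _ _ _ _ (fun n => - (C * expR (- ((s - sigma) * n%:R))))
    (fun n => C * expR (- ((s - sigma) * n%:R)))).
  - apply: nearW => n; rewrite -ler_norml; apply: damp_bound; exact: hC.
  - rewrite -oppr0; apply: cvgN; apply: cvg_expN_nat; by rewrite subr_gt0.
  - by apply: cvg_expN_nat; rewrite subr_gt0.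
have h4 : prim (damp s (prim g)) n%:R @[n --> \oo] --> s^-1 * lap s g - s^-1 * 0.
  under eq_fun do rewrite E.
  by apply: cvgB; apply: cvgM (cvg_cst _) _.
have := cvg_unique _ h1 h4; rewrite mulr0 subr0; exact.
Qed.

Section Op.
Variables (B M : R) (A : nat -> R) (h : R -> R) (C s m : R).
Hypotheses (B0 : 0 < B) (hA : geo M B A) (ch : continuous h).
Hypothesis hC : forall t, `|h t| <= C * expR (2 * B * `|t|).
Hypothesis s_large : 2 * B < s.
Hypothesis series_m : series (fun k => A k * s ^- k) N @[N --> \oo] --> m.

Let B2 : 0 < 2 * B. Proof. by rewrite mulr_gt0. Qed.
Let s0 : 0 < s. Proof. exact: lt_trans s_large. Qed.

Let iterC k t : 0 <= t ->
  `|iter k prim h t| <= C / (2 * B) ^+ k * expR (2 * B * t).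
Proof.
by move=> t0; have := @iter_prim_bound R h C t (2 * B) B2 ch (fun x _ => hC x) k t;
  rewrite ger0_norm//; apply.
Qed.

Let iter_integ k : integ (damp s (iter k prim h)).
Proof. exact: (damp_integ (continuous_iter_prim ch) s_large (iterC k)). Qed.

Let lap_iter k : lap s (iter k prim h) = s ^- k * lap s h.
Proof.
elim: k => [|k IH] /=; first by rewrite expr0 invr1 mul1r.
rewrite (lap_prim (continuous_iter_prim (k := k) ch) s_large s0 (iter_integ k) (@iterC k.+1)).
by rewrite IH mulrA exprS invfM.
Qed.

Let lap_series N : integ (damp s (fun t => series (fun k => A k * iter k prim h t) N)) /\
  lap s (fun t => series (fun k => A k * iter k prim h t) N) =
  series (fun k => A k * s ^- k) N * lap s h.
Proof.
elim: N => [|N [i1 IH]].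
  have E : (fun t => series (fun k => A k * iter k prim h t) 0%N) = fun t => 0 * h t.
    by apply/funext => t; rewrite /series/= big_geq// mul0r.
  rewrite E; split; first exact: damp_integZ (iter_integ 0).
  by rewrite (lapZ 0 (iter_integ 0)) /series/= big_geq.
have E : (fun t => series (fun k => A k * iter k prim h t) N.+1) =
    fun t => series (fun k => A k * iter k prim h t) N + A N * iter N prim h t.
  by apply/funext => t; rewrite seriesSr.
have i2 := damp_integZ (A N) (iter_integ N).
rewrite E; split; first exact: damp_integD.
by rewrite lapD// IH lapZ// lap_iter seriesSr; ring.
Qed.

(** Term by term: the truncation error is [2 ^- N] times an exponential of rate [2 * B], which is
    integrable against [exp (- s t)] as [s > 2 * B]. *)
Lemma lap_op_bounded : integ (damp s (op A h)) /\ lap s (op A h) = m * lap s h.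
Proof.
have cop := continuous_op B0 hA ch.
have bop t : 0 <= t -> `|op A h t| <= (M * C * 2) * expR (2 * B * t).
  move=> t0; have := @op_bound R A h M B C t B0 hA ch (fun x _ => hC x) t.
  by rewrite ger0_norm// => /(_ (lexx _)); rewrite mulrAC.
have iop := damp_integ cop s_large bop.
split=> //; have [i0 _] := lap_series 0.
have key N : `|lap s (op A h) - series (fun k => A k * s ^- k) N * lap s h| <=
    (M * C * 2 / (s - 2 * B)) * 2^-1 ^+ N.
  have [iN <-] := lap_series N.
  have -> : lap s (op A h) - lap s (fun t => series (fun k => A k * iter k prim h t) N) =
     lap s (fun t => op A h t + (-1) * series (fun k => A k * iter k prim h t) N).
    by rewrite lapD ?lapZ ?mulN1r//; exact: damp_integZ.
  rewrite mulrAC; apply: lap_bound => //.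
    move=> t; apply: cvgD; first exact: cop.
    by apply: cvgM; [exact: cvg_cst|exact: continuous_series_iter].
  move=> t t0; rewrite mulN1r.
  have := @op_tail R A h M B C t B0 hA ch (fun x _ => hC x) t.
  rewrite ger0_norm// => /(_ (lexx _) N) /le_trans; apply.
  by rewrite le_eqVlt; apply/orP; left; apply/eqP; ring.
have c1 : series (fun k => A k * s ^- k) N * lap s h @[N --> \oo] --> m * lap s h.
  by apply: cvgM; [exact: series_m|exact: cvg_cst].
have c2 : series (fun k => A k * s ^- k) N * lap s h @[N --> \oo] --> lap s (op A h).
  apply/cvgrPdist_le => e e0.
  have := half_expr_cvg0 (M * C * 2 / (s - 2 * B)) => /cvgrPdist_le/(_ _ e0).
  apply: filterS => N; rewrite sub0r normrN => hN.
  by apply: le_trans (key N) (le_trans (ler_norm _) hN).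
exact: cvg_unique c2 c1.
Qed.

End Op.

(** Unlike in [op_shift], the primitive is factored out next to [f]: the remaining series acts on
    [prim f], for which an exponential bound is available. *)
Lemma op_shift_prim A f M B : 0 < B -> geo M B A -> continuous f -> forall t,
  op A f t = A 0 * f t + op (fun k => A k.+1) (prim f) t.
Proof.
move=> B0 hA cf t; rewrite {1}/op; apply/cvg_lim => //.
rewrite -(cvg_shiftS (series (fun k => A k * iter k prim f t))).
have E : (fun n => series (fun k => A k * iter k prim f t) n.+1) =
   (fun n => A 0 * f t + series (fun k => A k.+1 * iter k prim (prim f) t) n).
  apply/funext => n; rewrite /series/= big_nat_recl//=.
  by congr (_ + _); apply: eq_bigr => k _; rewrite -iterSr.
rewrite E; apply: cvgD; first exact: cvg_cst.
exact: (op_cvg B0 (geoS hA) (continuous_prim cf)).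
Qed.

Lemma series_shift (A : nat -> R) (x s : R) : s != 0 ->
  series (fun k => A k * s ^- k) N @[N --> \oo] --> x ->
  series (fun k => A k.+1 * s ^- k) N @[N --> \oo] --> s * (x - A 0).
Proof.
move=> s0; rewrite -(cvg_shiftS (series (fun k => A k * s ^- k))) => h.
have h' : s * (series (fun k => A k * s ^- k) N.+1 - A 0) @[N --> \oo] --> s * (x - A 0).
  by apply: cvgM; [exact: cvg_cst|apply: cvgB h (cvg_cst _)].
apply: cvg_trans h'; apply: near_eq_cvg; apply: nearW => N.
rewrite /series/= big_nat_recl//= expr0 invr1 mulr1 addrAC subrr add0r mulr_sumr.
by apply: eq_bigr => k _; rewrite exprS invfM (mulrCA s) mulVKf.
Qed.

(** The estimates on [op] are symmetric in time; evenness of [g] carries the exponential bound on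
    [prim g] over to negative times. *)
Lemma lap_op A g M B s (m : R) : 0 < B -> geo M B A -> continuous g ->
  (forall t, g (- t) = g t) -> integ (damp (2 * B) g) -> integ (damp s g) ->
  2 * B < s -> series (fun k => A k * s ^- k) N @[N --> \oo] --> m ->
  integ (damp s (op A g)) /\ lap s (op A g) = m * lap s g.
Proof.
move=> B0 hA cg eg i2B isg sB hm.
have B2 : 0 < 2 * B by rewrite mulr_gt0.
have s0 : 0 < s by exact: lt_trans sB.
have [C hC] := prim_exp_bound cg B2 i2B.
have hC' t : `|prim g t| <= C * expR (2 * B * `|t|).
  case: (leP 0 t) => t0; first by rewrite (ger0_norm t0) hC.
  have -> : prim g t = - prim g (- t).
    by rewrite (prim_opp cg) opprK (_ : (fun x => g (- x)) = g)//; exact/funext.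
  have t0' : 0 <= - t by rewrite oppr_ge0 ltW.
  by rewrite normrN -(normrN t) (ger0_norm t0') hC.
have E : op A g = fun t => A 0 * g t + op (fun k => A k.+1) (prim g) t.
  by apply/funext => t; rewrite (op_shift_prim B0 hA cg).
have s0' : s != 0 by rewrite gt_eqF.
have hm' := series_shift s0' hm.
have [i1 l1] := lap_op_bounded B0 (geoS hA) (continuous_prim cg) hC' sB hm'.
have i2 := damp_integZ (A 0) isg.
rewrite E; split; first exact: damp_integD.
rewrite lapD// lapZ// l1 (lap_prim cg sB s0 isg hC).
by field; rewrite gt_eqF.
Qed.

End LaplaceOfSeries.

(** * Uniqueness of the Laplace transform, from its values at real points *)

Section LaplaceUniqueness.
Context {R : realType}.
Implicit Types (f g h F phi : R -> R) (s t C : R).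
Let mu := @lebesgue_measure R.

(** Integration backwards from infinity, where the second bound excludes an additive constant. Only
    the decay in that bound matters, so [C] does not enter the conclusion. *)
Lemma decay_primitive F f (e C s T0 : R) : 0 < s ->
  (forall t, is_derive t 1 F (f t)) ->
  (forall t, 0 <= t -> `|f t| <= e * expR (- (s * t))) ->
  (forall t, T0 <= t -> `|F t| <= C * expR (- (s * t))) ->
  forall t, 0 <= t -> `|F t| <= e / s * expR (- (s * t)).
Proof.
move=> s0 dF hf hF t t0; apply/ler_addgt0Pl => d d0.
have : \forall n \near \oo, C * expR (- (s * n%:R)) <= d.
  have /cvgrPdist_le/(_ _ d0) := @cvg_expN_nat R s C s0.
  by apply: filterS => n; rewrite sub0r normrN => /(le_trans (ler_norm _)).
move=> [N _ hN].
pose n := maxn N (Num.truncn (Num.max t T0)).+1.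
have nmax : Num.max t T0 <= n%:R.
  by rewrite (le_trans (ltW (truncnS_gt _)))// ler_nat leq_maxr.
have tn : t <= n%:R by apply: le_trans nmax; rewrite le_max lexx.
have Tn : T0 <= n%:R by apply: le_trans nmax; rewrite le_max lexx orbT.
have Fn : `|F n%:R| <= d by apply: le_trans (hF _ Tn) _; apply: hN; rewrite /= leq_maxl.
have es0 : 0 <= e by have := hf 0 (lexx _); rewrite mulr0 oppr0 expR0 mulr1; exact: le_trans.
pose H x := e / s * (expR (- (s * t)) - expR (- (s * x))).
have dH (x : R) : is_derive x 1 H (e * expR (- (s * x))).
  apply: is_derive_eq (dlamZ (e / s) (dlamB (is_derive_cst (expR (- (s * t))) x 1) (is_derive_expN s x))) _.
  by rewrite sub0r mulNr opprK; field; rewrite gt_eqF.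
have cF : continuous F by move=> x; exact: is_derive_cont (dF x).
have cH : continuous H by move=> x; exact: is_derive_cont (dH x).
have d1 (k x : R) : is_derive x 1 (fun x => k * (F x - F t)) (k * f x).
  apply: is_derive_eq (dlamZ k (dlamB (dF x) (is_derive_cst (F t) x 1))) _.
  by rewrite subr0.
have key (k : R) : `|k| = 1 -> k * (F n%:R - F t) <= H n%:R.
  move=> k1; apply: (@derive_le _ (fun x => k * (F x - F t)) H (fun x => k * f x)
    (fun x => e * expR (- (s * x))) t n%:R) => //.
  - by apply: continuous_subspaceT => x; exact: is_derive_cont (d1 k x).
  - exact: continuous_subspaceT.
  - move=> x /andP[tx _]; apply: le_trans (ler_norm _) _; rewrite normrM k1 mul1r hf//.
    by rewrite (le_trans t0)// ltW.
  - by rewrite /H !subrr !mulr0.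
have Hn : H n%:R <= e / s * expR (- (s * t)).
  by rewrite /H ler_wpM2l ?divr_ge0 ?(ltW s0)// gerBl expR_ge0.
have := key 1 (normr1 _); have := key (-1) (etrans (normrN _) (normr1 _)).
rewrite mul1r mulN1r => k1 k2; rewrite -[F t](subrK (F n%:R)) (le_trans (ler_normD _ _))// addrC.
by rewrite lerD// (le_trans _ Hn)// ler_norml; apply/andP; split; lra.
Qed.

Lemma lipschitz_of_derive f f' (L : R) : (forall x : R, is_derive x 1 f (f' x)) ->
  (forall x, `|f' x| <= L) -> forall x y, `|f x - f y| <= L * `|x - y|.
Proof.
move=> df fL.
have H x y : y < x -> `|f x - f y| <= L * `|x - y|.
  move=> yx; have [|c _ ->] := MVT yx (fun z _ => df z).
    by apply: continuous_subspaceT => z; exact: is_derive_cont (df z).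
  by rewrite normrM ler_wpM2r.
move=> x y; case: (ltgtP x y) => [xy|yx|->]; last by rewrite !subrr normr0 mulr0.
  by rewrite distrC (distrC x) H.
exact: H.
Qed.

Lemma dlamsum n (f df : nat -> R -> R) t :
  (forall j, is_derive t 1 (f j) (df j t)) ->
  is_derive t 1 (fun x => \sum_(j < n) f j x) (\sum_(j < n) df j t).
Proof.
move=> d; elim: n => [|n IH].
  rewrite big_ord0 (_ : (fun x => _) = cst 0); first exact: is_derive_cst.
  by apply/funext => x; rewrite big_ord0.
rewrite big_ord_recr/= (_ : (fun x => _) = fun x => \sum_(j < n) f j x + f n x).
  exact: dlamD.
by apply/funext => x; rewrite big_ord_recr.
Qed.

Section Approximation.
Variables (phi : R -> R) (s0 : R).
Hypotheses (tphi : test_function `]0, +oo[%classic phi) (s1 : 1 <= s0).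

Let sp0 : 0 < s0. Proof. exact: lt_le_trans s1. Qed.

(** In the variable [x = exp (- t)], the exponentials with these rates are [x ^ s0] times the
    monomials, and the points [- node j] all lie to the right of [s0]. *)
Definition node (j : nat) : R := - (s0 + j%:R).

(** After removing the factor [exp (- s0 t)] and substituting [x = exp (- t)], the derivative of the
    test function becomes [psi], which vanishes near [x = 0] and has a bounded derivative; a
    Bernstein polynomial approximates it on [[0, 1]]. *)
Lemma exp_poly_approx_top N (e : R) : 0 < e -> exists P : {poly R}, forall t, 0 <= t ->
  `|derive1n N phi t - \sum_(j < size P) P`_j * expR (node j * t)| <= e * expR (- (s0 * t)).
Proof.
move=> e0; have [a [b [a0 ab sphi]]] := test_function_supp tphi.
pose chi t := derive1n N phi t * expR (s0 * t).
pose chi' t := derive1n N.+1 phi t * expR (s0 * t) + derive1n N phi t * (s0 * expR (s0 * t)).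
have dchi t : is_derive t 1 chi (chi' t).
  exact: (dlamM (test_is_derive N t tphi) (dlamexp s0 t)).
have schi : supp a b chi by move=> t h; rewrite /chi (derive1n_supp N sphi h) mul0r.
have schi' : supp a b chi'.
  by move=> t h; rewrite /chi' (derive1n_supp N sphi h) (derive1n_supp N.+1 sphi h) !mul0r addr0.
have cchi' : continuous chi'.
  have cexp : continuous (fun t => expR (s0 * t)) by move=> t; exact: is_derive_cont (dlamexp s0 t).
  have c2 : continuous (fun t => s0 * expR (s0 * t)).
    by apply: continuous_mul => // t; exact: cvg_cst.
  have c3 := continuous_mul (test_continuous N.+1 tphi) cexp.
  have c4 := continuous_mul (test_continuous N tphi) c2.
  by move=> t; apply: cvgD; [exact: c3|exact: c4].
have [C hC] := locally_bounded b cchi'.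
have b0 : 0 < b by exact: lt_le_trans ab.
have C0 : 0 <= C by have := hC 0; rewrite normr0 => /(_ (ltW b0)); exact: le_trans.
have hC' t : `|chi' t| <= C.
  have [/andP[at_ tb]|/schi' ->] := boolP (a <= t <= b); last by rewrite normr0.
  by rewrite hC// ger0_norm// (le_trans (ltW a0)).
pose psi x := if 0 < x then chi (- ln x) else 0.
pose psi' x := if 0 < x then chi' (- ln x) * - x^-1 else 0.
have small x : 0 < x -> x < expR (- b) -> b < - ln x.
  by move=> x0 xb; rewrite ltrNr -[ltRHS]expRK ltr_ln// posrE// expR_gt0.
have dpsi (x : R) : is_derive x 1 psi (psi' x).
  have [xb|bx] := ltP x (expR (- b)).
    have hb y : y < expR (- b) -> psi y = 0 /\ psi' y = 0.
      move=> yb; rewrite /psi /psi'; case: ifPn => // y0.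
      have h : ~~ (a <= - ln y <= b) by rewrite negb_and -!ltNge small ?orbT.
      by rewrite schi// schi'// mul0r.
    rewrite (hb x xb).2; apply: is_derive_near0.
    have : \forall y \near x, y < expR (- b) by exact: lt_nbhsl.
    by apply: filterS => y /hb[].
  have x0 : 0 < x by apply: lt_le_trans bx; exact: expR_gt0.
  rewrite /psi' x0; apply: (@near_eq_is_derive _ _ _ (fun x => chi (- ln x))).
    have : \forall y \near x, 0 < y by exact: lt_nbhsr.
    by apply: filterS => y y0; rewrite /psi y0.
  exact: (dlamcomp (g := fun x => - ln x) (dchi _) (dlamN (is_derive1_ln x0))).
have bpsi x : `|psi' x| <= C * expR b.
  rewrite /psi'; case: ifPn => [x0|_]; last by rewrite normr0 mulr_ge0 ?expR_ge0.
  have [xb|bx] := ltP x (expR (- b)).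
    by rewrite schi' ?mul0r ?normr0 ?mulr_ge0 ?expR_ge0// negb_and -!ltNge small ?orbT.
  rewrite normrM ler_pM// normrN normfV gtr0_norm// -[leRHS]invrK lef_pV2 ?posrE ?invr_gt0 ?expR_gt0//.
  by rewrite -expRN.
have [P hP] := lipschitz_poly_approx (lipschitz_of_derive dpsi bpsi) e0.
exists P => t t0.
have t1 : expR (- t) <= 1 by rewrite -expR0 ler_expR oppr_le0.
have := hP (expR (- t)); rewrite expR_ge0 t1 => /(_ isT).
rewrite /psi expR_gt0 expRK opprK horner_coef => h.
have E : derive1n N phi t - \sum_(j < size P) P`_j * expR (node j * t) =
  (chi t - \sum_(i < size P) P`_i * expR (- t) ^+ i) * expR (- (s0 * t)).
  rewrite mulrBl /chi -mulrA -expRD subrr expR0 mulr1; congr (_ - _).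
  rewrite mulr_suml; apply: eq_bigr => i _; rewrite -mulrA; congr (_ * _).
  by rewrite -expRM_natl -expRD /node; congr expR; ring.
by rewrite E normrM (ger0_norm (expR_ge0 _)) ler_wpM2r ?expR_ge0.
Qed.

Let node0 j : node j != 0.
Proof. by rewrite /node oppr_eq0 gt_eqF// ltr_wpDr. Qed.

(** One polynomial serves all orders: the highest derivative is approximated, then integrated back
    from infinity, which divides each exponential by its rate. As [s0 >= 1], the error does not
    increase. *)
Lemma exp_poly_approx N (e : R) : 0 < e -> exists P : {poly R},
  forall i, (i <= N)%N -> forall t, 0 <= t ->
  `|derive1n i phi t - \sum_(j < size P) P`_j * (node j ^- (N - i)) * expR (node j * t)|
  <= e * expR (- (s0 * t)).
Proof.
move=> e0; have [P hP] := exp_poly_approx_top N e0; exists P.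
have [a [b [a0 ab sphi]]] := test_function_supp tphi.
suff H m : (m <= N)%N -> forall t, 0 <= t ->
   `|derive1n (N - m) phi t - \sum_(j < size P) P`_j * (node j ^- m) * expR (node j * t)|
  <= e * expR (- (s0 * t)).
  by move=> i iN t t0; have := H (N - i)%N (leq_subr _ _) t t0; rewrite subKn.
elim: m => [_|m IH mN] t t0.
  rewrite subn0; have := hP t t0.
  by under [in X in _ -> X]eq_bigr do rewrite expr0 invr1 mulr1.
pose D k t := \sum_(j < size P) P`_j * (node j ^- k) * expR (node j * t).
have dD (x : R) : is_derive x 1 (D m.+1) (D m x).
  apply: (@dlamsum (size P) (fun j t => P`_j * node j ^- m.+1 * expR (node j * t))
    (fun j t => P`_j * node j ^- m * expR (node j * t))) => j.
  apply: is_derive_eq (dlamZ (P`_j * node j ^- m.+1) (dlamexp (node j) x)) _.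
  move: (node j) (node0 j) => q q0; rewrite exprS; field.
  by rewrite q0 expf_neq0.
have dphi (x : R) : is_derive x 1 (derive1n (N - m.+1) phi) (derive1n (N - m) phi x).
  by have := test_is_derive (N - m.+1) x tphi; rewrite subnSK.
pose C := \sum_(j < size P) `|P`_j * node j ^- m.+1|.
apply: le_trans (@decay_primitive (fun t => derive1n (N - m.+1) phi t - D m.+1 t)
  (fun t => derive1n (N - m) phi t - D m t) e C s0 (b + 1) sp0 (fun x => dlamB (dphi x) (dD x)) _ _ t t0) _.
- by move=> x; apply: IH; exact: ltnW.
- move=> x bx; have x0 : 0 <= x by rewrite (le_trans _ bx)// addr_ge0// (le_trans (ltW a0)).
  rewrite (derive1n_supp _ sphi) ?sub0r ?normrN; last first.
    by rewrite negb_and -!ltNge (lt_le_trans _ bx) ?orbT// ltrDl.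
  rewrite /D /C mulr_suml (le_trans (ler_norm_sum _ _ _))//; apply: ler_sum => j _.
  rewrite normrM ler_wpM2l// ger0_norm ?expR_ge0// ler_expR /node mulNr lerN2.
  by rewrite ler_wpM2r// lerDl.
- by rewrite ler_wpM2r ?expR_ge0// ler_piMr ?(ltW e0)// invf_le1.
Qed.

Lemma integ_mul_bounded f g C : integ (damp s0 f) -> continuous g ->
  (forall t, 0 <= t -> `|g t| <= C * expR (- (s0 * t))) ->
  integ (fun t => f t * g t) /\
  `|\int[mu]_(t in half) (f t * g t)| <= C * \int[mu]_(t in half) `|damp s0 f t|.
Proof.
move=> hf cg hg; have inf := integ_norm hf.
have mf : measurable_fun half f.
  rewrite (_ : f = fun t => damp s0 f t * expR (s0 * t)).
    apply: measurable_funM; first exact: integ_measurable.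
    by apply: measurable_cont => t; exact: is_derive_cont (dlamexp s0 t).
  by apply/funext => t; rewrite /damp -mulrA -expRD addNr expR0 mulr1.
have bnd t : 0 <= t -> `|f t * g t| <= C * `|damp s0 f t|.
  move=> t0; rewrite normrM /damp normrM (ger0_norm (expR_ge0 _)) mulrCA.
  by rewrite ler_wpM2l// hg.
have ifg : integ (fun t => f t * g t).
  apply: integ_le bnd; last exact: integZ.
  by apply: measurable_funM => //; exact: measurable_cont.
split=> //; rewrite (le_trans (le_normr_Rintegral measurable_half ifg))//.
rewrite -(RintegralZl C measurable_half inf).
apply: le_Rintegral; [exact: measurable_half|exact: integ_norm|exact: integZ|].
by move=> t /halfP/bnd.
Qed.

Lemma exp_sum_integral f n (c : nat -> R) (k : nat -> R) :
  (forall j, integ (damp (- k j) f)) ->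
  integ (fun t => f t * \sum_(j < n) c j * expR (k j * t)) /\
  \int[mu]_(t in half) (f t * \sum_(j < n) c j * expR (k j * t)) =
  \sum_(j < n) c j * lap (- k j) f.
Proof.
move=> hf; elim: n => [|n [i1 IH]].
  have E t : f t * \sum_(j < 0) c j * expR (k j * t) = 0 by rewrite big_ord0 mulr0.
  rewrite big_ord0; split.
    have := integZ 0 (hf 0%N); apply: integ_ext => t _; by rewrite E mul0r.
  transitivity (\int[mu]_(t in half) (0 * damp (- k 0%N) f t)); last first.
    by rewrite (RintegralZl 0 measurable_half (hf 0%N)) mul0r.
  by apply: eq_Rintegral => t _; rewrite E mul0r.
have E t : f t * \sum_(j < n.+1) c j * expR (k j * t) =
  f t * \sum_(j < n) c j * expR (k j * t) + c n * damp (- k n) f t.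
  by rewrite big_ord_recr/= mulrDr /damp mulNr opprK; congr (_ + _); ring.
have i2 := integZ (c n) (hf n).
split; first by have := integD i1 i2; apply: integ_ext => t _; rewrite E.
rewrite big_ord_recr/= -IH /lap -(RintegralZl (c n) measurable_half (hf n)).
rewrite -(RintegralD measurable_half i1 i2).
by apply: eq_Rintegral => t _; rewrite E.
Qed.

End Approximation.

Lemma le_eps_cst0 (x K : R) : (forall e, 0 < e -> `|x| <= e * K) -> x = 0.
Proof.
move=> h; apply/eqP; rewrite -normr_le0; apply/ler_addgt0Pl => d d0; rewrite addr0.
have K0 : 0 <= K by have := h 1 ltr01; rewrite mul1r; exact: le_trans.
apply: le_trans (h (d / (K + 1)) _) _; first by rewrite divr_gt0// ltr_wpDl.
by rewrite -mulrA ler_piMr ?(ltW d0)// mulrC ler_pdivrMr ?ltr_wpDl// mul1r lerDl.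
Qed.

(* The functional vanishes on the exponentials [expR (node s0 j * t)], which
   approximate a test function together with its derivatives. *)
Lemma laplace_uniq n f F g (beta S : R) phi :
  (forall s, S <= s -> [/\ integ (damp s f), integ (damp s F), integ (damp s g) &
     s ^+ n * lap s f = lap s F + beta * s * lap s g]) ->
  test_function `]0, +oo[%classic phi ->
  (-1) ^+ n * \int[mu]_(t in half) (f t * derive1n n phi t) =
  pairing F phi - beta * pairing g (derive1 phi).
Proof.
move=> hS tphi; pose s0 := Num.max 1 S.
have s1 : 1 <= s0 by rewrite le_max lexx.
have S0 s : s0 <= s -> S <= s by apply: le_trans; rewrite le_max lexx orbT.
have nS j : S <= - node s0 j by apply: S0; rewrite /node opprK lerDl.
have [a [b [a0 ab sphi]]] := test_function_supp tphi.
have pairE h k : \int[mu]_(t in half) (h t * derive1n k phi t) = pairing h (derive1n k phi).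
  have sh : supp a b (fun t => h t * derive1n k phi t).
    by move=> t /(derive1n_supp k sphi) ->; rewrite mulr0.
  by have [e1 e2] := integral_supp a0 ab sh; rewrite /half e2 /pairing e1.
rewrite -[pairing F phi]/(pairing F (derive1n 0 phi)).
rewrite -[derive1 phi]/(derive1n 1 phi) -!pairE.
pose I h k := \int[mu]_(t in half) (h t * derive1n k phi t).
pose K h := \int[mu]_(t in half) `|damp s0 h t|.
apply/eqP; rewrite -subr_eq0; apply/eqP.
apply: (@le_eps_cst0 _ (K f + K F + `|beta| * K g)) => e e0.
(* Order [n.+1] covers the three orders in use, 0, 1 and [n], also when [n = 0]. *)
have [P hP] := exp_poly_approx tphi s1 n.+1 e0.
pose J h k := \sum_(j < size P) P`_j * node s0 j ^- (n.+1 - k) * lap (- node s0 j) h.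
have key h k : (k <= n.+1)%N -> (forall s, S <= s -> integ (damp s h)) ->
    `|I h k - J h k| <= e * K h.
  move=> kn ih; pose D t := \sum_(j < size P) (P`_j * node s0 j ^- (n.+1 - k)) * expR (node s0 j * t).
  have [iD vD] := @exp_sum_integral h (size P) (fun j => P`_j * node s0 j ^- (n.+1 - k)) (node s0) (fun j => ih _ (nS j)).
  have cD : continuous D.
    move=> t; apply: is_derive_cont; apply: (@dlamsum (size P)
     (fun j t => P`_j * node s0 j ^- (n.+1 - k) * expR (node s0 j * t))
     (fun j t => P`_j * node s0 j ^- (n.+1 - k) * (node s0 j * expR (node s0 j * t)))) => j.
    exact: (dlamZ _ (dlamexp _ _)).
  have cp : continuous (fun t => derive1n k phi t - D t).
    by move=> t; apply: cvgB; [exact: (test_continuous k tphi)|exact: cD].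
  have ihs : integ (damp s0 h) by apply: ih; exact: S0.
  have [i1 v1] := integ_mul_bounded ihs cp (hP k kn).
  apply: le_trans v1; rewrite le_eqVlt; apply/orP; left; apply/eqP; congr `|_|.
  rewrite /J -vD /I -[X in X - _](_ : \int[mu]_(t in half) ((h t * (derive1n k phi t - D t)) + h t * D t) = _).
    rewrite (RintegralD measurable_half i1 iD) addrK //.
  by apply: eq_Rintegral => t _; rewrite mulrBr subrK.
(* Each exponential contributes its coefficient times [nu ^- n.+1] times the assumed identity at
   [s = - nu]. *)
have J0 : (-1) ^+ n * J f n - (J F 0 - beta * J g 1) = 0.
  rewrite /J !mulr_sumr -!sumrB big1// => j _.
  have [_ _ _] := hS _ (nS j).
  have : node s0 j != 0 by rewrite /node oppr_eq0 gt_eqF// ltr_wpDr// (lt_le_trans ltr01).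
  move: (node s0 j) => nu nu0; rewrite (exprNn nu) => h.
  rewrite subSnn subn0 subn1/= expr1.
  have s1n : (-1 : R) ^+ n * (-1) ^+ n = 1 by rewrite -exprMn mulrNN mulr1 expr1n.
  have -> : (-1) ^+ n * (P`_j * nu^-1 * lap (- nu) f) =
    P`_j * nu ^- n.+1 * ((-1) ^+ n * nu ^+ n * lap (- nu) f).
    by rewrite exprS; field; rewrite nu0 expf_neq0.
  by rewrite h exprS; field; rewrite nu0 expf_neq0.
have hf s (Ss : S <= s) : integ (damp s f) by have [] := hS s Ss.
have hF s (Ss : S <= s) : integ (damp s F) by have [] := hS s Ss.
have hg s (Ss : S <= s) : integ (damp s g) by have [] := hS s Ss.
rewrite -[X in `|X|]subr0 -J0.
rewrite (_ : _ - _ = (-1) ^+ n * (I f n - J f n) - (I F 0%N - J F 0%N) + beta * (I g 1%N - J g 1%N)); last first.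
  by rewrite /I; ring.
rewrite [leRHS]mulrDr (mulrDr e) (le_trans (ler_normD _ _))// lerD//.
  rewrite (le_trans (ler_normB _ _))// lerD ?key//.
  by rewrite normrM normrX normrN normr1 expr1n mul1r key.
by rewrite normrM mulrCA ler_wpM2l// key.
Qed.

End LaplaceUniqueness.

(** * The symbol on the real axis *)

Section SymbolOnTheRealAxis.
Context {R : realType}.
Variables (c alpha eps : R).
Hypotheses (alpha_gt0 : 0 < alpha) (eps_gt0 : 0 < eps).

Definition rate : R := (Num.sqrt alpha)^-1.
Definition latp : R := c * rate / 4.
Definition latr : R := eps * rate ^+ 3 / 4.

Lemma rate_gt0 : 0 < rate.
Proof. by rewrite invr_gt0 sqrtr_gt0. Qed.

Lemma alpha_rate : alpha = rate ^- 2.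
Proof. by rewrite /rate exprVn invrK sqr_sqrtr// ltW. Qed.

(** For large [s] the term [s th (1 - th)] fixes the signs at [th = - 1/4] and [th = 1/4], and a
    root lies in between. *)
Lemma theta_exists s : 2 * growth latp latr <= s -> exists th : R,
  `|th| <= 4^-1 /\ s * th * (1 - th) =
  - (latp * (1 - th ^+ 2) * (1 - th) + latr * (1 + th) ^+ 3).
Proof.
set p := latp; set r := latr => hs.
pose P : {poly R} := s *: ('X * (1 - 'X)) + p *: ((1 - 'X ^+ 2) * (1 - 'X)) + r *: (1 + 'X) ^+ 3.
have PE x : P.[x] = s * (x * (1 - x)) + p * ((1 - x ^+ 2) * (1 - x)) + r * (1 + x) ^+ 3.
  by rewrite /P !hornerE.
have cP : {within `[- 4^-1, 4^-1 : R], continuous (horner P)}.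
  by apply: continuous_subspaceT => x; exact: is_derive_cont (is_derive_poly P x).
have := ler_norm p; have := ler_norm (- p); have := ler_norm r; have := ler_norm (- r).
rewrite !normrN => r1 r2 p1 p2; move: hs; rewrite /growth => hs.
have P1 : P.[- 4^-1] <= 0 by rewrite PE; lra.
have P2 : 0 <= P.[4^-1] by rewrite PE; lra.
have [| |th] := @IVT R (horner P) (- 4^-1) 4^-1 0 _ cP.
- by lra.
- by rewrite ge_min le_max P1 P2 orbT.
rewrite in_itv/= => h; rewrite PE => e; exists th; split; first by rewrite ler_norml.
by lra.
Qed.

Lemma real_root_of_theta s (th : R) : `|th| <= 4^-1 ->
  s * th * (1 - th) = - (latp * (1 - th ^+ 2) * (1 - th) + latr * (1 + th) ^+ 3) ->
  let l := - rate * (1 + th) / (1 - th) in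
  l < 0 /\ s + c * l - alpha * s * l ^+ 2 + eps * l ^+ 3 = 0.
Proof.
rewrite ler_norml => /andP[h1 h2] hth l.
have d0 : 0 < 1 - th by lra.
have dn : 1 - th != 0 by rewrite gt_eqF.
have rn : rate != 0 by rewrite gt_eqF// rate_gt0.
split.
  rewrite /l mulNr mulNr oppr_lt0 divr_gt0// mulr_gt0 ?rate_gt0//; lra.
have -> : s + c * l - alpha * s * l ^+ 2 + eps * l ^+ 3 =
  - 4 / (1 - th) ^+ 3 * (s * th * (1 - th) + (latp * (1 - th ^+ 2) * (1 - th) + latr * (1 + th) ^+ 3)).
  rewrite /l /latp /latr alpha_rate; field; by rewrite rn dn.
by rewrite hth addNr mulr0.
Qed.

(** Dividing the cubic by [l - l0] leaves a real quadratic whose coefficients have signs [+], [-],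
    [+], which has no root with negative real part. *)
Lemma root_unique (l0 s : R) (l : R[i]) : 0 < s -> l0 < 0 ->
  s + c * l0 - alpha * s * l0 ^+ 2 + eps * l0 ^+ 3 = 0 ->
  char_cubic c alpha eps s%:C l = 0 -> complex.Re l < 0 -> l = l0%:C.
Proof.
move=> s0 l00 h0 hl rl; apply/eqP; rewrite -subr_eq0.
pose b := eps * l0 - alpha * s; pose g := c + b * l0.
have h0C : char_cubic c alpha eps s%:C l0%:C = 0.
  by rewrite /char_cubic -!rmorphXn -!rmorphM/= -!rmorphD -rmorphB -rmorphD h0.
have : (l - l0%:C) * (eps%:C * l ^+ 2 + b%:C * l + g%:C) = 0.
  have -> : g%:C = c%:C + b%:C * l0%:C by rewrite /g rmorphD rmorphM.
  have -> : b%:C = eps%:C * l0%:C - alpha%:C * s%:C by rewrite /b rmorphB !rmorphM.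
  rewrite -[RHS]subr0 -{1}hl -h0C /char_cubic; ring.
move/eqP; rewrite mulf_eq0 => /orP[//|/eqP hq]; exfalso.
have b0 : b < 0.
  by rewrite /b subr_lt0 (@lt_trans _ _ 0) ?pmulr_rlt0// mulr_gt0.
have g0 : 0 < g.
  have e : g * l0 = - s by rewrite /g /b; lra.
  by rewrite -(nmulr_rlt0 _ l00) mulrC e oppr_lt0.
case: l rl {hl} hq => x y /= x0.
move=> hq.
have /eqP := hq; rewrite eq_complex /= => /andP[/eqP hre /eqP him].
have hre' : eps * (x * x - y * y) + b * x + g = 0 by move: hre; rewrite !mul0r; lra.
have him' : y * (2 * eps * x + b) = 0 by move: him; rewrite !mul0r; lra.
have epx : eps * x < 0 by rewrite pmulr_rlt0.
have bx : 0 < b * x by rewrite nmulr_rgt0.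
have exx : 0 <= eps * (x * x) by rewrite mulr_ge0 ?(ltW eps_gt0)// -expr2 sqr_ge0.
have ex : 2 * eps * x + b < 0 by lra.
move/eqP: him'; rewrite mulf_eq0 (lt_eqF ex) orbF => /eqP y0.
have : 0 < eps * (x * x - y * y) + b * x + g by rewrite y0; lra.
by rewrite hre' ltxx.
Qed.

Lemma lambda1_real (s th : R) : 0 < s -> `|th| <= 4^-1 ->
  s * th * (1 - th) = - (latp * (1 - th ^+ 2) * (1 - th) + latr * (1 + th) ^+ 3) ->
  lambda1 c alpha eps s%:C = (- rate * (1 + th) / (1 - th))%:C.
Proof.
move=> s0 th1 hth; have [l0 h0] := real_root_of_theta th1 hth.
rewrite /lambda1; case: xgetP => [l _ [/(root_unique s0 l0 h0)]|] //.
move=> /(_ (- rate * (1 + th) / (1 - th))%:C) []; split; last exact: l0.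
by rewrite /char_cubic -!rmorphXn -!rmorphM/= -!rmorphD -rmorphB -rmorphD h0.
Qed.

Lemma laplace_real (f : R -> R) s : laplace f s%:C = (lap s f)%:C.
Proof.
rewrite /laplace /lap /damp /=; apply/eqP; rewrite eq_complex /=; apply/andP; split.
  apply/eqP; apply: eq_Rintegral => t _; by rewrite mul0r cos0 mulr1.
rewrite oppr_eq0; apply/eqP.
rewrite (_ : (fun t => _) = fun=> 0).
  by rewrite Rintegral_cst ?mul0r//; exact: measurable_half.
by apply/funext => t; rewrite mul0r sin0 !mulr0.
Qed.

End SymbolOnTheRealAxis.

(** * From distributional convolutions to operators on continuous traces *)

Section ConvolutionRepresentation.
Context {R : realType}.
Implicit Types (g : R -> R) (t : R).

(** The even extension is continuous through 0, which an extension by 0 need not be. At [t >= 0] the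
    iterated primitives only see the values on [[0, t]], so causality is not affected. *)
Definition even_ext g t : R := g `|t|.

Lemma continuous_even_ext g : {within `[0, +oo[, continuous g} ->
  continuous (even_ext g).
Proof.
move=> /subspace_continuousP cg t.
have nt : `[0, +oo[%classic `|t| by rewrite /= in_itv/= normr_ge0.
apply: cvg_comp (cg _ nt) => U hU.
have hn := @norm_continuous R R t.
have hy : \forall y \near `|t|, `[0, +oo[%classic y -> U y by exact: hU.
have hx : \forall x \near t, `[0, +oo[%classic `|x| -> U `|x| by exact: (hn _ hy).
apply: filterS hx => x; apply.
by rewrite /= in_itv/= normr_ge0.
Qed.

Lemma is_derive_even_ext g (d t : R) : 0 < t -> is_derive t 1 g d ->
  is_derive t 1 (even_ext g) d.
Proof.
move=> t0; apply: near_eq_is_derive.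
have : \forall x \near t, 0 < x by exact: lt_nbhsr.
by apply: filterS => x x0; rewrite /even_ext gtr0_norm.
Qed.

Lemma lap_even_ext g s : integ (damp s g) ->
  integ (damp s (even_ext g)) /\ lap s (even_ext g) = lap s g.
Proof.
move=> ig; split.
  by apply: integ_ext ig => t t0; rewrite /damp /even_ext ger0_norm.
by apply: eq_Rintegral => t; rewrite inE => /halfP t0; rewrite /damp /even_ext ger0_norm.
Qed.

(* A symbol with the expansion [sum_k A k / s ^ k + beta s] at infinity acts as
   the operator [op A] plus [beta] times the time derivative. *)
Lemma conv_repr (m : R[i] -> R[i]) g g' T A M B (S beta : R) :
  0 < B -> geo M B A -> 0 < S ->
  (forall s, S <= s -> exists2 l : R, m s%:C = l%:C &
     series (fun k => A k * s ^- k) N @[N --> \oo] --> l - beta * s) ->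
  {within `[0, +oo[, continuous g} ->
  (forall t, 0 < t -> is_derive t 1 g (g' t)) -> cont0 g' ->
  is_invL_conv m g T ->
  forall phi, test_function `]0, +oo[%classic phi ->
  T phi = pairing (fun t => op A (even_ext g) t + beta * g' t) phi.
Proof.
move=> B0 hA S0 hm cg dg cg' [tg [n [f [[tf hT] hL]]]] phi tphi.
have ceg := continuous_even_ext cg.
have i_g s : 0 < s -> integ (damp s g) by move=> s0; exact: tg.
have i_f s : 0 < s -> integ (damp s f) by move=> s0; exact: tf.
have B2 : 0 < 2 * B by rewrite mulr_gt0.
have hT' : test_function setT phi.
  by case: tphi => h1 [K [h2 h3] h4]; split => //; exists K.
have deg t : 0 < t -> is_derive t 1 (even_ext g) (g' t).
  by move=> t0; exact: is_derive_even_ext (dg t t0).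
have cop : continuous (op A (even_ext g)) by exact: continuous_op B0 hA ceg.
have key s : Num.max S (2 * B + 1) <= s -> [/\ integ (damp s f), integ (damp s (op A (even_ext g))),
   integ (damp s (even_ext g)) &
   s ^+ n * lap s f = lap s (op A (even_ext g)) + beta * s * lap s (even_ext g)].
  rewrite ge_max => /andP[Ss Bs]; have [l e1 e2] := hm s Ss.
  have s0 : 0 < s by exact: lt_le_trans Ss.
  have [ie le_] := lap_even_ext (i_g s s0).
  have Bs' : 2 * B < s by rewrite (lt_le_trans _ Bs)// ltrDl.
  have [ie2 _] := lap_even_ext (i_g _ B2).
  have ev t : even_ext g (- t) = even_ext g t by rewrite /even_ext normrN.
  have [io lo] := lap_op B0 hA ceg ev ie2 ie Bs' e2.
  split => //; first exact: i_f.
  have := hL s%:C s0; rewrite !laplace_real e1 -rmorphXn -!rmorphM/= => /complexI ->.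
  by rewrite lo le_; ring.
rewrite (hT phi hT') (laplace_uniq key tphi).
rewrite (pairing_derive tphi deg cg') mulrN opprK.
rewrite (_ : (fun t => _) = (fun t => 1 * op A (even_ext g) t + beta * g' t)).
  by rewrite pairing_lin ?mul1r// => t _; exact: cop.
by apply/funext => t; rewrite mul1r.
Qed.

End ConvolutionRepresentation.

(** * The operators in the boundary conditions *)

Section BoundaryOperators.
Context {R : realType}.
Variables (c alpha eps : R).
Hypotheses (alpha_gt0 : 0 < alpha) (eps_gt0 : 0 < eps).
Implicit Types (g : R -> R) (t s : R).

Let a := rate alpha.
Let p := latp c alpha.
Let r := latr alpha eps.
Let B := growth p r.
Let lam := lambda1 c alpha eps.
Let B0 : 0 < B. Proof. exact: growth_gt0. Qed.
Let a0 : a != 0. Proof. by rewrite gt_eqF// rate_gt0. Qed.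

(* The operators with symbols [lam1] and [alpha s (lam1 + a) - eps lam1 ^ 2]; in terms of
   [th = (lam1 + a) / (lam1 - a)] both have only a simple pole at [th = 1]. *)
Definition lamop g t : R := - a * (mode p r 0 g t + mode p r 1 g t).

Definition qop g t : R := 2 / a *
  (p * (mode p r 0 g t - mode p r 2 g t) -
   r * (mode p r 0 g t + 2 * mode p r 1 g t + mode p r 2 g t)).

Definition lamA k : R := - a * coef p r k 0 + - a * coef p r k 1.

Definition qA k : R :=
  1 * (2 / a * (p - r) * coef p r k 0 + 2 / a * (- 2 * r) * coef p r k 1) +
  2 / a * (- p - r) * coef p r k 2.

Lemma geo_lamA : exists M, geo M B lamA.
Proof. by eexists; exact: (geo_lin (- a) (- a) B0 (geo_coef p r 0) (geo_coef p r 1)). Qed.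

Lemma geo_qA : exists M, geo M B qA.
Proof.
have h := geo_lin (2 / a * (p - r)) (2 / a * (- 2 * r)) B0 (geo_coef p r 0) (geo_coef p r 1).
by eexists; exact: (geo_lin 1 (2 / a * (- p - r)) B0 h (geo_coef p r 2)).
Qed.

Lemma op_lamA g : continuous g -> op lamA g = lamop g.
Proof.
move=> cg; apply/funext => t.
by rewrite (op_lin _ _ B0 (geo_coef p r 0) (geo_coef p r 1) cg) /lamop /mode mulrDr.
Qed.

Lemma op_qA g : continuous g -> op qA g = qop g.
Proof.
move=> cg; apply/funext => t.
have h := geo_lin (2 / a * (p - r)) (2 / a * (- 2 * r)) B0 (geo_coef p r 0) (geo_coef p r 1).
rewrite (op_lin _ _ B0 h (geo_coef p r 2) cg).
rewrite (op_lin _ _ B0 (geo_coef p r 0) (geo_coef p r 1) cg) /qop /mode; ring.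
Qed.

Lemma series_lin (A A' : nat -> R) (k l x y s : R) :
  series (fun k => A k * s ^- k) N @[N --> \oo] --> x ->
  series (fun k => A' k * s ^- k) N @[N --> \oo] --> y ->
  series (fun j => (k * A j + l * A' j) * s ^- j) N @[N --> \oo] --> k * x + l * y.
Proof.
move=> hx hy.
rewrite (_ : series _ = fun N => k * series (fun k => A k * s ^- k) N + l * series (fun k => A' k * s ^- k) N).
  by apply: cvgD; apply: cvgM (cvg_cst _) _.
by apply/funext => N; rewrite /series/= !mulr_sumr -big_split/=; apply: eq_bigr => i _; ring.
Qed.

(** For the second series, the equation of [th] replaces [s] by a polynomial in [th], and the double
    poles at [th = 1] of the two terms cancel. What remains is [(2 / a) (p (1 - th ^ 2) - r (1 + th)
    ^ 2) / (1 - th)]. *)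
Lemma symbol_expansion s : 2 * B <= s -> exists l : R,
  [/\ lam s%:C = l%:C,
    series (fun k => lamA k * s ^- k) N @[N --> \oo] --> l &
    series (fun k => qA k * s ^- k) N @[N --> \oo] --> alpha * s * (l + a) - eps * l ^+ 2].
Proof.
move=> hs; have s0 : 0 < s by apply: lt_le_trans hs; rewrite mulr_gt0.
have [th [th1 hth]] := theta_exists hs.
have lE := lambda1_real alpha_gt0 eps_gt0 s0 th1 hth.
have G := coef_generating th1 hs hth.
have d0 : 1 - th != 0.
  by move: th1; rewrite ler_norml => /andP[_ h]; rewrite gt_eqF//; lra.
exists (- a * (1 + th) / (1 - th)); split; first exact: lE.
  have := series_lin (k := - a) (l := - a) (G 0) (G 1).
  have -> // : - a * (th ^+ 0 / (1 - th)) + - a * (th ^+ 1 / (1 - th)) = - a * (1 + th) / (1 - th).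
  by rewrite expr0 expr1; ring.
have := series_lin (k := 1) (l := 2 / a * (- p - r)) (series_lin (k := 2 / a * (p - r)) (l := 2 / a * (- 2 * r)) (G 0) (G 1)) (G 2).
set x := (X in _ --> X -> _).
suff -> : x = alpha * s * (- a * (1 + th) / (1 - th) + a) - eps * (- a * (1 + th) / (1 - th)) ^+ 2 by [].
rewrite {}/x.
have -> : alpha * s * (- a * (1 + th) / (1 - th) + a) - eps * (- a * (1 + th) / (1 - th)) ^+ 2 =
  - 2 * alpha * a / (1 - th) ^+ 2 * (s * th * (1 - th)) - eps * a ^+ 2 * (1 + th) ^+ 2 / (1 - th) ^+ 2.
  by field.
rewrite hth -/p -/r; have -> : alpha = a ^- 2 by exact: alpha_rate.
have -> : eps = 4 * r / a ^+ 3 by rewrite /r /latr -/a; field.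
by field; rewrite a0 d0.
Qed.

Lemma continuous_lamop g : continuous g -> continuous (lamop g).
Proof. by move=> cg; have [M hM] := geo_lamA; rewrite -op_lamA//; exact: continuous_op B0 hM cg. Qed.

Lemma continuous_qop g : continuous g -> continuous (qop g).
Proof. by move=> cg; have [M hM] := geo_qA; rewrite -op_qA//; exact: continuous_op B0 hM cg. Qed.

Lemma lamA0 : lamA 0 = - a.
Proof. by rewrite /lamA /= mulr1 mulr0 addr0. Qed.

Let S0 : 0 < 2 * B. Proof. by rewrite mulr_gt0. Qed.

Section Boundary.
Variables (g g' : R -> R).
Hypotheses (cg : {within `[0, +oo[, continuous g})
  (dg : forall t, 0 < t -> is_derive t 1 g (g' t)) (cg' : cont0 g').

Let ge := even_ext g.
Let cge : continuous ge. Proof. exact: continuous_even_ext. Qed.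

(** The operator with symbol [s (lam1 + a)]: the time derivative of [lamop] without its term in
    [g']. *)
Definition lamop' : R -> R := op (fun k => lamA k.+1) ge.

Lemma continuous_lamop' : continuous lamop'.
Proof. by have [M hM] := geo_lamA; exact: continuous_op B0 (geoS hM) cge. Qed.

Lemma is_derive_lamop t : 0 < t -> is_derive t 1 (lamop ge) (- a * g' t + lamop' t).
Proof.
move=> t0; have [M hM] := geo_lamA; rewrite -op_lamA//.
rewrite (_ : op lamA ge = fun t => - a * ge t + prim lamop' t); last first.
  by apply/funext => x; rewrite (op_shift B0 hM cge) lamA0.
apply: dlamD; first exact: (dlamZ (- a) (is_derive_even_ext t0 (dg t0))).
by apply: is_derive_prim; exact: continuous_lamop'.
Qed.

Lemma conv_lambda T : is_invL_conv lam g T -> forall phi,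
  test_function `]0, +oo[%classic phi -> T phi = pairing (lamop ge) phi.
Proof.
move=> hT phi tphi; have [M hM] := geo_lamA.
rewrite (conv_repr (beta := 0) B0 hM S0 _ cg dg cg' hT tphi).
  by congr (pairing _ _); apply/funext => t; rewrite op_lamA// mul0r addr0.
by move=> s /symbol_expansion[l [e1 e2 _]]; exists l => //; rewrite mul0r subr0.
Qed.

(** [eps lam1 ^ 2] is split as [alpha s (lam1 + a)] minus the symbol of [qop], because the first
    part cancels in the flux at [x_r] against [alpha u_tx]. *)
Lemma conv_lambda2 T : is_invL_conv (fun s : R[i] => lam s ^+ 2) g T -> forall phi,
  test_function `]0, +oo[%classic phi ->
  T phi = pairing (fun t => alpha / eps * lamop' t + (- eps^-1) * qop ge t) phi.
Proof.
move=> hT phi tphi; have [M1 h1] := geo_lamA; have [M2 h2] := geo_qA.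
have en : eps != 0 by rewrite gt_eqF.
have hM := geo_lin (alpha / eps) (- eps^-1) B0 (geoS h1) h2.
rewrite (conv_repr (beta := 0) B0 hM S0 _ cg dg cg' hT tphi).
  congr (pairing _ _); apply/funext => t.
  by rewrite (op_lin _ _ B0 (geoS h1) h2 cge) op_qA// mul0r addr0.
move=> s hs; have [l [e1 e2 e3]] := symbol_expansion hs.
have s0 : s != 0 by rewrite gt_eqF// (lt_le_trans _ hs).
exists (l ^+ 2); first by rewrite e1 -rmorphXn.
have := series_lin (k := alpha / eps) (l := - eps^-1) (series_shift s0 e2) e3.
rewrite lamA0; set x := (X in _ --> X -> _); suff -> : x = l ^+ 2 - 0 * s by [].
by rewrite /x; field.
Qed.

Lemma conv_left1 T : is_invL_conv (fun s : R[i] => lam s - alpha%:C * s / eps%:C) g T ->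
  forall phi, test_function `]0, +oo[%classic phi ->
  T phi = pairing (fun t => 1 * lamop ge t + (- alpha / eps) * g' t) phi.
Proof.
move=> hT phi tphi; have [M hM] := geo_lamA.
rewrite (conv_repr (beta := - alpha / eps) B0 hM S0 _ cg dg cg' hT tphi).
  by congr (pairing _ _); apply/funext => t; rewrite op_lamA// mul1r.
move=> s /symbol_expansion[l [e1 e2 _]]; exists (l - alpha * s / eps).
  by rewrite e1 rmorphB rmorphM fmorphV rmorphM.
rewrite (_ : _ - _ = l)//; ring.
Qed.

(** The same splitting leaves [alpha a s / eps] over; since [alpha a = 1 / a], this is the
    coefficient of the time derivative. *)
Lemma conv_left2 T :
  is_invL_conv (fun s : R[i] => lam s ^+ 2 - alpha%:C * s / eps%:C * lam s) g T ->
  forall phi, test_function `]0, +oo[%classic phi ->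
  T phi = pairing (fun t => - eps^-1 * qop ge t + (a * eps)^-1 * g' t) phi.
Proof.
move=> hT phi tphi; have [M hM] := geo_qA.
have en : eps != 0 by rewrite gt_eqF.
have hM' := geo_lin (- eps^-1) 0 B0 hM hM.
rewrite (conv_repr (beta := (a * eps)^-1) B0 hM' S0 _ cg dg cg' hT tphi).
  congr (pairing _ _); apply/funext => t.
  by rewrite (op_lin _ _ B0 hM hM cge) op_qA// mul0r addr0.
move=> s /symbol_expansion[l [e1 _ e3]]; exists (l ^+ 2 - alpha * s / eps * l).
  by rewrite e1 rmorphB -rmorphXn !rmorphM fmorphV.
have := series_lin (k := - eps^-1) (l := 0) e3 e3.
set x := (X in _ --> X -> _).
suff -> : x = l ^+ 2 - alpha * s / eps * l - (a * eps)^-1 * s by [].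
rewrite /x; have -> : alpha = a ^- 2 by exact: alpha_rate.
by field; rewrite en a0.
Qed.

End Boundary.
End BoundaryOperators.

(** * Functions of two variables *)

Section TwoVariables.
Context {R : realType}.
Implicit Types (f F V D : R -> R -> R) (a b d t x : R).
Let mu := @lebesgue_measure R.

Lemma within_comp_continuous (S U W : topologicalType) (A : set U)
    (phi : S -> U) (F : U -> W) : continuous phi -> (forall u, A (phi u)) ->
  {within A, continuous F} -> continuous (fun u => F (phi u)).
Proof.
move=> cphi Aphi /subspace_continuousP cF u.
apply: cvg_comp (cF _ (Aphi u)) => Q hQ.
have hy : \forall y \near phi u, A y -> Q y by exact: hQ.
have hx : \forall v \near u, A (phi v) -> Q (phi v) by exact: (cphi u _ hy).
by apply: filterS hx => v; exact.
Qed.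

Definition cont2 f : Prop := continuous (fun p : R * R => f p.1 p.2).

(** Projection on [[a, b]]: composing with it extends a function on a closed strip continuously to
    the plane. *)
Definition clip a b x : R := Num.min b (Num.max a x).

Lemma clip_id a b x : a <= x <= b -> clip a b x = x.
Proof. by move=> /andP[ax xb]; rewrite /clip max_r// min_r. Qed.

Lemma clip_in a b x : a <= b -> a <= clip a b x <= b.
Proof. by move=> ab; rewrite /clip le_min ab le_max lexx/= ge_min lexx. Qed.

Lemma continuous_clip a b : continuous (clip a b).
Proof.
move=> x; apply: continuous_min; first exact: cvg_cst.
by apply: continuous_max; [exact: cvg_cst|exact: cvg_id].
Qed.

Lemma cont2_clip (A : set (R * R)) (F : R * R -> R) (h : R -> R) a b : continuous h ->
  (forall t x, A (h t, clip a b x)) -> {within A, continuous F} ->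
  cont2 (fun t x => F (h t, clip a b x)).
Proof.
move=> ch hA cF.
apply: (within_comp_continuous (phi := fun p : R * R => (h p.1, clip a b p.2))) cF => //.
move=> p.
have h1 : h q.1 @[q --> p] --> h p.1.
  by apply: (@continuous_comp _ _ _ fst h); [exact: cvg_fst|exact: ch].
have h2 : clip a b q.2 @[q --> p] --> clip a b p.2.
  by apply: (@continuous_comp _ _ _ snd (clip a b)); [exact: cvg_snd|exact: continuous_clip].
exact: (cvg_pair h1 h2).
Qed.

Lemma cont2_sec1 f t : cont2 f -> continuous (f t).
Proof.
move=> cf x; apply: (@continuous_comp _ _ _ (fun x => (t, x)) (fun p : R * R => f p.1 p.2)).
  exact: (cvg_pair (cvg_cst t) (@cvg_id _ (nbhs x))).
exact: cf.
Qed.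

Lemma cont2_sec2 f x : cont2 f -> continuous (f ^~ x).
Proof.
move=> cf t; apply: (@continuous_comp _ _ _ (fun t => (t, x)) (fun p : R * R => f p.1 p.2)).
  exact: (cvg_pair (@cvg_id _ (nbhs t)) (cvg_cst x)).
exact: cf.
Qed.

Lemma bounded_rect f (s t a b : R) : cont2 f ->
  exists C, forall t' x, s <= t' <= t -> a <= x <= b -> `|f t' x| <= C.
Proof.
move=> cf; have := compact_setX (@segment_compact R s t) (@segment_compact R a b).
have cw : {within `[s, t] `*` `[a, b], continuous (fun p : R * R => f p.1 p.2)}.
  exact: continuous_subspaceT.
move=> /(continuous_compact cw)/compact_bounded[M [_ hM]].
exists (`|M| + 1) => t' x ht hx; apply: hM.
  by rewrite (le_lt_trans (ler_norm _))// ltrDl.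
by exists (t', x) => //=; rewrite !in_itv.
Qed.

Lemma integral_oo_cc (g : R -> R) a b : continuous g ->
  \int[mu]_(x in `]a, b[) g x = \int[mu]_(x in `[a, b]) g x.
Proof.
move=> cg; have i1 := continuous_integrable_itv a b cg.
rewrite Rintegral_itv_obnd_cbnd; last first.
  by move: i1; apply: integrableS => //; exact: subset_itv_oo_cc.
rewrite Rintegral_itv_bndo_bndc//.
by move: i1; apply: integrableS => //; exact: subset_itv_co_cc.
Qed.

Lemma integral_prim (g : R -> R) a b : a <= b -> continuous g ->
  \int[mu]_(x in `[a, b]) g x = prim g b - prim g a.
Proof.
move=> ab cg; move: ab; rewrite le_eqVlt => /predU1P[->|ab].
  by rewrite set_itv1 Rintegral_set1 subrr.
rewrite /Rintegral (@continuous_FTC2 R g (prim g)) //.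
- exact: continuous_subspaceT.
- split.
  + by move=> x _; have [] := is_derive_prim cg x.
  + by apply: cvg_at_right_filter; exact: continuous_prim.
  + by apply: cvg_at_left_filter; exact: continuous_prim.
- by move=> x _; exact: is_derive_derive1 (is_derive_prim cg x).
Qed.

Lemma continuous_affine (k c : R) (f : R -> R) : continuous f ->
  continuous (fun x => k * (f x - c)).
Proof.
move=> cf x; apply: cvgM; first exact: cvg_cst.
by apply: cvgB; [exact: cf|exact: cvg_cst].
Qed.

Lemma integral_derive (g F : R -> R) a b : a <= b -> continuous g -> continuous F ->
  (forall x, a < x < b -> is_derive x 1 F (g x)) ->
  \int[mu]_(x in `[a, b]) g x = F b - F a.
Proof.
move=> ab cg cF dF; rewrite integral_prim//.
have H (k : R) : k * (F b - F a) <= k * (prim g b - prim g a).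
  apply: (@derive_le _ (fun x => k * (F x - F a)) (fun x => k * (prim g x - prim g a))
    (fun x => k * g x) (fun x => k * g x) a b) => //.
  - move=> x hx; apply: is_derive_eq (dlamZ k (dlamB (dF x hx) (is_derive_cst (F a) x 1))) _.
    by rewrite subr0.
  - move=> x hx; apply: is_derive_eq (dlamZ k (dlamB (is_derive_prim cg x) (is_derive_cst (prim g a) x 1))) _.
    by rewrite subr0.
  - exact/continuous_subspaceT/continuous_affine.
  - exact/continuous_subspaceT/continuous_affine/continuous_prim.
  - by rewrite !subrr.
by have := H 1; have := H (-1); lra.
Qed.

(** The time derivative is known only for [x] inside []a, b[], so the integral is first moved to the
    open interval; on a compact time window a constant dominates. *)
Lemma is_derive_integral f (fp : R -> R -> R) a b d : cont2 f -> cont2 fp ->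
  (forall t x, d < t -> a < x < b -> is_derive t 1 (f ^~ x) (fp t x)) ->
  forall t, d < t ->
  is_derive t 1 (fun s => \int[mu]_(x in `[a, b]) f s x) (\int[mu]_(x in `[a, b]) fp t x).
Proof.
move=> cf cfp df t dt.
pose u := (d + t) / 2; have du : d < u by rewrite /u; lra.
have ut : u < t by rewrite /u; lra.
have Ia : `]u, (t + 1)[%classic t by rewrite /= in_itv/= ut ltrDl ltr01.
have [C hC] := bounded_rect u (t + 1) a b cfp.
have C0 : forall y : R, 0 <= `|C| by move=> _; exact: normr_ge0.
have mB : measurable (`]a, b[%classic : set (measurableTypeR R)) by exact: measurable_itv.
have iI (g : R -> R) : continuous g -> mu.-integrable (`]a, b[) (EFin \o g).
  move=> cg; have := continuous_integrable_itv a b cg.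
  by apply: integrableS => //; exact: subset_itv_oo_cc.
have If s : `]u, (t + 1)[%classic s -> mu.-integrable (`]a, b[) (EFin \o f s).
  by move=> _; apply: iI; exact: cont2_sec1.
have Df s x : `]u, (t + 1)[%classic s -> `]a, b[%classic x -> is_derive s 1 (f ^~ x) (fp s x).
  rewrite /= !in_itv/= => /andP[us _] xab; apply: df => //; exact: lt_trans us.
have Df1 s x : `]u, (t + 1)[%classic s -> `]a, b[%classic x -> derivable (f ^~ x) s 1.
  by move=> hs hx; have [] := Df s x hs hx.
have Dfe s x : `]u, (t + 1)[%classic s -> `]a, b[%classic x -> partial1of2 f s x = fp s x.
  by move=> hs hx; exact: is_derive_derive1 (Df s x hs hx).
have Gi : mu.-integrable (`]a, b[) (EFin \o (fun _ : R => `|C|)).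
  by apply: iI => x; exact: cvg_cst.
have Gub s x : `]u, (t + 1)[%classic s -> `]a, b[%classic x -> `|partial1of2 f s x| <= `|C|.
  move=> hs hx; rewrite Dfe//; apply: le_trans (ler_norm C); apply: hC.
    by move: hs; rewrite /= in_itv/= => /andP[h1 h2]; rewrite !ltW.
  by move: hx; rewrite /= in_itv/= => /andP[h1 h2]; rewrite !ltW.
have e1 := differentiation_under_integral mB Ia If Df1 C0 Gi Gub.
have e2 := derivable_under_integral mB Ia If Df1 C0 Gi Gub.
rewrite (_ : (fun s => _) = fun s => \int[mu]_(x in `]a, b[) f s x); last first.
  by apply/funext => s; rewrite integral_oo_cc//; exact: cont2_sec1.
apply: derive1_is_derive => //; rewrite e1 -integral_oo_cc; last exact: cont2_sec1.
by apply: eq_Rintegral => x; rewrite inE => hx; exact: Dfe.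
Qed.

(** An exchange of derivatives: nothing is assumed on the x-derivative of [D1]. It is found by
    differentiating in time the formula of [V1 t z - V1 t y] as an integral of [V2]. *)
Lemma is_derive_mixed (V1 V2 D1 D2 : R -> R -> R) a b d :
  cont2 V1 -> cont2 V2 -> cont2 D1 -> cont2 D2 ->
  (forall t x, d < t -> a < x < b -> is_derive x 1 (V1 t) (V2 t x)) ->
  (forall t x, d < t -> a < x < b -> is_derive t 1 (V1 ^~ x) (D1 t x)) ->
  (forall t x, d < t -> a < x < b -> is_derive t 1 (V2 ^~ x) (D2 t x)) ->
  forall t x, d < t -> a < x < b -> is_derive x 1 (D1 t) (D2 t x).
Proof.
move=> c1 c2 cD1 cD2 hx h1 h2 t x dt /andP[ax xb].
pose y := (a + x) / 2; have ay : a < y by rewrite /y; lra.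
have yx : y < x by rewrite /y; lra.
have E z : y < z < b -> D1 t z = D1 t y + (prim (D2 t) z - prim (D2 t) y).
  move=> /andP[yz zb].
  have dV : is_derive t 1 (fun s => \int[mu]_(w in `[y, z]) V2 s w) (\int[mu]_(w in `[y, z]) D2 t w).
    apply: (is_derive_integral c2 cD2) dt => s w ds /andP[yw wz].
    by apply: h2 => //; rewrite (lt_trans ay yw) (lt_trans wz zb).
  rewrite -integral_prim ?(ltW yz)//; last exact: cont2_sec1.
  have dV' : is_derive t 1 (fun s => V1 s z - V1 s y) (D1 t z - D1 t y).
    apply: dlamB; apply: h1 => //; first by rewrite (lt_trans ay yz).
    by rewrite ay (lt_trans yz).
  have : is_derive t 1 (fun s => V1 s z - V1 s y) (\int[mu]_(w in `[y, z]) D2 t w).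
    apply: near_eq_is_derive dV; have : \forall s \near t, d < s by exact: lt_nbhsr.
    apply: filterS => s ds; apply: integral_derive; rewrite ?(ltW yz)//.
    - exact: cont2_sec1.
    - exact: cont2_sec1.
    - move=> w /andP[yw wz]; apply: hx => //.
      by rewrite (lt_trans ay yw) (lt_trans wz zb).
  move=> /is_derive_derive1 <-; rewrite (is_derive_derive1 dV'); ring.
have cD2t : continuous (D2 t) by exact: cont2_sec1.
have d0 : is_derive x 1 (fun z => D1 t y + (prim (D2 t) z - prim (D2 t) y)) (D2 t x).
  apply: is_derive_eq (dlamD (is_derive_cst (D1 t y) x 1)
    (dlamB (is_derive_prim cD2t x) (is_derive_cst (prim (D2 t) y) x 1))) _.
  by rewrite add0r subr0.
apply: near_eq_is_derive d0; have : \forall z \near x, z \in `]y, b[.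
  by apply: near_in_itvoo; rewrite in_itv/= yx xb.
by apply: filterS => z; rewrite in_itv/= => /E ->.
Qed.

Lemma is_derive_eps (f : R -> R) t l :
  (forall e, 0 < e -> \forall s \near t, `|f s - f t - l * (s - t)| <= e * `|s - t|) ->
  is_derive t 1 f l.
Proof.
move=> hf; apply/is_derive1_caratheodory.
exists (fun s => if s == t then l else (f s - f t) / (s - t)); split.
- move=> s; case: eqVneq => [->|st]; first by rewrite !subrr mulr0.
  by rewrite divfK// subr_eq0.
- apply/cvgrPdist_le => e e0; have := hf e e0; apply: filterS => s hs.
  rewrite eqxx; case: eqVneq => [_|st]; first by rewrite subrr normr0 ltW.
  have st0 : s - t != 0 by rewrite subr_eq0.
  rewrite -(ler_pM2r (_ : 0 < `|s - t|)) ?normr_gt0// (distrC l) -normrM.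
  by rewrite mulrBl divfK.
- by rewrite eqxx.
Qed.

(** The mean value theorem in time gives, at interior points near [x], an increment estimate that is
    uniform in the point; it passes to the end points by continuity. *)
Lemma is_derive_boundary V D a b d : a < b -> cont2 V -> cont2 D ->
  (forall t x, d < t -> a < x < b -> is_derive t 1 (V ^~ x) (D t x)) ->
  forall t x, d < t -> a <= x <= b -> is_derive t 1 (V ^~ x) (D t x).
Proof.
move=> ab cV cD dV t x dt /andP[ax xb]; apply: is_derive_eps => e e0.
have /cvgrPdist_le/(_ _ e0) := cD (t, x).
move=> /nbhs_ballP[rho /= rho0 hrho].
have hD s y : `|s - t| < rho -> `|y - x| < rho -> `|D s y - D t x| <= e.
  move=> hs hy; have := hrho (s, y); rewrite /= distrC; apply.
  by split; rewrite /ball/= distrC.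
have near1 : \forall s \near t, `|s - t| < rho.
  have : (fun z : R => z) z @[z --> t] --> t by exact: cvg_id.
  by move=> /cvgrPdist_lt/(_ _ rho0); apply: filterS => s; rewrite distrC.
have near2 : \forall s \near t, d < s by exact: lt_nbhsr.
apply: filterS2 near1 near2 => s hs ds.
pose W y := `|V s y - V t y - D t x * (s - t)|.
have hW y : a < y < b -> `|y - x| < rho -> W y <= e * `|s - t|.
  move=> yab hy; rewrite /W.
  have mv (s1 s2 : R) : s1 < s2 -> d < s1 -> `|s1 - t| < rho -> `|s2 - t| < rho ->
      `|V s2 y - V s1 y - D t x * (s2 - s1)| <= e * `|s2 - s1|.
    move=> s12 ds1 h1 h2.
    have dd c : c \in `]s1, s2[ -> is_derive c 1 (V ^~ y) ((D ^~ y) c).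
      by rewrite in_itv/= => /andP[h _]; apply: dV => //; exact: lt_trans h.
    have [|c cs ->] := MVT s12 dd.
    - by apply: continuous_subspaceT; exact: cont2_sec2.
    - rewrite -mulrBl normrM ler_wpM2r//; apply: hD => //.
      by move: cs h1 h2; rewrite in_itv/= !ltr_norml => /andP[? ?] /andP[? ?] /andP[? ?]; apply/andP; split; lra.
  have tr : `|t - t| < rho by rewrite subrr normr0.
  case: (ltgtP s t) => [st|ts|->]; last by rewrite !subrr mulr0 subrr normr0 mulr0.
    have := mv s t st ds hs tr.
    rewrite [X in X <= _](_ : _ = `|V s y - V t y - D t x * (s - t)|); last first.
      by rewrite -normrN; congr `|_|; ring.
    by rewrite (distrC t).
  exact: mv.
rewrite -/(W x); rewrite leNgt; apply/negP => bad.
have cW : continuous W.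
  move=> y; apply: (@continuous_comp _ _ _ (fun y => V s y - V t y - D t x * (s - t)) Num.norm).
    by apply: cvgB (cvg_cst _); apply: cvgB; exact: cont2_sec1.
  exact: norm_continuous.
have [eta eta0 heta] : exists2 eta, 0 < eta & forall y, `|y - x| < eta -> e * `|s - t| < W y.
  have : \forall y \near x, e * `|s - t| < W y by apply: (cvgr_gt _ (cW x)).
  move=> /nbhs_ballP[eta /= eta0 heta].
  by exists eta => // y hy; apply: heta; rewrite /ball/= distrC.
(* A step [k] from [x] towards the midpoint lands strictly inside the interval and stays within
   [rho] and [eta], where the two estimates contradict each other. *)
pose m := Num.min rho eta / 2; pose k := Num.min m ((b - a) / 4).
have m0 : 0 < m by rewrite divr_gt0// lt_min rho0 eta0.
have k0 : 0 < k by rewrite lt_min m0 divr_gt0// subr_gt0.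
have km : k <= m by rewrite ge_min lexx.
have kb : k <= (b - a) / 4 by rewrite ge_min lexx orbT.
have mr : m < rho.
  rewrite /m ltr_pdivrMr// (@le_lt_trans _ _ rho) ?ge_min ?lexx// ltr_pMr// ltr1n//.
have me : m < eta.
  rewrite /m ltr_pdivrMr// (@le_lt_trans _ _ eta) ?ge_min ?lexx ?orbT// ltr_pMr// ltr1n//.
have [y yab hyx] : exists2 y, a < y < b & `|y - x| = k.
  have [h|h] := leP x ((a + b) / 2).
    exists (x + k); last by rewrite addrAC subrr add0r gtr0_norm.
    by apply/andP; split; lra.
  exists (x - k); last by rewrite addrAC subrr sub0r normrN gtr0_norm.
  by apply/andP; split; lra.
have := hW y yab; rewrite hyx => /(_ (le_lt_trans km mr)).
by rewrite leNgt heta// hyx (le_lt_trans km me).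
Qed.

End TwoVariables.

(** * Energy balance in the interval *)

Section Interior.
Context {R : realType}.
Variables (c alpha eps xl xr : R) (F G : nat -> R * R -> R).
Hypothesis xlr : xl < xr.
Implicit Types (t x d : R) (k : nat) (H : R * R -> R).
Let mu := @lebesgue_measure R.

Hypothesis cF : forall k, (k <= 3)%N ->
  {within `]0, +oo[ `*` `[xl, xr], continuous (F k)}.
Hypothesis cG : forall k, (k <= 2)%N ->
  {within `]0, +oo[ `*` `[xl, xr], continuous (G k)}.
Hypothesis cFz : forall k, (k <= 1)%N ->
  {within `[0, +oo[ `*` `[xl, xr], continuous (F k)}.
Hypothesis dxF : forall k t x, (k <= 2)%N -> 0 < t -> xl < x < xr ->
  is_derive x 1 (fun y => F k (t, y)) (F k.+1 (t, x)).
Hypothesis dtF : forall k t x, (k <= 2)%N -> 0 < t -> xl < x < xr ->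
  is_derive t 1 (fun s => F k (s, x)) (G k (t, x)).
Hypothesis pde : forall t x, 0 < t -> xl < x < xr ->
  G 0 (t, x) - alpha * G 2 (t, x) + c * F 1 (t, x) + eps * F 3 (t, x) = 0.

(** Extends to the plane a function that is continuous for [t > 0] only; with [d = t / 2] it is
    unchanged near time [t]. *)
Definition cut d (H : R * R -> R) t x : R := H (Num.max d t, clip xl xr x).

Lemma cut_id d H t x : d <= t -> xl <= x <= xr -> cut d H t x = H (t, x).
Proof. by move=> dt hx; rewrite /cut max_r// clip_id. Qed.

Lemma cont2_cut d H : 0 < d -> {within `]0, +oo[ `*` `[xl, xr], continuous H} ->
  cont2 (cut d H).
Proof.
move=> d0; apply: cont2_clip.
  by move=> t; apply: continuous_max; [exact: cvg_cst|exact: cvg_id].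
by move=> t x; split; rewrite /= in_itv/= ?andbT; [rewrite lt_max d0|exact/clip_in/ltW].
Qed.

Let le_oo x : xl < x < xr -> xl <= x <= xr.
Proof. by move=> /andP[h1 h2]; rewrite !ltW. Qed.

Let near_oo x : xl < x < xr -> \forall y \near x, xl < y < xr.
Proof.
move=> hx; have : \forall y \near x, y \in `]xl, xr[ by apply: near_in_itvoo; rewrite in_itv.
by apply: filterS => y; rewrite in_itv.
Qed.

Let dx_cut d k t x : 0 < d -> (k <= 2)%N -> d < t -> xl < x < xr ->
  is_derive x 1 (cut d (F k) t) (cut d (F k.+1) t x).
Proof.
move=> d0 k2 dt hx; rewrite cut_id ?(ltW dt) ?le_oo//.
apply: near_eq_is_derive (dxF k2 (lt_trans d0 dt) hx).
by apply: filterS (near_oo hx) => y hy; rewrite cut_id ?(ltW dt) ?le_oo.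
Qed.

Let dt_cut d k t x : 0 < d -> (k <= 2)%N -> d < t -> xl < x < xr ->
  is_derive t 1 (cut d (F k) ^~ x) (cut d (G k) t x).
Proof.
move=> d0 k2 dt hx; rewrite cut_id ?(ltW dt) ?le_oo//.
apply: near_eq_is_derive (dtF k2 (lt_trans d0 dt) hx).
have : \forall s \near t, d < s by exact: lt_nbhsr.
by apply: filterS => s ds; rewrite cut_id ?(ltW ds) ?le_oo.
Qed.

Lemma dt_boundary k t x : (k <= 2)%N -> 0 < t -> xl <= x <= xr ->
  is_derive t 1 (fun s => F k (s, x)) (G k (t, x)).
Proof.
move=> k2 t0 hx; pose d := t / 2.
have d0 : 0 < d by rewrite divr_gt0.
have dt : d < t by rewrite /d; lra.
have h := is_derive_boundary xlr (cont2_cut d0 (cF (leqW k2))) (cont2_cut d0 (cG k2))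
  (fun t x dt hx => dt_cut d0 k2 dt hx) dt hx.
rewrite cut_id ?(ltW dt)// in h; apply: near_eq_is_derive h.
have : \forall s \near t, d < s by exact: lt_nbhsr.
by apply: filterS => s ds; rewrite cut_id ?(ltW ds).
Qed.

Lemma cont0_boundary H x : xl <= x <= xr ->
  {within `]0, +oo[ `*` `[xl, xr], continuous H} -> cont0 (fun t => H (t, x)).
Proof.
move=> hx cH t t0; pose d := t / 2.
have d0 : 0 < d by rewrite divr_gt0.
have dt : d < t by rewrite /d; lra.
have h0 := cont2_sec2 (x := x) (cont2_cut d0 cH); have h := h0 t.
have e : cut d H t x = H (t, x) by rewrite cut_id ?(ltW dt).
rewrite /prop_for /continuous_at /= -e.
apply: cvg_trans h; apply: near_eq_cvg.
have : \forall s \near t, d < s by exact: lt_nbhsr.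
by apply: filterS => s ds; rewrite cut_id ?(ltW ds).
Qed.

(** The counterpart of [cut] for functions that are continuous down to [t = 0], needed for the
    continuity of the energy there. *)
Definition cutz (H : R * R -> R) t x : R := H (`|t|, clip xl xr x).

Lemma cont2_cutz H : {within `[0, +oo[ `*` `[xl, xr], continuous H} -> cont2 (cutz H).
Proof.
apply: cont2_clip; first exact: norm_continuous.
by move=> t x; split; rewrite /= in_itv/= ?andbT//; exact/clip_in/ltW.
Qed.

Lemma cont0_within_boundary H x : xl <= x <= xr ->
  {within `[0, +oo[ `*` `[xl, xr], continuous H} ->
  {within `[0, +oo[, continuous (fun t => H (t, x))}.
Proof.
move=> hx cH.
have h := continuous_subspaceT (A := (`[0, +oo[%classic : set R)) (cont2_sec2 (x := x) (cont2_cutz cH)).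
apply: subspace_eq_continuous h => t; rewrite inE/= in_itv/= andbT => t0.
by rewrite /from_subspace/= /cutz ger0_norm// clip_id.
Qed.

Definition energy_density t x : R :=
  cutz (F 0) t x ^+ 2 + alpha * cutz (F 1) t x ^+ 2.

Definition energy t : R := \int[mu]_(x in `[xl, xr]) energy_density t x.

(** The current obtained by multiplying the equation by [2 u]: its x-derivative is the time
    derivative of the energy density. *)
Definition boundary_flux t x : R :=
  2 * (alpha * F 0 (t, x) * G 1 (t, x) - c / 2 * F 0 (t, x) ^+ 2
    - eps * F 0 (t, x) * F 2 (t, x) + eps / 2 * F 1 (t, x) ^+ 2).

Lemma cont2M f g : cont2 f -> cont2 g -> cont2 (fun t x => f t x * g t x : R).
Proof. by move=> cf cg p; apply: cvgM; [exact: cf|exact: cg]. Qed.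

Lemma cont2D f g : cont2 f -> cont2 g -> cont2 (fun t x => f t x + g t x : R).
Proof. by move=> cf cg p; apply: cvgD; [exact: cf|exact: cg]. Qed.

Lemma cont2Z (k : R) f : cont2 f -> cont2 (fun t x => k * f t x : R).
Proof. by move=> cf p; apply: cvgM; [exact: cvg_cst|exact: cf]. Qed.

Lemma cont2_energy_density : cont2 energy_density.
Proof.
have c0 := cont2_cutz (cFz (leq0n 1)); have c1 := cont2_cutz (cFz (leqnn 1)).
have -> : energy_density = fun t x => cutz (F 0) t x * cutz (F 0) t x +
    alpha * (cutz (F 1) t x * cutz (F 1) t x).
  by apply/funext => t; apply/funext => x; rewrite /energy_density !expr2.
exact: (cont2D (cont2M c0 c0) (cont2Z (k := alpha) (cont2M c1 c1))).
Qed.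

Lemma continuous_energy : continuous energy.
Proof.
move=> t0.
have [C hC] := bounded_rect (t0 - 1) (t0 + 1) xl xr cont2_energy_density.
have mB : measurable (`[xl, xr]%classic : set (measurableTypeR R)) by exact: measurable_itv.
have ic t : mu.-integrable (`[xl, xr]) (EFin \o energy_density t).
  exact/continuous_integrable_itv/cont2_sec1/cont2_energy_density.
apply: (@continuity_under_integral R _ _ mu energy_density `[xl, xr]%classic mB (t0 - 1) (t0 + 1) _ _ (cst C)).
- by move=> t _; exact: ic.
- apply: aeW => x _ t _; apply: cont2_sec2; exact: cont2_energy_density.
- by apply: continuous_integrable_itv => x; exact: cvg_cst.
- move=> t; rewrite /= in_itv/= => /andP[h1 h2]; apply: aeW => x; rewrite /= in_itv/= => hx.
  by apply: hC; rewrite ?(ltW h1) ?(ltW h2).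
- by rewrite inE/= in_itv/=; apply/andP; split; lra.
Qed.

Lemma is_derive_energy t : 0 < t ->
  is_derive t 1 energy (boundary_flux t xr - boundary_flux t xl).
Proof.
move=> t0; pose d := t / 2.
have d0 : 0 < d by rewrite divr_gt0.
have dt : d < t by rewrite /d; lra.
pose V k := cut d (F k); pose D k := cut d (G k).
have cV k : (k <= 3)%N -> cont2 (V k) by move=> k3; exact: cont2_cut d0 (cF k3).
have cD k : (k <= 2)%N -> cont2 (D k) by move=> k2; exact: cont2_cut d0 (cG k2).
have [cV0 cV1 cV2 cV3] := And4 (cV 0%N isT) (cV 1%N isT) (cV 2%N isT) (cV 3%N isT).
have [cD0 cD1 cD2] := And3 (cD 0%N isT) (cD 1%N isT) (cD 2%N isT).
pose e s x := V 0%N s x * V 0%N s x + alpha * (V 1%N s x * V 1%N s x).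
pose pe s x := 2 * (V 0%N s x * D 0%N s x) + 2 * alpha * (V 1%N s x * D 1%N s x).
pose j s x := 2 * alpha * (V 0%N s x * D 1%N s x) + (- c * (V 0%N s x * V 0%N s x)
    + (- 2 * eps * (V 0%N s x * V 2%N s x) + eps * (V 1%N s x * V 1%N s x))).
have ce : cont2 e by apply: cont2D; [exact: cont2M|apply: cont2Z; exact: cont2M].
have cpe : cont2 pe by apply: cont2D; apply: cont2Z; exact: cont2M.
have cj : cont2 j by do 3 (apply: cont2D; first by apply: cont2Z; exact: cont2M);
  apply: cont2Z; exact: cont2M.
have de s x : d < s -> xl < x < xr -> is_derive s 1 (e ^~ x) (pe s x).
  move=> ds hx; have h0 := dt_cut d0 (leq0n 2) ds hx; have h1 := dt_cut d0 (leqnSn 1) ds hx.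
  apply: is_derive_eq (dlamD (dlamM h0 h0) (dlamZ alpha (dlamM h1 h1))) _.
  by rewrite /pe /V /D; ring.
have dD1 s x : d < s -> xl < x < xr -> is_derive x 1 (D 1%N s) (D 2%N s x).
  apply: (is_derive_mixed cV1 cV2 cD1 cD2).
  - by move=> ? ? ? ?; exact: dx_cut.
  - by move=> ? ? ? ?; exact: dt_cut.
  - by move=> ? ? ? ?; exact: dt_cut.
have dj s x : d < s -> xl < x < xr -> is_derive x 1 (j s) (pe s x).
  move=> ds hx; have h0 := dx_cut d0 (leq0n 2) ds hx.
  have h1 := dx_cut d0 (leqnSn 1) ds hx; have h2 := dx_cut d0 (leqnn 2) ds hx.
  have h3 := dD1 s x ds hx.
  apply: is_derive_eq (dlamD (dlamZ (2 * alpha) (dlamM h0 h3))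
    (dlamD (dlamZ (- c) (dlamM h0 h0)) (dlamD (dlamZ (- 2 * eps) (dlamM h0 h2))
     (dlamZ eps (dlamM h1 h1))))) _.
  have := pde (lt_trans d0 ds) hx.
  rewrite /pe /V /D !cut_id ?(ltW ds) ?le_oo// => h.
  have -> : G 0 (s, x) = alpha * G 2 (s, x) - c * F 1 (s, x) - eps * F 3 (s, x).
    by rewrite -[LHS]subr0 -h; ring.
  by ring.
have E : \int[mu]_(x in `[xl, xr]) pe t x = j t xr - j t xl.
  apply: integral_derive; rewrite ?(ltW xlr)//; try exact: cont2_sec1.
  by move=> x hx; exact: dj.
have bf x : xl <= x <= xr -> j t x = boundary_flux t x.
  by move=> hx; rewrite /j /boundary_flux /V /D !cut_id ?(ltW dt)//; field.
have := is_derive_integral ce cpe de dt; rewrite E !bf ?lexx ?(ltW xlr)//.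
apply: near_eq_is_derive.
have : \forall s \near t, d < s by exact: lt_nbhsr.
apply: filterS => s ds; apply: eq_Rintegral => x; rewrite inE/= in_itv/= => hx.
by rewrite /e /energy_density /V /cut /cutz max_r ?(ltW ds)// gtr0_norm ?(lt_trans d0).
Qed.

End Interior.

(** * Energy estimate *)

Section BoundaryDissipation.
Context {R : realType}.
Variables (c alpha eps : R).
Hypotheses (alpha_gt0 : 0 < alpha) (eps_gt0 : 0 < eps).
Implicit Types (g h : R -> R) (t T : R).

Let a := rate alpha.
Let p := latp c alpha.
Let r := latr alpha eps.
Let a0 : a != 0. Proof. by rewrite gt_eqF// rate_gt0. Qed.

(** With [g] written as the difference of modes 0 and 1, both sides are quadratic forms in the first
    three modes, and the physical flux is seen to be the telescoping one. *)
Lemma flux_identity g t : continuous g ->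
  g t * qop c alpha eps g t - c / 2 * g t ^+ 2 + eps / 2 * lamop c alpha eps g t ^+ 2
  = 2 / a * flux p r (fun m => mode p r m g t) 0.
Proof.
move=> cg; rewrite -(mode01 p r cg t) /qop /lamop -/a -/p -/r /flux.
have -> : c = 4 * p / a by rewrite /p /latp -/a; field.
have -> : eps = 4 * r / a ^+ 3 by rewrite /r /latr -/a; field.
by field.
Qed.

Lemma prim_rev g T : continuous g -> prim (rev T g) T = prim g T.
Proof.
move=> cg; have crg := continuous_rev (T := T) cg.
have d (t : R) : is_derive t 1 (fun t => - prim g (T - t)) (rev T g t).
  have h := dlamB (is_derive_cst T t 1) (is_derive_id t 1).
  apply: is_derive_eq (dlamN (dlamcomp (g := fun x => T - x) (is_derive_prim cg (T - t)) h)) _.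
  by rewrite sub0r mulrN1 opprK.
have := prim_unique crg d T; rewrite subrr subr0 prim0 oppr0 sub0r opprK.
by move=> ->.
Qed.

Lemma primZ k g T : continuous g -> prim (fun t => k * g t) T = k * prim g T.
Proof.
move=> cg; have := prim_lin k 0 cg cg T; rewrite mul0r addr0 => <-.
by congr (prim _ _); apply/funext => t; rewrite mul0r addr0.
Qed.

Lemma primD g h T : continuous g -> continuous h ->
  prim (fun t => g t + h t) T = prim g T + prim h T.
Proof.
move=> cg ch; have := prim_lin 1 1 cg ch T; rewrite !mul1r => <-.
by congr (prim _ _); apply/funext => t; rewrite !mul1r.
Qed.

Lemma continuous_sq k g : continuous g -> continuous (fun t => k * g t ^+ 2 : R).
Proof.
move=> cg t; apply: cvgM; first exact: cvg_cst.
by apply: cvgM; exact: cg.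
Qed.

Lemma continuous_sqr g : continuous g -> continuous (fun t => g t ^+ 2 : R).
Proof. by move=> cg t; apply: cvgM; exact: cg. Qed.

Lemma continuous_add g h : continuous g -> continuous h -> continuous (fun t => g t + h t).
Proof. by move=> cg ch t; apply: cvgD; [exact: cg|exact: ch]. Qed.

Lemma continuous_scale k g : continuous g -> continuous (fun t => k * g t : R).
Proof. by move=> cg t; apply: cvgM; [exact: cvg_cst|exact: cg]. Qed.

(** What is left of minus the flux at [x_l] once the boundary condition has eliminated [u_xx] and
    the exact derivative of [g ^ 2] has been removed; [g] and [h] stand for the traces of [u] and
    [u_x]. *)
Definition left_power g h t : R :=
  g t * qop c alpha eps g t - c / 2 * g t ^+ 2
  - eps * (g t * lamop c alpha eps h t) - eps / 2 * h t ^+ 2.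

Lemma continuous_left_power g h : continuous g -> continuous h ->
  continuous (left_power g h).
Proof.
move=> cg ch; have cq := continuous_qop (c := c) (alpha := alpha) (eps := eps) cg; have cl := continuous_lamop (c := c) (alpha := alpha) (eps := eps) ch.
have e : left_power g h = fun t => (g t * qop c alpha eps g t + (- (c / 2)) * g t ^+ 2)
  + (- eps * (g t * lamop c alpha eps h t) + (- (eps / 2)) * h t ^+ 2).
  by apply/funext => t; rewrite /left_power; ring.
rewrite e; apply: continuous_add; apply: continuous_add.
- exact: continuous_mul.
- exact: continuous_sq.
- by apply: continuous_scale; exact: continuous_mul.
- exact: continuous_sq.
Qed.

(* Time reversal turns the causal operator acting on [h] into an anticausal one
   acting on [g]; completing the square in [h] then leaves the quadratic form of
   the right boundary, evaluated at the reversed trace. *)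
Lemma left_dissipation g h T : continuous g -> continuous h -> 0 <= T ->
  prim (left_power g h) T <= 0.
Proof.
move=> cg ch T0; pose gt := rev T g.
have cgt : continuous gt by exact: continuous_rev.
have [M hM] := geo_lamA c alpha eps; have [M' hM'] := geo_qA c alpha eps.
have B0 := growth_gt0 (latp c alpha) (latr alpha eps).
have cq := continuous_qop (c := c) (alpha := alpha) (eps := eps) cg; have cl := continuous_lamop (c := c) (alpha := alpha) (eps := eps) ch.
have cqt := continuous_qop (c := c) (alpha := alpha) (eps := eps) cgt; have clt := continuous_lamop (c := c) (alpha := alpha) (eps := eps) cgt.
pose w := rev T (lamop c alpha eps gt).
have cw : continuous w by exact: continuous_rev.
have E1 : prim (fun t => g t * lamop c alpha eps h t) T = prim (fun t => w t * h t) T.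
  by rewrite -op_lamA// (prim_dual_op B0 hM T0 cg ch) op_lamA.
(* The adjoint of a series in [prim] is its time reversal, so this quadratic form takes the same
   value on the reversed trace. *)
have E2 : prim (fun t => g t * qop c alpha eps g t) T =
    prim (fun t => gt t * qop c alpha eps gt t) T.
  rewrite -op_qA// (prim_dual_op B0 hM' T0 cg cg) op_qA//.
  rewrite -[RHS]prim_rev; last exact: continuous_mul.
  by congr (prim _ _); apply/funext => t; rewrite /rev /gt/= /rev subKr mulrC.
have E3 : prim (fun t => g t ^+ 2) T = prim (fun t => gt t ^+ 2) T.
  by rewrite -[LHS]prim_rev//; exact: continuous_sqr.
have E4 : prim (fun t => w t ^+ 2) T = prim (fun t => lamop c alpha eps gt t ^+ 2) T.
  by rewrite -[RHS]prim_rev//; exact: continuous_sqr.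
have cgq : continuous (fun t => g t * qop c alpha eps g t) by exact: continuous_mul.
have cgl : continuous (fun t => g t * lamop c alpha eps h t) by exact: continuous_mul.
have cwh : continuous (fun t => w t * h t) by exact: continuous_mul.
have [sg [sh sw]] : continuous (fun t => g t ^+ 2) /\ continuous (fun t => h t ^+ 2) /\
    continuous (fun t => w t ^+ 2) by split; [|split]; exact: continuous_sqr.
have P1 : prim (left_power g h) T = prim (fun t => g t * qop c alpha eps g t) T
    - c / 2 * prim (fun t => g t ^+ 2) T
    + (- eps * prim (fun t => w t * h t) T + (- (eps / 2)) * prim (fun t => h t ^+ 2) T).
  rewrite -E1 -(prim_lin _ _ cgl sh) -[X in X - _ + _]mul1r -mulNr -(prim_lin _ _ cgq sg).
  rewrite -[RHS]/(_ + _) -[X in X + _]mul1r -[X in _ + X]mul1r -prim_lin.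
  - by congr (prim _ _); apply/funext => t; rewrite /left_power; ring.
  - by apply: continuous_add; apply: continuous_scale.
  - by apply: continuous_add; apply: continuous_scale.
have P2 : - eps * prim (fun t => w t * h t) T + (- (eps / 2)) * prim (fun t => h t ^+ 2) T
    <= eps / 2 * prim (fun t => w t ^+ 2) T.
  rewrite -(prim_lin _ _ cwh sh) -[leRHS]addr0 -[X in _ + X](mul0r (prim (fun t => w t ^+ 2) T)).
  rewrite -(prim_lin _ _ sw sw); apply: prim_le => //.
  - by apply: continuous_add; apply: continuous_scale.
  - by apply: continuous_add; apply: continuous_scale.
  - move=> x _; rewrite mul0r addr0 -subr_ge0.
    rewrite (_ : _ - _ = eps / 2 * (w x + h x) ^+ 2); last by field.
    by rewrite mulr_ge0 ?sqr_ge0// divr_ge0// ltW.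
rewrite P1; apply: le_trans (lerD (lexx _) P2) _.
rewrite E2 E3 E4.
have cgq' : continuous (fun t => gt t * qop c alpha eps gt t) by exact: continuous_mul.
have [s1 s2] := (continuous_sqr cgt, continuous_sqr clt).
have -> : prim (fun t => gt t * qop c alpha eps gt t) T - c / 2 * prim (fun t => gt t ^+ 2) T
   + eps / 2 * prim (fun t => lamop c alpha eps gt t ^+ 2) T =
  2 / a * prim (fun t => flux p r (fun m => mode p r m gt t) 0) T.
  have cf := @continuous_flux_mode R p r 0 gt cgt.
  rewrite -(primZ _ _ cf) -mulNr -!primZ// -!primD//; try exact: continuous_scale.
    by congr (prim _ _); apply/funext => t; rewrite -(flux_identity _ cgt); ring.
  by apply: continuous_add => //; exact: continuous_scale.
rewrite pmulr_rle0 ?divr_gt0 ?rate_gt0//.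
exact: dissipation.
Qed.

Lemma energy_decay (E Jr Jl gr gr' gl gl' hl : R -> R) :
  continuous E -> continuous gr -> continuous gl -> continuous hl ->
  gr 0 = 0 -> gl 0 = 0 ->
  (forall t, 0 < t -> is_derive t 1 E (2 * Jr t - 2 * Jl t)) ->
  (forall t, 0 < t -> is_derive t 1 gr (gr' t)) ->
  (forall t, 0 < t -> is_derive t 1 gl (gl' t)) ->
  (forall t, 0 < t -> Jr t = - a^-1 * (gr t * gr' t) +
     2 / a * flux p r (fun m => mode p r m gr t) 0) ->
  (forall t, 0 < t -> - Jl t = - a^-1 * (gl t * gl' t) + left_power gl hl t) ->
  forall T, 0 < T -> E T <= E 0.
Proof.
move=> cE cgr cgl chl gr0 gl0 dE dgr dgl hJr hJl T T0.
pose fx t := flux p r (fun m => mode p r m gr t) 0.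
have cfx : continuous fx by exact: continuous_flux_mode.
have clp := continuous_left_power cgl chl.
(* The energy in the interval plus everything that has left it. It is constant, the added terms
   vanish at time 0, and they are nonnegative at time [T]. *)
pose Psi t := E t + (a^-1 * (gr t * gr t) + (a^-1 * (gl t * gl t) +
   (- (4 / a) * prim fx t + (- 2) * prim (left_power gl hl) t))).
have dPsi (t : R) : 0 < t -> is_derive t 1 Psi 0.
  move=> t0.
  apply: is_derive_eq (dlamD (dE t t0) (dlamD (dlamZ a^-1 (dlamM (dgr t t0) (dgr t t0)))
   (dlamD (dlamZ a^-1 (dlamM (dgl t t0) (dgl t t0)))
   (dlamD (dlamZ (- (4 / a)) (is_derive_prim cfx t)) (dlamZ (- 2) (is_derive_prim clp t)))))) _.
  have -> : - (2 * Jl t) = 2 * - Jl t by rewrite mulrN.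
  by rewrite hJr// hJl// /fx; field.
have cPsi : continuous Psi.
  apply: continuous_add => //; apply: continuous_add.
    by apply: continuous_scale; exact: continuous_mul.
  apply: continuous_add; first by apply: continuous_scale; exact: continuous_mul.
  by apply: continuous_add; apply: continuous_scale; exact: continuous_prim.
have : Psi T - Psi 0 = 0.
  have c0 : continuous (fun _ : R => 0 : R) by move=> t; exact: cvg_cst.
  have dP (t : R) (ht : 0 < t < T) : is_derive t 1 Psi ((fun _ : R => 0 : R) t).
    by case/andP: ht => t0 _; exact: dPsi.
  rewrite -(integral_derive (ltW T0) c0 cPsi dP).
  by rewrite Rintegral_cst ?mul0r//; exact: measurable_itv.
rewrite /Psi !prim0 gr0 gl0 !mulr0 !addr0 => /eqP; rewrite subr_eq0 => /eqP <-.
have A0 : 0 < a by exact: rate_gt0.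
have h1 : 0 <= a^-1 * (gr T * gr T) by rewrite mulr_ge0 ?invr_ge0 ?(ltW A0)// -expr2 sqr_ge0.
have h2 : 0 <= a^-1 * (gl T * gl T) by rewrite mulr_ge0 ?invr_ge0 ?(ltW A0)// -expr2 sqr_ge0.
have h3 : 0 <= - (4 / a) * prim fx T.
  rewrite mulNr -mulrN mulr_ge0 ?divr_ge0 ?(ltW A0)// oppr_ge0.
  exact: dissipation cgr (ltW T0).
have h4 := left_dissipation cgl chl (ltW T0).
by lra.
Qed.

End BoundaryDissipation.

(** * One-sided limits and values at the end points *)

Section Traces.
Context {R : realType}.
Implicit Types (f g v : R -> R) (a b : R).
Let mu := @lebesgue_measure R.

(** Nothing is known of [f] at [a] and [b]: this is meant for space derivatives, whose formal values
    at the end points carry no information. *)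
Lemma integral_eq_oo f g a b : continuous g ->
  (forall x, a < x < b -> f x = g x) ->
  \int[mu]_(x in `[a, b]) f x = \int[mu]_(x in `[a, b]) g x.
Proof.
move=> cg fg; have e x : x \in `]a, b[%classic -> g x = f x.
  by rewrite inE/= in_itv/= => h; rewrite fg.
have mf : measurable_fun (`]a, b[%classic : set (measurableTypeR R)) f.
  apply: eq_measurable_fun e _; apply: measurable_funTS.
  exact: continuous_measurable_fun.
rewrite -(integral_oo_cc a b cg) (eq_Rintegral mu e).
have m1 : measurable_fun (`[a, b[%classic : set (measurableTypeR R)) f.
  exact/measurable_fun_itv_obnd_cbndP.
rewrite /Rintegral -integral_itv_bndo_bndc; last exact/measurable_EFinP.
by rewrite -integral_itv_obnd_cbnd//; exact/measurable_EFinP.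
Qed.

Lemma lim_left_of_continuous f g a b : a < b -> continuous g ->
  (forall x, a < x < b -> f x = g x) -> lim (f x @[x --> b^'-]) = g b.
Proof.
move=> ab cg fg; apply/cvg_lim => //.
have h : g x @[x --> b^'-] --> g b by apply: cvg_at_left_filter; exact: cg.
apply: cvg_trans h; apply: near_eq_cvg.
near=> x; rewrite fg//; apply/andP; split; near: x; [exact: nbhs_left_gt|exact: nbhs_left_lt].
Unshelve. all: by end_near. Qed.

Lemma lim_right_of_continuous f g a b : a < b -> continuous g ->
  (forall x, a < x < b -> f x = g x) -> lim (f x @[x --> a^'+]) = g a.
Proof.
move=> ab cg fg; apply/cvg_lim => //.
have h : g x @[x --> a^'+] --> g a by apply: cvg_at_right_filter; exact: cg.
apply: cvg_trans h; apply: near_eq_cvg.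
near=> x; rewrite fg//; apply/andP; split; near: x; [exact: nbhs_right_gt|exact: nbhs_right_lt].
Unshelve. all: by end_near. Qed.

Lemma eq_pairing f g phi : (forall t, 0 < t -> f t = g t) -> pairing f phi = pairing g phi.
Proof.
move=> fg; apply: eq_Rintegral => t; rewrite inE/= in_itv/= andbT => t0.
by rewrite fg.
Qed.

(** Applied to [u0], this makes both traces vanish at time 0, so that the exterior energy starts
    from 0. *)
Lemma zero_outside_boundary f a b : a < b -> continuous f ->
  (forall x, ~ (a <= x <= b) -> f x = 0) -> f a = 0 /\ f b = 0.
Proof.
move=> ab cf f0; split.
  have := @lim_left_of_continuous (fun=> 0) f (a - 1) a _ cf.
  rewrite lim_cst// => <- //; first by rewrite gtrBl.
  by move=> x /andP[_ xa]; rewrite f0// => /andP[]; rewrite leNgt xa.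
have := @lim_right_of_continuous (fun=> 0) f b (b + 1) _ cf.
rewrite lim_cst// => <- //; first by rewrite ltrDl.
by move=> x /andP[bx _]; rewrite f0// => /andP[_]; rewrite leNgt bx.
Qed.

End Traces.

(** * Stability of the boundary value problem *)

Unset Implicit Arguments.
Set Strict Implicit.
Set Printing Implicit Defensive.

Theorem proposition2p2 (R : realType) (c alpha eps xl xr : R)
    (u0 : R -> R) (u : R -> R -> R)
    (alpha_gt0 : 0 < alpha) (eps_gt0 : 0 < eps) (xl_lt_xr : xl < xr)
    (u0_cont : continuous u0)
    (u0_supp : forall x, ~ (xl <= x <= xr) -> u0 x = 0)
    (symbol_ge0 : forall xi : R,
      let l := lambda1_bnd c alpha eps xi in
      c / 2 + eps * (complex.Re (l ^+ 2) - complex.Re `|l| ^+ 2 / 2)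
        - alpha * complex.Re ((0 +i* xi) * l) >= 0)
    (u_regular : regular xl xr u)
    (u_pde : solves_pde c alpha eps xl xr u)
    (u_init : forall x, xl < x < xr -> u 0 x = u0 x)
    (u_bc_right1 : bc_right1 c alpha eps xr u)
    (u_bc_right2 : bc_right2 c alpha eps xr u)
    (u_bc_left : bc_left c alpha eps xl u) :
  forall t : R, 0 < t ->
    \int[@lebesgue_measure R]_(x in `[xl, xr])
        (u t x ^+ 2 + alpha * dx 1 u t x ^+ 2)
    <= \int[@lebesgue_measure R]_(x in `[xl, xr])
        (u0 x ^+ 2 + alpha * derive1 u0 x ^+ 2).
Proof.
case: u_regular => cu [du [F1 cF1 F1E]] dxt extF extG.
have [F2 cF2 F2E] := extF 2%N isT; have [F3 cF3 F3E] := extF 3%N isT.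
have [G0 cG0 G0E] := extG 0%N isT; have [G1 cG1 G1E] := extG 1%N isT.
have [G2 cG2 G2E] := extG 2%N isT.
(* From here on, the boundary is handled through continuous extensions to the closed strip; [F 0]
   and [F 1] reach [t = 0], the others only positive times. *)
pose F k : R * R -> R := match k with
  | 0%N => fun p => u p.1 p.2 | 1%N => F1 | 2%N => F2 | _ => F3 end.
pose G k : R * R -> R := match k with 0%N => G0 | 1%N => G1 | _ => G2 end.
have in0 (t x : R) : 0 <= t -> xl < x < xr -> (`[0, +oo[ `*` `]xl, xr[)%classic (t, x).
  by move=> t0 hx; split; rewrite /= in_itv/= ?andbT.
have inp (t x : R) : 0 < t -> xl < x < xr -> (`]0, +oo[ `*` `]xl, xr[)%classic (t, x).
  by move=> t0 hx; split; rewrite /= in_itv/= ?andbT.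
have FE k (t x : R) : (k <= 3)%N -> 0 < t -> xl < x < xr -> F k (t, x) = dx k u t x.
  move=> + t0 hx; case: k => [|[|[|[|//]]]] _ //=.
  - by rewrite F1E//; apply: in0 => //; exact: ltW.
  - by rewrite F2E//; exact: inp.
  - by rewrite F3E//; exact: inp.
have GE k (t x : R) : (k <= 2)%N -> 0 < t -> xl < x < xr -> G k (t, x) = dt (dx k u) t x.
  move=> + t0 hx; case: k => [|[|[|//]]] _ /=.
  - by rewrite G0E//; exact: inp.
  - by rewrite G1E//; exact: inp.
  - by rewrite G2E//; exact: inp.
have cFz k : (k <= 1)%N -> {within `[0, +oo[ `*` `[xl, xr], continuous (F k)}.
  by case: k => [|[|//]].
have sub : ((`]0, +oo[ : set R) `*` `[xl, xr] `<=` (`[0, +oo[ : set R) `*` `[xl, xr])%classic.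
  move=> [t x] [t0 hx]; split => //; have := t0; rewrite /= !in_itv/= !andbT.
  exact: ltW.
have cF k : (k <= 3)%N -> {within `]0, +oo[ `*` `[xl, xr], continuous (F k)}.
  case: k => [|[|[|[|//]]]] _ //.
  - exact: continuous_subspaceW sub cu.
  - exact: continuous_subspaceW sub cF1.
have cG k : (k <= 2)%N -> {within `]0, +oo[ `*` `[xl, xr], continuous (G k)}.
  by case: k => [|[|[|//]]].
have oo (x : R) : xl < x < xr -> \forall y \near x, xl < y < xr.
  move=> hx; have : \forall y \near x, y \in `]xl, xr[ by apply: near_in_itvoo; rewrite in_itv.
  by apply: filterS => y; rewrite in_itv.
have dxu k (t x : R) : (k <= 2)%N -> 0 < t -> xl < x < xr ->
    is_derive x 1 (dx k u t) (dx k.+1 u t x).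
  move=> k2 t0 hx; have [d _] := dxt k t x k2 t0 hx.
  by apply: derive1_is_derive => //; rewrite /dx derive1nS.
have dtu k (t x : R) : (k <= 2)%N -> 0 < t -> xl < x < xr ->
    is_derive t 1 (fun s => dx k u s x) (dt (dx k u) t x).
  move=> k2 t0 hx; have [_ d] := dxt k t x k2 t0 hx.
  exact: derive1_is_derive.
have dxF k (t x : R) : (k <= 2)%N -> 0 < t -> xl < x < xr ->
    is_derive x 1 (fun y => F k (t, y)) (F k.+1 (t, x)).
  move=> k2 t0 hx; rewrite FE//; apply: near_eq_is_derive (dxu k t x k2 t0 hx).
  by apply: filterS (oo x hx) => y hy; rewrite FE// leqW.
have dtF k (t x : R) : (k <= 2)%N -> 0 < t -> xl < x < xr ->
    is_derive t 1 (fun s => F k (s, x)) (G k (t, x)).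
  move=> k2 t0 hx; rewrite GE//; apply: near_eq_is_derive (dtu k t x k2 t0 hx).
  have : \forall s \near t, 0 < s by exact: lt_nbhsr.
  by apply: filterS => s s0; rewrite FE// leqW.
have pde (t x : R) : 0 < t -> xl < x < xr ->
    G 0%N (t, x) - alpha * G 2%N (t, x) + c * F 1%N (t, x) + eps * F 3%N (t, x) = 0.
  move=> t0 hx; rewrite !GE// !FE// -(u_pde t x t0 hx); congr (_ + _ + _).
  rewrite [RHS](_ : _ = derive1 (fun s => dx 0 u s x - alpha * dx 2 u s x) t)//.
  symmetry; apply: is_derive_derive1.
  exact: (dlamB (dtu 0%N t x isT t0 hx) (dlamZ alpha (dtu 2%N t x isT t0 hx))).
have hl : xl <= xl <= xr by rewrite lexx ltW.
have hr : xl <= xr <= xr by rewrite lexx ltW.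
have dF k (t x : R) : (k <= 2)%N -> 0 < t -> xl <= x <= xr ->
    is_derive t 1 (fun s => F k (s, x)) (G k (t, x)).
  by move=> k2 t0 hx; exact: (dt_boundary xl_lt_xr cF cG dtF).
have lim_cut k (t x : R) : (k <= 2)%N -> 0 < t -> xl < x < xr ->
    dx k u t x = cut xl xr t (F k) t x.
  move=> k2 t0 hx; have hx' : xl <= x <= xr by case/andP: hx => h1 h2; rewrite !ltW.
  by rewrite cut_id// FE// leqW.
have cc k (t : R) : (k <= 2)%N -> 0 < t -> continuous (cut xl xr t (F k) t).
  by move=> k2 t0; apply: cont2_sec1; exact: (cont2_cut xl_lt_xr t0 (cF k (leqW k2))).
have trR k (t : R) : (k <= 2)%N -> 0 < t -> trace_r xr (dx k u) t = F k (t, xr).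
  move=> k2 t0; rewrite /trace_r (lim_left_of_continuous xl_lt_xr (cc k t k2 t0)).
    by rewrite cut_id.
  by move=> x; exact: lim_cut.
have trL k (t : R) : (k <= 2)%N -> 0 < t -> trace_l xl (dx k u) t = F k (t, xl).
  move=> k2 t0; rewrite /trace_l (lim_right_of_continuous xl_lt_xr (cc k t k2 t0)).
    by rewrite cut_id.
  by move=> x; exact: lim_cut.
have trL0 (t : R) : 0 <= t -> trace_l xl (dx 1 u) t = F1 (t, xl).
  move=> t0; have c1 : continuous (cutz xl xr F1 t) by exact/cont2_sec1/cont2_cutz.
  rewrite /trace_l (lim_right_of_continuous xl_lt_xr c1).
    by rewrite /cutz ger0_norm// clip_id.
  by move=> x hx; rewrite /cutz ger0_norm// clip_id ?F1E//; [exact: in0|case/andP: hx => ? ?; rewrite !ltW].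
have cgr : {within `[0, +oo[, continuous (u ^~ xr)}.
  exact: (cont0_within_boundary xl_lt_xr hr cu).
have cgl : {within `[0, +oo[, continuous (u ^~ xl)}.
  exact: (cont0_within_boundary xl_lt_xr hl cu).
have chl : {within `[0, +oo[, continuous (trace_l xl (dx 1 u))}.
  apply: subspace_eq_continuous (cont0_within_boundary xl_lt_xr hl cF1) => t.
  by rewrite inE/= in_itv/= andbT => t0; rewrite /from_subspace/= trL0.
have dgr (t : R) : 0 < t -> is_derive t 1 (u ^~ xr) (G0 (t, xr)) by move=> t0; exact: (dF 0%N).
have dgl (t : R) : 0 < t -> is_derive t 1 (u ^~ xl) (G0 (t, xl)) by move=> t0; exact: (dF 0%N).
have dhl (t : R) : 0 < t -> is_derive t 1 (trace_l xl (dx 1 u)) (G1 (t, xl)).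
  move=> t0; apply: near_eq_is_derive (dF 1%N t xl isT t0 hl).
  have : \forall s \near t, 0 < s by exact: lt_nbhsr.
  by apply: filterS => s /ltW s0; rewrite trL0.
have c0b (x : R) (H : R * R -> R) : xl <= x <= xr -> {within `]0, +oo[ `*` `[xl, xr], continuous H} ->
    cont0 (fun t => H (t, x)).
  by move=> hx; exact: cont0_boundary.
have cG0r := c0b _ _ hr (cG 0%N isT); have cG0l := c0b _ _ hl (cG 0%N isT).
have cG1l := c0b _ _ hl (cG 1%N isT).
pose gr := even_ext (u ^~ xr); pose gl := even_ext (u ^~ xl).
pose he := even_ext (trace_l xl (dx 1 u)).
have cger : continuous gr by exact: continuous_even_ext.
have cgel : continuous gl by exact: continuous_even_ext.
have chel : continuous he by exact: continuous_even_ext.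
have cont0T (f : R -> R) : continuous f -> cont0 f by move=> cf t _; exact: cf.
have clr : continuous (lamop c alpha eps gr) by exact: continuous_lamop.
have clr' : continuous (lamop' c alpha eps (u ^~ xr)) by exact: continuous_lamop'.
have cqr : continuous (qop c alpha eps gr) by exact: continuous_qop.
have cll : continuous (lamop c alpha eps he) by exact: continuous_lamop.
have cql : continuous (qop c alpha eps gl) by exact: continuous_qop.
have lin0 (f g : R -> R) (k l : R) : cont0 f -> cont0 g -> cont0 (fun t => k * f t + l * g t).
  by move=> cf cg t t0; apply: cvgD; apply: cvgM (cvg_cst _) _; [exact: cf|exact: cg].
(* Both sides are continuous for [t > 0], so equality against all test functions is pointwise
   equality; the other two boundary conditions are treated in the same way. *)
have R1 (t : R) : 0 < t -> F1 (t, xr) = lamop c alpha eps gr t.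
  move: t; apply: (pairing_inj (f := fun t => F1 (t, xr)) (g := lamop c alpha eps gr)); [exact: c0b _ _ hr (cF 1%N isT)|exact: cont0T|].
  case: u_bc_right1 => T hT eqT phi tphi.
  rewrite -(conv_lambda alpha_gt0 eps_gt0 cgr dgr cG0r hT tphi) -eqT//.
  by apply: eq_pairing => s s0; rewrite trR.
have R2 (t : R) : 0 < t -> F2 (t, xr) = alpha / eps * lamop' c alpha eps (u ^~ xr) t
     + (- eps^-1) * qop c alpha eps gr t.
  move: t; apply: (pairing_inj (f := fun t => F2 (t, xr)) (g := fun t =>
    alpha / eps * lamop' c alpha eps (u ^~ xr) t + (- eps^-1) * qop c alpha eps gr t)).
  - exact: c0b _ _ hr (cF 2%N isT).
  - by apply: lin0; apply: cont0T.
  case: u_bc_right2 => T hT eqT phi tphi.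
  rewrite -(conv_lambda2 alpha_gt0 eps_gt0 cgr dgr cG0r hT tphi) -eqT//.
  by apply: eq_pairing => s s0; rewrite trR.
(* No boundary condition mentions [u_tx] at [x_r]: it is found by differentiating [R1] in time. *)
have R1' (t : R) : 0 < t -> G1 (t, xr) = - rate alpha * G0 (t, xr) + lamop' c alpha eps (u ^~ xr) t.
  move=> t0; rewrite -[G1 _]/(G 1%N (t, xr)) -(is_derive_derive1 (dF 1%N t xr isT t0 hr)).
  apply: is_derive_derive1; apply: near_eq_is_derive (is_derive_lamop c alpha eps cgr dgr t0).
  have : \forall s \near t, 0 < s by exact: lt_nbhsr.
  by apply: filterS => s s0; rewrite -(R1 s s0).
(* The factors 1 give the expression the nested shape that [pairing_lin] expects. *)
have L1 (t : R) : 0 < t -> 1 * (1 * F2 (t, xl) + 1 * (1 * lamop c alpha eps he t + (- alpha / eps) * G1 (t, xl)))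
    + 1 * (1 * (- eps^-1 * qop c alpha eps gl t + (rate alpha * eps)^-1 * G0 (t, xl))
      + c / eps * u t xl) = 0.
  have cu0l : cont0 (u ^~ xl) := c0b _ _ hl (cF 0%N isT).
  have k2 := c0b _ _ hl (cF 2%N isT).
  have k1 := lin0 _ _ 1 (- alpha / eps) (cont0T _ cll) cG1l.
  have k3 := lin0 _ _ (- eps^-1) ((rate alpha * eps)^-1) (cont0T _ cql) cG0l.
  have k4 := lin0 _ _ 1 1 k2 k1; have k5 := lin0 _ _ 1 (c / eps) k3 cu0l.
  have k6 := lin0 _ _ 1 1 k4 k5.
  have cz : cont0 (fun _ : R => 0 : R) by move=> s _; exact: cvg_cst.
  move: t; apply: (pairing_inj k6 cz) => phi tphi.
  case: u_bc_left => T1 [T2 [hT1 hT2 eqT]].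
  have := eqT phi tphi.
  rewrite (conv_left1 alpha_gt0 eps_gt0 chl dhl cG1l hT1 tphi).
  rewrite (conv_left2 alpha_gt0 eps_gt0 cgl dgl cG0l hT2 tphi).
  rewrite (eq_pairing (f := trace_l xl (dx 2 u)) (g := fun t => F2 (t, xl))); last first.
    by move=> s s0; rewrite trL.
  move=> h; rewrite (pairing_lin 1 1 tphi k4 k5) (pairing_lin 1 1 tphi k2 k1).
  rewrite (pairing_lin 1 (c / eps) tphi k3 cu0l) !mul1r addrA.
  have z : pairing (fun _ : R => 0 * 0 + 0 * 0 : R) phi = 0.
    by rewrite (pairing_lin 0 0 tphi cz cz) !mul0r addr0.
  by rewrite h -[LHS]z; apply: eq_pairing => s s0; rewrite mul0r addr0.
have [u0l u0r] := zero_outside_boundary xl_lt_xr u0_cont u0_supp.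
have c00 : continuous (cutz xl xr (F 0%N) 0) by exact/cont2_sec1/cont2_cutz.
have clipE (x : R) : xl < x < xr -> clip xl xr x = x.
  by case/andP=> h1 h2; rewrite clip_id// !ltW.
have e00 (x : R) : xl < x < xr -> u0 x = cutz xl xr (F 0%N) 0 x.
  by move=> hx; rewrite /cutz normr0 clipE//= u_init.
have gr0 : gr 0 = 0.
  rewrite /gr /even_ext normr0; have := lim_left_of_continuous xl_lt_xr c00 e00.
  rewrite (lim_left_of_continuous xl_lt_xr u0_cont (fun x _ => erefl (u0 x))) u0r.
  by rewrite /cutz normr0 clip_id//= => <-.
have gl0 : gl 0 = 0.
  rewrite /gl /even_ext normr0; have := lim_right_of_continuous xl_lt_xr c00 e00.
  rewrite (lim_right_of_continuous xl_lt_xr u0_cont (fun x _ => erefl (u0 x))) u0l.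
  by rewrite /cutz normr0 clip_id//= => <-.
have a0 : rate alpha != 0 by rewrite gt_eqF// rate_gt0.
have en : eps != 0 by rewrite gt_eqF.
pose J t x := alpha * F 0%N (t, x) * G 1%N (t, x) - c / 2 * F 0%N (t, x) ^+ 2
    - eps * F 0%N (t, x) * F 2%N (t, x) + eps / 2 * F 1%N (t, x) ^+ 2.
have dE (t : R) : 0 < t -> is_derive t 1 (energy alpha xl xr F) (2 * J t xr - 2 * J t xl).
  by move=> t0; exact: (is_derive_energy xl_lt_xr cF cG dxF dtF pde t0).
(* The terms in [lamop'] cancel between [alpha u_tx] and [eps u_xx]; [alpha a = 1 / a] yields the
   coefficient of the exact derivative. *)
have JR (t : R) : 0 < t -> J t xr = - (rate alpha)^-1 * (gr t * G0 (t, xr)) +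
    2 / rate alpha * flux (latp c alpha) (latr alpha eps)
      (fun m => mode (latp c alpha) (latr alpha eps) m gr t) 0.
  move=> t0; rewrite -flux_identity// /J /F /G R1// R2// R1'//.
  have -> : gr t = u t xr by rewrite /gr /even_ext gtr0_norm.
  have -> : (rate alpha)^-1 = alpha * rate alpha.
    transitivity (rate alpha ^- 2 * rate alpha); first by field.
    by rewrite -alpha_rate.
  by field.
(* Solving the left condition for [u_xx] cancels [alpha u_tx] and turns [c / 2] into [- c / 2], the
   sign that occurs in the form at [x_r]. *)
have JL (t : R) : 0 < t -> - J t xl = - (rate alpha)^-1 * (gl t * G0 (t, xl)) +
    left_power c alpha eps gl he t.
  move=> t0; rewrite /J /F /G /left_power.
  have -> : gl t = u t xl by rewrite /gl /even_ext gtr0_norm.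
  have -> : he t = F1 (t, xl) by rewrite /he /even_ext gtr0_norm// trL0// ltW.
  have -> : F2 (t, xl) = - (lamop c alpha eps he t + (- alpha / eps) * G1 (t, xl))
     - (- eps^-1 * qop c alpha eps gl t + (rate alpha * eps)^-1 * G0 (t, xl)) - c / eps * u t xl.
    by rewrite -[LHS]subr0 -(L1 t t0); ring.
  by field; rewrite en a0.
move=> T T0.
have decay := energy_decay alpha_gt0 eps_gt0 (continuous_energy xl_lt_xr cFz) cger cgel chel gr0 gl0 dE
  (fun t t0 => is_derive_even_ext t0 (dgr t t0)) (fun t t0 => is_derive_even_ext t0 (dgl t t0)) JR JL T0.
have ced (t : R) : continuous (energy_density alpha xl xr F t).
  exact/cont2_sec1/cont2_energy_density.
rewrite (integral_eq_oo (ced T)); last first.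
  move=> x hx; rewrite /energy_density /cutz clipE// gtr0_norm//= F1E//.
  by apply: in0 => //; exact: ltW.
rewrite [leRHS](integral_eq_oo (ced 0)); first exact: decay.
move=> x hx; rewrite /energy_density /cutz clipE// normr0/= u_init// F1E//; last exact: in0.
congr (_ + _ * _ ^+ 2); apply: is_derive_derive1.
have d0 : is_derive x 1 (u 0) (dx 1 u 0 x) by apply: derive1_is_derive => //; exact: du.
apply: near_eq_is_derive d0.
by apply: filterS (oo x hx) => y; exact: u_init.
Qed.
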